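(* Let $\psi:\mathbb{R}\to\mathbb{C}$ be a $2\pi$-periodic function satisfying the Lipschitz condition on $[-\pi,\pi]$: there is a constant $C>0$ such that $|\psi(u)-\psi(v)|\le C|u-v|$ for all $u,v\in[-\pi,\pi]$. Let $$f(x)=-32\int_{-\pi}^{\pi}\mathrm{Re}\left[K_0\left(4e^{\pi i/4}\cosh^{1/2}(u)\sqrt{x}\right)\right]\psi(u)\sinh(u)\,du,\qquad x>0 ,$$ and let $$a_n=\frac{1}{\sinh(\pi n/2)}\int_0^\infty \mathrm{Im}\left[J_{in}\left(2\sqrt{2x}\right)\right]K_{in}\left(2\sqrt{2x}\right)f(x)\,dx,\qquad n\in\mathbb{N} .$$ For $x>0$ and $n\in\mathbb{N}$ let $$\Omega_n(x)=\int_0^\pi \mathrm{Re}\left[K_0\left(4e^{\pi i/4}\cosh^{1/2}(u)\sqrt{x}\right)\right]\sinh(u)\sin(nu)\,du .$$ Then for all $x>0$ $$f(x)=-\frac{32}{\pi^2}\sum_{n=1}^\infty \sinh(\pi n)\,\Omega_n(x)\,a_n ,$$ the series being understood as the limit of its partial sums.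
   Context: $\mathbb{N}=\{1,2,3,\dots\}$ and $i$ is the imaginary unit. $J_\nu(z)$ is the Bessel function of the first kind, $J_\nu(z)=\sum_{k=0}^\infty\frac{(-1)^k (z/2)^{\nu+2k}}{k!\,\Gamma(\nu+k+1)}$ for $z>0$, used with purely imaginary order. $K_\nu(z)$ is the modified Bessel function of the second kind (principal branch), $K_\nu(z)=\int_0^\infty e^{-z\cosh t}\cosh(\nu t)\,dt$ for $\mathrm{Re}\,z>0$. *)

(* Defs.v *)
From HB Require Import structures.
From mathcomp Require Export all_boot all_order all_algebra.
From mathcomp Require Export complex.
From mathcomp Require Export all_classical all_reals all_analysis.

Set Implicit Arguments.
Unset Strict Implicit.
Unset Printing Implicit Defensive.

Export Order.TTheory GRing.Theory Num.Theory.
Export numFieldNormedType.Exports.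

Local Open Scope classical_set_scope.
Local Open Scope complex_scope.
Local Open Scope ring_scope.

(* The norm topology of R[i], as a normed space over itself. *)
HB.instance Definition _ (R : realType) := NormedModule.copy R[i] R[i]^o.

Definition sinh {R : realType} (x : R) : R := (expR x - expR (- x)) / 2.

Definition cosh {R : realType} (x : R) : R := (expR x + expR (- x)) / 2.

Definition cexp {R : realType} (z : R[i]) : R[i] :=
  (expR (complex.Re z))%:C * (cos (complex.Im z) +i* sin (complex.Im z)).

Definition ccosh {R : realType} (z : R[i]) : R[i] :=
  (cexp z + cexp (- z)) / 2.

(* x ^ s, used only for x > 0. *)
Definition cpow {R : realType} (x : R) (s : R[i]) : R[i] :=
  cexp (s * (ln x)%:C).

(* Lebesgue integral of a complex-valued function on D; Rintegral takes junk
   values when the real or imaginary part is not integrable. *)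
Definition Cintegral {R : realType} (D : set R) (F : R -> R[i]) : R[i] :=
  (\int[lebesgue_measure]_(t in D) complex.Re (F t)) +i*
  (\int[lebesgue_measure]_(t in D) complex.Im (F t)).

(* Euler's integral: this is Gamma on the half-plane Re s > 0 only. *)
Definition cgamma {R : realType} (s : R[i]) : R[i] :=
  Cintegral `]0, +oo[ (fun t => cpow t (s - 1) * (expR (- t))%:C).

(* J_nu(z), for z > 0 and Re nu > -1, so that every cgamma below is evaluated
   in the half-plane Re s > 0; this covers the purely imaginary orders. *)
Definition besselJ {R : realType} (nu : R[i]) (z : R) : R[i] :=
  limn (fun N : nat => \sum_(0 <= k < N)
    (-1) ^+ k * cpow (z / 2) (nu + (2 * k)%:R)
      / ((k`!)%:R * cgamma (nu + k%:R + 1))).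

(* K_nu(z), for Re z > 0. *)
Definition besselK {R : realType} (nu z : R[i]) : R[i] :=
  Cintegral `[0, +oo[
    (fun t => cexp (- z * (cosh t)%:C) * ccosh (nu * t%:C)).

(* Re [K_0 (4 e^(pi i / 4) cosh^(1/2)(u) sqrt x)] *)
Definition ReK0 {R : realType} (x u : R) : R :=
  complex.Re (besselK 0 (4 * cexp ('i%C * (pi / 4)%:C)
                 * (Num.sqrt (cosh u))%:C * (Num.sqrt x)%:C)).

(* Main.v *)
(** Euler's integral for [Gamma], used termwise in the power series of [J],
    gives Weber's formula for the Laplace transform of the two real series of
    which [Im J_(in) (2 sqrt X)] is a phase-shifted combination.  Since
    [K_(in) (2 sqrt X)] is an integral of [exp (- e^t - X e^(-t))] against
    [cos (n (t - ln X / 2))], the product [Im J_(in) K_(in)] at [X = 2 x] has,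
    at [4 / s], the Laplace transform
    [- (s / 8) * int_0^oo exp (- s sinh v) sin (n v) dv].  Integrating it against
    [Re K_0 = 1/2 * int exp (- 4 x e^(-t)) cos (cosh u * e^t) dt] yields
    [- 1/16 * int_0^oo sin (n v) sinh v / (sinh^2 v + cosh^2 u) dv].  Multiplied by
    [sinh u], the rational factor becomes [(sech (v - u) - sech (v + u)) / 2], so
    that the Fourier transform [pi / cosh (pi n / 2)] of [sech] leaves a multiple
    of [sin (n u)].  Hence [a_n] is [2 pi / sinh (pi n)] times the [n]-th sine
    coefficient of [psi], and the series is Parseval's pairing of [psi] with the
    odd function [Re K_0 * sinh]. *)

(* Four obstacles shape the proof. A damping factor exp(- e exp t) is inserted; rotating the line of
   integration by pi/4 then turns oscillation into decay, with bounds independent of e, and e -> 0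
   becomes dominated convergence. Next, the power series bounds J only by a multiple of exp(2 sqrt
   X), so the bound for K must carry exactly the opposite exponent; their product leaves the
   majorant x^(-1/4). Third, the series for J needs 1/Gamma while Gamma is known through Euler's
   integral only, so Gamma(1 + i nu) <> 0 has to be proved. Last, contour shifts are done with pairs
   of real functions satisfying the Cauchy-Riemann equations, by Fubini and the fundamental theorem
   of calculus. For the transform of sech the line stops short of the pole at i pi / 2, and the
   limit is taken through a kernel of mass pi that concentrates at 0. *)
Require Import Defs.
From mathcomp Require Import measurable_realfun lebesgue_integral_fubini ring lra.

Set Implicit Arguments.
Unset Strict Implicit.
Unset Printing Implicit Defensive.

Local Open Scope classical_set_scope.
Local Open Scope complex_scope.
Local Open Scope ring_scope.

(** * Calculus on the real line *)

Section derivation_rules.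
Context {R : realType}.
Implicit Types (f g : R -> R) (x df dg c : R).

(* [is_derive] is a type class; stating derivatives through an ordinary
   definition keeps instance resolution from guessing the derivative. *)
Definition der f x df : Prop := is_derive x 1 f df.

Lemma der_eq f x df dg : der f x df -> df = dg -> der f x dg.
Proof. by move=> h <-. Qed.

Lemma der_cst c x : der (fun=> c) x 0.
Proof. exact: is_derive_cst. Qed.

Lemma der_id x : der (fun y => y) x 1.
Proof. exact: is_derive_id. Qed.

Lemma derD f g x df dg : der f x df -> der g x dg ->
  der (fun y => f y + g y) x (df + dg).
Proof. by move=> *; exact: is_deriveD. Qed.

Lemma derN f x df : der f x df -> der (fun y => - f y) x (- df).
Proof. by move=> *; exact: is_deriveN. Qed.

Lemma derM f g x df dg : der f x df -> der g x dg ->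
  der (fun y => f y * g y) x (df * g x + f x * dg).
Proof.
move=> h1 h2; apply: der_eq; first exact: (is_deriveM h1 h2).
by rewrite /GRing.scale/= addrC [df * _]mulrC.
Qed.

Lemma derV f x df : f x != 0 -> der f x df ->
  der (fun y => (f y)^-1) x (- df / f x ^+ 2).
Proof.
move=> f0 h; apply: der_eq; first exact: (is_deriveV f0 h).
by rewrite /GRing.scale/= mulNr mulrC mulNr.
Qed.

Let dcomp (F : R -> R) f x df dF : der F (f x) dF -> der f x df ->
  der (fun y => F (f y)) x (df * dF).
Proof. by move=> h1 h2; apply: der_eq; [exact: (is_derive1_comp h1 h2)|exact: mulrC]. Qed.

Lemma der_expR f x df : der f x df -> der (fun y => expR (f y)) x (df * expR (f x)).
Proof. by apply: dcomp; exact: is_derive_expR. Qed.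

Lemma der_cos f x df : der f x df -> der (fun y => cos (f y)) x (df * - sin (f x)).
Proof. by apply: dcomp; exact: is_derive_cos. Qed.

Lemma der_sin f x df : der f x df -> der (fun y => sin (f y)) x (df * cos (f x)).
Proof. by apply: dcomp; exact: is_derive_sin. Qed.

Lemma der_ln f x df : 0 < f x -> der f x df ->
  der (fun y => ln (f y)) x (df * (f x)^-1).
Proof. by move=> fx0; apply: dcomp; exact: is_derive1_ln. Qed.

Lemma derXS f x df n : der f x df ->
  der (fun y => f y ^+ n.+1) x (n.+1%:R * f x ^+ n * df).
Proof.
move=> h; elim: n => [|n IH]; first by apply: der_eq h _; rewrite expr0; ring.
have -> : (fun y => f y ^+ n.+2) = (fun y => f y * f y ^+ n.+1).
  by apply/funext => y; rewrite exprS.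
by apply: der_eq; [exact: derM h IH|rewrite -natr1 exprS; ring].
Qed.

Lemma derX f x df n : der f x df ->
  der (fun y => f y ^+ n) x (n%:R * f x ^+ n.-1 * df).
Proof.
case: n => [|n]; last exact: derXS.
by move=> _; rewrite !mul0r; exact: der_cst.
Qed.

Lemma der_sinh f x df : der f x df -> der (fun y => sinh (f y)) x (df * cosh (f x)).
Proof.
move=> h; apply: der_eq.
  by apply: derM (der_cst _ _); apply: derD; [exact: der_expR h|apply: derN; exact: der_expR (derN h)].
by rewrite /cosh; lra.
Qed.

Lemma der_cosh f x df : der f x df -> der (fun y => cosh (f y)) x (df * sinh (f x)).
Proof.
move=> h; apply: der_eq.
  by apply: derM (der_cst _ _); apply: derD; [exact: der_expR h|exact: der_expR (derN h)].
by rewrite /sinh; lra.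
Qed.

Lemma der_continuous f x df : der f x df -> {for x, continuous f}.
Proof. by move=> [h _]; apply: differentiable_continuous; exact/derivable1_diffP. Qed.

End derivation_rules.

(** [der_eq] leaves the derivative as an unknown that the rules fill in; besides side conditions
    only an identity between two expressions for it remains. [assumption] comes first so that
    derivatives of abbreviations can be supplied from the context. *)
Ltac der_step := first [ assumption | apply: der_cst | apply: der_id
  | apply: der_sinh | apply: der_cosh | apply: derD | apply: derN | apply: derM
  | apply: der_expR | apply: der_cos | apply: der_sin
  | apply: derXS | apply: derX | apply: derV | apply: der_ln ].
Ltac derive := apply: der_eq; [repeat der_step|rewrite /=].

(** * Integration on the line: improper integrals, changes of variables, Fubini, contour shifts *)

Section integration.
Context {R : realType}.
Notation mu := (@lebesgue_measure R).
Implicit Types (D : set R) (f g F : R -> R).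

Lemma integrable_le D f g : measurable D -> measurable_fun D f ->
  (forall x, D x -> `|f x| <= g x) -> mu.-integrable D (EFin \o g) ->
  mu.-integrable D (EFin \o f).
Proof.
move=> mD mf fg ig; apply: le_integrable ig => //; first exact/measurable_EFinP.
by move=> x Dx /=; rewrite lee_fin (le_trans (fg _ Dx))// ler_norm.
Qed.

Lemma norm_Rintegral_le D f g : measurable D -> measurable_fun D f ->
  (forall x, D x -> `|f x| <= g x) -> mu.-integrable D (EFin \o g) ->
  `|\int[mu]_(x in D) f x| <= \int[mu]_(x in D) g x.
Proof.
move=> mD mf fg ig; have if_ := integrable_le mD mf fg ig.
apply: (le_trans (le_normr_Rintegral (mu := mu) mD if_)).
apply: le_Rintegral => //.
apply: (integrable_le (g := g) mD) => //; first exact: measurableT_comp.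
by move=> x Dx; rewrite normr_id fg.
Qed.

Lemma integrable_scale D f (c : R) : measurable D ->
  mu.-integrable D (EFin \o f) -> mu.-integrable D (EFin \o (fun x => c * f x)).
Proof. by move=> mD fi; exact: (integrableZl (mu := mu) mD c fi). Qed.

Lemma integrable_add D f g : measurable D ->
  mu.-integrable D (EFin \o f) -> mu.-integrable D (EFin \o g) ->
  mu.-integrable D (EFin \o (fun x => f x + g x)).
Proof. by move=> mD fi gi; exact: (integrableD (mu := mu) mD fi gi). Qed.

Lemma integrable_sub D f g : measurable D ->
  mu.-integrable D (EFin \o f) -> mu.-integrable D (EFin \o g) ->
  mu.-integrable D (EFin \o (fun x => f x - g x)).
Proof. by move=> mD fi gi; exact: (integrableB (mu := mu) mD fi gi). Qed.

Lemma Rintegral_sumn D (h : nat -> R -> R) N : measurable D ->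
  (forall k, mu.-integrable D (EFin \o h k)) ->
  mu.-integrable D (EFin \o (fun x => \sum_(0 <= k < N) h k x)) /\
  \int[mu]_(x in D) (\sum_(0 <= k < N) h k x) = \sum_(0 <= k < N) \int[mu]_(x in D) h k x.
Proof.
move=> mD hi; elim: N => [|N [IHi IH]].
  under eq_fun do rewrite big_geq//.
  by split; [exact: integrable0|rewrite big_geq// /Rintegral integral0].
under eq_fun do rewrite big_nat_recr//=.
split; first exact: integrable_add.
by rewrite RintegralD// IH big_nat_recr.
Qed.

Lemma measurable_itv0y : measurable (`]0, +oo[%classic : set R).
Proof. exact: measurable_itv. Qed.

Lemma Rintegral_dominated_cvg D (h : nat -> R -> R) f g :
  measurable D -> (forall n, measurable_fun D (h n)) ->
  (forall x, D x -> h n x @[n --> \oo] --> f x) ->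
  (forall n x, D x -> `|h n x| <= g x) -> mu.-integrable D (EFin \o g) ->
  [/\ mu.-integrable D (EFin \o f) &
  (\int[mu]_(x in D) h n x) @[n --> \oo] --> \int[mu]_(x in D) f x].
Proof.
move=> mD mh hf hg ig.
have mf : measurable_fun D f by apply: (measurable_fun_cvg (h := h)) => // x /hf.
have [|||||if_ _ hc] := @dominated_convergence _ _ _ mu D mD
    (fun n x => (h n x)%:E) (EFin \o f) (EFin \o g).
- by move=> n; apply/measurable_EFinP; exact: mh.
- exact/measurable_EFinP.
- by apply/aeW => x Dx; apply: cvg_EFin; [exact: nearW|exact: hf].
- exact: ig.
- by apply/aeW => x n Dx /=; rewrite lee_fin hg.
split => //; apply: fine_cvg; rewrite fineK; first exact: hc.
exact: integrable_fin_num.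
Qed.

(** The inverse of 0 is 0 by convention, which breaks continuity there. Continuity serves on the two
    open half-lines, and the point 0 is a measurable piece of its own. *)
Lemma measurable_inv : measurable_fun setT (fun x : R => x^-1).
Proof.
have -> : [set: R] = `]-oo, 0[ `|` ([set 0] `|` `]0, +oo[).
  apply/esym; rewrite -subTset => x _ /=.
  by have [x0|x0|->] := ltgtP x 0; [left|right; right|right; left];
    rewrite ?in_itv/= ?andbT.
apply/measurable_funU => //; first exact: measurableU.
have cV (x : R) : x != 0 -> {for x, continuous (fun x : R => x^-1)}.
  by move=> x0; apply: (@continuousV _ _ id).
split.
  apply: open_continuous_measurable_fun => [|x]; first exact: open_lt.
  by rewrite inE/= in_itv/= => /lt_eqF x0; apply: cV; rewrite x0.
apply/measurable_funU => //; split; first exact: measurable_fun_set1.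
apply: open_continuous_measurable_fun => [|x].
  by rewrite set_itvoy; exact: open_gt.
by rewrite inE/= in_itv/= andbT => /gt_eqF x0; apply: cV; rewrite x0.
Qed.

Section exhaustion.
Variables (D : set R) (a b : nat -> R) (F f : R -> R) (l L : R).
Hypothesis mD : measurable D.
Hypothesis ab : forall n, a n < b n.
Hypothesis a_dec : forall n m, (n <= m)%N -> a m <= a n.
Hypothesis b_inc : forall n m, (n <= m)%N -> b n <= b m.
Hypothesis DE : D = \bigcup_n `[a n, b n]%classic.
Hypothesis dF : forall x, D x -> der F x (f x).
Hypothesis cf : forall x, D x -> {for x, continuous f}.
Hypothesis Fa : F (a n) @[n --> \oo] --> l.
Hypothesis Fb : F (b n) @[n --> \oo] --> L.

Let Dab n x : x \in `[a n, b n] -> D x.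
Proof. by move=> xn; rewrite DE; exists n. Qed.

Let FTC n : (\int[mu]_(x in `[a n, b n]) (f x)%:E = (F (b n))%:E - (F (a n))%:E)%E.
Proof.
have cF x : D x -> {for x, continuous F}.
  by move=> /dF[dx _]; apply: differentiable_continuous; exact/derivable1_diffP.
have aI : D (a n) by apply: (@Dab n); rewrite in_itv/= lexx ltW.
have bI : D (b n) by apply: (@Dab n); rewrite in_itv/= lexx ltW.
apply: continuous_FTC2 => //.
- by apply: continuous_in_subspaceT => x /set_mem/= xn; apply: cf; exact: Dab xn.
- split.
  + move=> x xn; have [] // := dF (Dab (subset_itv_oo_cc xn)).
  + by apply: cvg_at_right_filter; exact: cF.
  + by apply: cvg_at_left_filter; exact: cF.
- by move=> x xn; rewrite derive1E; have [_ ->] := dF (Dab (subset_itv_oo_cc xn)).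
Qed.

Let mf : measurable_fun D f.
Proof.
rewrite DE; apply/measurable_fun_bigcup => [n|n]; first exact: measurable_itv.
apply: subspace_continuous_measurable_fun; first exact: measurable_itv.
by apply: continuous_in_subspaceT => x /set_mem/= xn; apply: cf; exact: Dab xn.
Qed.

Let seg n := `[a n, b n]%classic.

Let nd_seg : nondecreasing_seq seg.
Proof.
move=> n m nm; apply/subsetPset; apply: subset_itv; rewrite bnd_simp.
  exact: a_dec.
exact: b_inc.
Qed.

Let mseg n : measurable (seg n). Proof. exact: measurable_itv. Qed.

Let msegf n : measurable_fun (seg n) (EFin \o f).
Proof.
apply/measurable_EFinP; apply: measurable_funS mf => // x xn.
exact: Dab xn.
Qed.

Let cvgFTC : (\int[mu]_(x in seg n) (f x)%:E)%E @[n --> \oo] --> (L - l)%:E.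
Proof.
rewrite [X in X @ _ --> _](_ : _ = EFin \o (fun n => F (b n) - F (a n))).
  by apply: cvg_EFin; [exact: nearW|exact: cvgB].
by apply/funext => n; rewrite FTC.
Qed.

(** Monotone convergence over the segments. The integral is the extended one, so finiteness belongs
    to the conclusion and the lemma also yields integrability. *)
Lemma ge0_FTC_exhaust : (forall x, D x -> 0 <= f x) ->
  (\int[mu]_(x in D) (f x)%:E = (L - l)%:E)%E.
Proof.
move=> f0.
have h := ge0_nondecreasing_set_cvg_integral (mu := mu) nd_seg mseg msegf.
rewrite DE; apply: (cvg_unique _ (h _) cvgFTC) => // n x xn.
by rewrite lee_fin f0//; exact: Dab xn.
Qed.

(** Dominated convergence: the truncations of [f] to the segments are eventually constant at each
    point and bounded by the absolute value of [f]. *)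
Lemma FTC_exhaust : mu.-integrable D (EFin \o f) -> \int[mu]_(x in D) f x = L - l.
Proof.
move=> fi.
have [||||_] := @Rintegral_dominated_cvg D (fun n => f \_ (seg n)) f (fun x => `|f x|) mD.
- move=> n; apply: measurable_funTS; apply/(measurable_restrictT _ (mseg n)).
  exact/measurable_EFinP.
- move=> x; rewrite {1}DE => -[N _ xN]; apply: cvg_near_cst.
  exists N => // n /= Nn; rewrite patchE mem_set//.
  by have /subsetPset := nd_seg Nn; apply.
- by move=> n x Dx; rewrite patchE; case: ifPn => // _; rewrite normr0.
- have -> : EFin \o (fun x => `|f x|) = abse \o (EFin \o f) by [].
  exact: integrable_abse.
move=> h; apply: (cvg_unique _ h) => //.
have -> : (fun n => \int[mu]_(x in D) (f \_ (seg n)) x) = (fun n => F (b n) - F (a n)).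
  apply/funext => n; rewrite -Rintegral_mkcondr setIidr; last exact: Dab.
  by rewrite /Rintegral FTC.
exact: cvgB.
Qed.

End exhaustion.
Lemma bigcup_itvT : [set: R] = \bigcup_n `[- (n.+1%:R), n.+1%:R]%classic.
Proof.
apply/esym; rewrite -subTset => x _ /=.
exists (Num.truncn `|x|) => //=; rewrite in_itv/= -ler_norml.
by rewrite ltW// truncnS_gt.
Qed.

Lemma bigcup_itv0y : `]0, +oo[%classic = \bigcup_n `[n.+2%:R^-1, n.+2%:R]%classic :> set R.
Proof.
apply/seteqP; split=> [x|x [n _]] /=; last first.
  by rewrite !in_itv/= andbT => /andP[+ _]; apply: lt_le_trans; rewrite invr_gt0 ltr0n.
rewrite in_itv/= andbT => x0.
pose N := maxn (Num.truncn x) (Num.truncn x^-1).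
exists N => //=; rewrite in_itv/=; apply/andP; split.
  rewrite -[leRHS]invrK lef_pV2 ?posrE ?invr_gt0 ?ltr0n//.
  rewrite (le_trans (ltW (truncnS_gt _)))// ler_nat ltnS leqW// leq_maxr//.
by rewrite (le_trans (ltW (truncnS_gt _)))// ler_nat ltnS leqW// leq_maxl.
Qed.

Section FTC_real_line.
Variables (F f : R -> R) (l L : R).
Hypothesis dF : forall x : R, der F x (f x).
Hypothesis cf : continuous f.
Hypothesis Fl : F x @[x --> -oo] --> l.
Hypothesis FL : F x @[x --> +oo] --> L.

Let cvg_nS : (n.+1%:R : R) @[n --> \oo] --> +oo.
Proof. by rewrite (cvg_shiftS (fun n => n%:R : R)); exact: cvgr_idn. Qed.

Let Fa : F (- (n.+1%:R)) @[n --> \oo] --> l.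
Proof. by apply: (cvg_comp (- (fun n => n.+1%:R : R)) F) Fl; exact/cvgNrNy. Qed.

Let Fb : F n.+1%:R @[n --> \oo] --> L.
Proof. exact: (cvg_comp _ _ cvg_nS FL). Qed.

Lemma FTC_T : mu.-integrable setT (EFin \o f) -> \int[mu]_x f x = L - l.
Proof.
move=> fi; apply: (FTC_exhaust measurableT _ _ _ bigcup_itvT _ _ Fa Fb fi) => //.
- by move=> n; rewrite -subr_gt0 opprK ltr_wpDl.
- by move=> n m nm; rewrite lerN2 ler_nat.
- by move=> n m nm; rewrite ler_nat.
- by move=> x _; exact: cf.
Qed.

End FTC_real_line.

Section affine.
Variables (a b : R).
Hypothesis a0 : a != 0.
Let phi (x : R) := a * x + b.

Let mphi : measurable_fun setT phi.
Proof. by apply: measurable_funD => //; exact: mulrl_measurable. Qed.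

(** [|a|] times Lebesgue measure, transported by [phi]. Once it is seen to be Lebesgue measure
    again, by comparison on half-open intervals, the affine change of variables is integration
    against an image measure. *)
Let nu : {measure set (measurableTypeR R) -> \bar R}.
Proof.
refine (pushforward (mscale (NngNum (normr_ge0 a)) mu)
  (phi : measurableTypeR R -> measurableTypeR R)).
exact: mphi.
Defined.

Let nuE A : measurable A -> mu A = nu A.
Proof.
apply: lebesgue_measure_unique => X /ocitvP[->|[[c d] /= cd ->]].
  by rewrite !measure0.
rewrite /nu/= /pushforward/= /mscale/= lebesgue_measure_itv/= lte_fin cd.
have [ap|an] : (0 < a) \/ (a < 0) by move: a0; rewrite neq_lt => /orP[]; [right|left].
  have -> : phi @^-1` `]c, d] = `](c - b) / a, (d - b) / a]%classic.
    apply/seteqP; split=> x; rewrite /phi/= !in_itv/= => /andP[h1 h2].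
      by rewrite ltr_pdivrMr// ler_pdivlMr// ltrBlDr lerBrDr mulrC h1.
    by move: h1 h2; rewrite ltr_pdivrMr// ler_pdivlMr// ltrBlDr lerBrDr mulrC => -> ->.
  rewrite lebesgue_measure_itv/= lte_fin ltr_pM2r ?invr_gt0// ltrD2r cd.
  by rewrite -EFinD -!EFinM gtr0_norm//; congr EFin; field; rewrite gt_eqF.
(* For negative [a] the preimage is the reversed interval, closed on the left instead of on the
   right; its length is the same. *)
have -> : phi @^-1` `]c, d] = `[(d - b) / a, (c - b) / a[%classic.
  apply/seteqP; split=> x; rewrite /phi/= !in_itv/= => /andP[h1 h2].
    by rewrite ltr_ndivlMr// ler_ndivrMr// ltrBlDr lerBrDr mulrC h1 h2.
  by move: h1 h2; rewrite ltr_ndivlMr// ler_ndivrMr// ltrBlDr lerBrDr mulrC => -> ->.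
rewrite lebesgue_measure_itv/= lte_fin ltr_nM2r ?invr_lt0// ltrD2r cd.
by rewrite -EFinD -!EFinM ltr0_norm//; congr EFin; field; rewrite lt_eqF.
Qed.

Lemma ge0_integral_affine (f : R -> \bar R) : measurable_fun setT f ->
  (forall x, 0 <= f x)%E ->
  (\int[mu]_x f x = `|a|%:E * \int[mu]_x f (a * x + b)%R)%E.
Proof.
move=> mf f0; rewrite (eq_measure_integral nu); last by move=> A mA _; exact: nuE.
rewrite ge0_integral_pushforward//= preimage_setT ge0_integral_mscale//=.
exact: measurableT_comp.
Qed.

Lemma integrable_affine f : mu.-integrable setT (EFin \o f) ->
  mu.-integrable setT (EFin \o (fun x => f (a * x + b))).
Proof.
move=> /integrableP[/measurable_EFinP mf]; rewrite ge0_integral_affine//; last first.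
  by apply: measurableT_comp => //; exact/measurable_EFinP.
move=> fi; apply/integrableP; split.
  by apply/measurable_EFinP; exact: measurableT_comp.
move: fi; rewrite !ltey; apply: contraNneq => ->.
by rewrite gt0_muley// lte_fin normr_gt0.
Qed.

(** The nonnegative case is applied to the positive and negative parts of [f]. *)
Lemma Rintegral_affine f : mu.-integrable setT (EFin \o f) ->
  \int[mu]_x f x = `|a| * \int[mu]_x f (a * x + b).
Proof.
have P g : mu.-integrable setT (EFin \o g) -> (forall x, 0 <= g x) ->
    \int[mu]_x g x = `|a| * \int[mu]_x g (a * x + b).
  move=> gi g0; have gai := integrable_affine gi.
  rewrite {1}/Rintegral ge0_integral_affine; last 2 first.
  - by case/integrableP : gi.
  - by move=> x; rewrite lee_fin.
  by rewrite fineM//; exact: (integrable_fin_num _ gai).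
move=> fi; have /integrableP[/measurable_EFinP mf _] := fi.
have ip : mu.-integrable setT (EFin \o (fun x => `|f x|)) := integrable_abse fi.
pose fp x := Num.max (f x) 0; pose fn x := Num.max (- f x) 0.
have fE : f = fun x => fp x - fn x.
  by apply/funext => x; rewrite /fp /fn; case: (leP (f x) 0); case: (leP (- f x) 0); lra.
have fpi : mu.-integrable setT (EFin \o fp).
  apply: integrable_le ip => //; first exact: measurable_maxr.
  by move=> x _; rewrite /fp; case: (leP (f x) 0); rewrite ?normr0.
have fni : mu.-integrable setT (EFin \o fn).
  apply: integrable_le ip => //.
    by apply: measurable_maxr => //; exact: measurableT_comp.
  by move=> x _; rewrite /fn; case: (leP (- f x) 0); rewrite ?normr0 ?normrN.
have fp0 x : 0 <= fp x by rewrite /fp le_max lexx orbT.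
have fn0 x : 0 <= fn x by rewrite /fn le_max lexx orbT.
rewrite fE RintegralB// (P fp)// (P fn)// RintegralB//; first by rewrite mulrBr.
- exact: integrable_affine.
- exact: integrable_affine.
Qed.

End affine.

Section FTC_half_line.
Variables (F f : R -> R) (l L : R).
Hypothesis dF : forall x : R, 0 < x -> der F x (f x).
Hypothesis cf : forall x : R, 0 < x -> {for x, continuous f}.
Hypothesis Fl : F x @[x --> 0^'+] --> l.
Hypothesis FL : F x @[x --> +oo] --> L.

Let cvg_nS : (n.+2%:R : R) @[n --> \oo] --> +oo.
Proof.
rewrite (cvg_shiftS (fun n => n.+1%:R : R)) (cvg_shiftS (fun n => n%:R : R)).
exact: cvgr_idn.
Qed.

Let Fa : F (n.+2%:R^-1) @[n --> \oo] --> l.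
Proof.
apply: ((cvg_at_rightP _ _ _).1 Fl); split => [n|]; first by rewrite invr_gt0.
rewrite (cvg_shiftS (fun n => n.+1%:R^-1 : R)); exact: cvg_harmonic.
Qed.

Let Fb : F n.+2%:R @[n --> \oo] --> L.
Proof. exact: (cvg_comp _ _ cvg_nS FL). Qed.

Let lt_seg n : n.+2%:R^-1 < n.+2%:R :> R.
Proof. by rewrite (@lt_trans _ _ 1)// ?invf_lt1// ltr1n. Qed.

Lemma ge0_FTC_0y : (forall x, 0 < x -> 0 <= f x) ->
  (\int[mu]_(x in `]0%R, +oo[) (f x)%:E = (L - l)%:E)%E.
Proof.
move=> f0; apply: (ge0_FTC_exhaust _ lt_seg _ _ bigcup_itv0y _ _ Fa Fb) => //.
- by move=> n m nm; rewrite lef_pV2 ?posrE ?ltr0n// ler_nat.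
- by move=> n m nm; rewrite ler_nat.
- by move=> x /=; rewrite in_itv/= andbT; exact: dF.
- by move=> x /=; rewrite in_itv/= andbT; exact: cf.
- by move=> x /=; rewrite in_itv/= andbT; exact: f0.
Qed.

Lemma FTC_0y : mu.-integrable `]0%R, +oo[ (EFin \o f) ->
  \int[mu]_(x in `]0, +oo[) f x = L - l.
Proof.
move=> fi; apply: (FTC_exhaust _ lt_seg _ _ bigcup_itv0y _ _ Fa Fb) => //.
- by move=> n m nm; rewrite lef_pV2 ?posrE ?ltr0n// ler_nat.
- by move=> n m nm; rewrite ler_nat.
- by move=> x /=; rewrite in_itv/= andbT; exact: dF.
- by move=> x /=; rewrite in_itv/= andbT; exact: cf.
Qed.

End FTC_half_line.

Lemma mem_itv0y (x : R) : (x \in `]0, +oo[%classic) = (0 < x).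
Proof.
apply/idP/idP => [/set_mem/=|x0]; rewrite ?in_itv/= ?andbT//.
by apply/mem_set; rewrite /= in_itv/= andbT.
Qed.

Lemma mem_itvNy0 (x : R) : (x \in `]-oo, 0[%classic) = (x < 0).
Proof.
apply/idP/idP => [/set_mem/=|x0]; rewrite ?in_itv//=.
by apply/mem_set; rewrite /= in_itv.
Qed.

Lemma Rintegral_scale_0y (c : R) f : 0 < c ->
  mu.-integrable `]0, +oo[ (EFin \o f) ->
  \int[mu]_(x in `]0, +oo[) f x = c * \int[mu]_(x in `]0, +oo[) f (c * x).
Proof.
move=> c0 fi.
have fi' : mu.-integrable setT (EFin \o (f \_ `]0, +oo[)).
  by rewrite -restrict_EFin; apply: (integrable_mkcond _ _).1 => //.
rewrite Rintegral_mkcond (Rintegral_affine 0 (lt0r_neq0 c0) fi') gtr0_norm//.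
congr (_ * _); rewrite [RHS]Rintegral_mkcond; apply: eq_Rintegral => x _.
rewrite addr0 !patchE; congr (if _ then _ else _).
by rewrite !mem_itv0y pmulr_rgt0.
Qed.

Lemma integrable_scale_0y (c : R) f : 0 < c ->
  mu.-integrable `]0, +oo[ (EFin \o f) ->
  mu.-integrable `]0, +oo[ (EFin \o (fun x => f (c * x))).
Proof.
move=> c0 fi.
have fi' : mu.-integrable setT (EFin \o (f \_ `]0, +oo[)).
  by rewrite -restrict_EFin; apply: (integrable_mkcond _ _).1 => //.
have := integrable_affine 0 (lt0r_neq0 c0) fi'.
move=> h; apply: (integrable_mkcond _ _).2 => //; rewrite restrict_EFin.
apply: eq_integrable h => // x _ /=; rewrite addr0 !patchE !mem_itv0y.
by rewrite pmulr_rgt0.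
Qed.

Lemma Rintegral_even f : mu.-integrable setT (EFin \o f) ->
  (forall x, f (- x) = f x) ->
  \int[mu]_x f x = 2 * \int[mu]_(x in `]0, +oo[) f x.
Proof.
move=> fi fE.
have fp : mu.-integrable `]0, +oo[ (EFin \o f) by exact: integrableS fi.
have fn : mu.-integrable `]-oo, 0[ (EFin \o f) by exact: integrableS fi.
have fn' : mu.-integrable `]-oo, 0] (EFin \o f) by exact: integrableS fi.
have TE : [set: R] = `]-oo, 0] `|` `]0, +oo[ by rewrite -setCitvr setvU.
rewrite TE Rintegral_setU//=; last 2 first.
- by rewrite -TE.
- rewrite disj_set2E; apply/eqP/seteqP; split=> // x [] /=.
  by rewrite !in_itv/= andbT => /le_lt_trans h /h; rewrite ltxx.
rewrite -Rintegral_itv_bndo_bndc//.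
suff -> : \int[mu]_(x in `]-oo, 0[) f x = \int[mu]_(x in `]0, +oo[) f x.
  by rewrite mulr2n mulrDl mul1r.
have fi' : mu.-integrable setT (EFin \o (f \_ `]-oo, 0[)).
  by rewrite -restrict_EFin; apply: (integrable_mkcond _ _).1 => //.
have N1 : (-1 : R) != 0 by rewrite oppr_eq0.
rewrite Rintegral_mkcond (Rintegral_affine 0 N1 fi') normrN normr1 mul1r.
rewrite [RHS]Rintegral_mkcond; apply: eq_Rintegral => x _.
rewrite addr0 mulN1r !patchE fE; congr (if _ then _ else _).
by rewrite mem_itvNy0 mem_itv0y oppr_lt0.
Qed.

Lemma Rintegral_odd f : mu.-integrable setT (EFin \o f) ->
  (forall x, f (- x) = - f x) -> \int[mu]_x f x = 0.
Proof.
move=> fi fE; have N1 : (-1 : R) != 0 by rewrite oppr_eq0.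
have := Rintegral_affine 0 N1 fi; rewrite normrN normr1 mul1r.
have -> : (fun x => f (-1 * x + 0)) = (fun x => -1 * f x).
  by apply/funext => x; rewrite addr0 mulN1r fE mulN1r.
by rewrite RintegralZl// => h; lra.
Qed.

Lemma Rintegral_shift (b : R) f : mu.-integrable setT (EFin \o f) ->
  \int[mu]_x f x = \int[mu]_x f (x + b).
Proof.
move=> fi; rewrite (Rintegral_affine b (oner_neq0 _) fi) normr1 mul1r.
by congr Rintegral; apply/funext => x; rewrite mul1r.
Qed.

Lemma integrable_shift (b : R) f : mu.-integrable setT (EFin \o f) ->
  mu.-integrable setT (EFin \o (fun x => f (x + b))).
Proof.
move=> /(integrable_affine b (oner_neq0 _)).
by under eq_fun do rewrite mul1r.
Qed.

(** The last hypothesis is in Tonelli form and gives integrability on the product. A real-valued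
    inner integral replaces an infinite value by 0; this happens only on a null set, so the outer
    integrals do not see it. *)
Lemma Rintegral_fubini (D1 D2 : set R) (F : R * R -> R) (g : R -> R) :
  measurable D1 -> measurable D2 -> measurable_fun setT F ->
  mu.-integrable D1 (EFin \o g) ->
  (forall x, D1 x -> \int[mu]_(y in D2) `|F (x, y)|%:E <= (g x)%:E)%E ->
  \int[mu]_(x in D1) \int[mu]_(y in D2) F (x, y) =
  \int[mu]_(y in D2) \int[mu]_(x in D1) F (x, y).
Proof.
move=> mD1 mD2 mF gi Fg.
pose G := F \_ (D1 `*` D2).
have mG : measurable_fun setT G.
  apply/(measurable_restrictT F (measurableX mD1 mD2)).
  exact: measurable_funTS.
pose T := measurableTypeR R.
have mG' : measurable_fun [set: T * T] G := mG.
have GE x y : G (x, y) = if x \in D1 then (fun y => F (x, y)) \_ D2 y else 0.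
  rewrite /G patchE [in RHS]patchE.
  have -> : ((x, y) \in D1 `*` D2) = (x \in D1) && (y \in D2).
    apply/idP/andP => [/set_mem[/= ? ?]|[/set_mem ? /set_mem ?]].
      by split; exact/mem_set.
    exact/mem_set.
  by case: (x \in D1); case: (y \in D2).
have iG : (product_measure1 mu mu).-integrable [set: T * T] (EFin \o G).
  apply/(integrable12ltyP mu mu); first exact/measurable_EFinP.
  have /integrableP[mg] := gi; apply: le_lt_trans.
  rewrite [leRHS]integral_mkcond; apply: ge0_le_integral => //.
  - by move=> x _; exact: integral_ge0.
  - apply: (@measurable_fun_fubini_tonelli_F _ _ T T R mu (abse \o (EFin \o G))) => //.
      by apply: measurableT_comp => //; exact/measurable_EFinP.
    by move=> z; exact: abse_ge0.
  - by apply/(measurable_restrictT _ mD1); exact: measurableT_comp.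
  move=> x _; rewrite patchE; case: ifPn => xD1; last first.
    by rewrite integral0_eq// => y _ /=; rewrite GE (negbTE xD1) normr0.
  apply: (@le_trans _ _ (g x)%:E); last by rewrite /= lee_fin ler_norm.
  apply: le_trans (Fg _ (set_mem xD1)); rewrite [leRHS]integral_mkcond.
  rewrite le_eqVlt; apply/orP; left; apply/eqP; apply: eq_integral => y _ /=.
  by rewrite GE xD1 !patchE; case: ifPn => //; rewrite normr0.
have fineI H : measurable_fun setT H -> {ae mu, forall x, H x \is a fin_num} ->
    (\int[mu]_x (fine (H x))%:E = \int[mu]_x H x)%E.
  move=> mH [N [mN N0 HN]]; apply: ae_eq_integral => //.
    by apply/measurable_EFinP; exact: measurableT_comp.
  exists N; split => // x; apply: contra_notP => xN _.
  by rewrite fineK//; apply: contrapT => h; apply: xN; exact: HN.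
have -> : \int[mu]_(x in D1) \int[mu]_(y in D2) F (x, y) =
    fine (\int[mu]_x (fine (\int[mu]_y (G (x, y))%:E))%:E)%E.
  rewrite Rintegral_mkcond; congr fine; apply: eq_integral => x _; congr EFin.
  rewrite patchE; case: ifPn => xD1; last first.
    by rewrite integral0_eq// => y _ /=; rewrite GE (negbTE xD1).
  rewrite Rintegral_mkcond; congr fine; apply: eq_integral => y _.
  by rewrite GE xD1.
have -> : \int[mu]_(y in D2) \int[mu]_(x in D1) F (x, y) =
    fine (\int[mu]_y (fine (\int[mu]_x (G (x, y))%:E))%:E)%E.
  rewrite Rintegral_mkcond; congr fine; apply: eq_integral => y _; congr EFin.
  rewrite patchE; case: ifPn => yD2; last first.
    by rewrite integral0_eq// => x _ /=; rewrite GE patchE (negbTE yD2) if_same.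
  rewrite Rintegral_mkcond; congr fine; apply: eq_integral => x _.
  by rewrite GE !patchE yD2.
rewrite (fineI _ (measurable_fubini_F iG)); last first.
  have [N [mN N0 HN]] := ae_integrable1 iG.
  exists N; split => //; apply: subset_trans HN; apply: subsetC => x /=.
  exact: integrable_fin_num.
rewrite (fineI _ (measurable_fubini_G iG)); last first.
  have [N [mN N0 HN]] := ae_integrable2 iG.
  exists N; split => //; apply: subset_trans HN; apply: subsetC => x /=.
  exact: integrable_fin_num.
by congr fine; exact: (Fubini iG).
Qed.

(** The integral is the difference of those of the positive and negative parts, and each of these is
    measurable in the parameter by Tonelli. *)
Lemma measurable_Rintegral d (T : measurableType d) (F : T * R -> R) :
  measurable_fun setT F -> measurable_fun setT (fun x => \int[mu]_y F (x, y)).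
Proof.
move=> mF.
pose P z := Num.max (F z) 0; pose N z := Num.max (- F z) 0.
have mP : measurable_fun setT P by exact: measurable_maxr.
have mN : measurable_fun setT N.
  by apply: measurable_maxr => //; exact: measurableT_comp.
rewrite /Rintegral; apply: measurableT_comp => //.
have -> : (fun x => \int[mu]_y (F (x, y))%:E)%E =
   (fun x => \int[mu]_y (P (x, y))%:E - \int[mu]_y (N (x, y))%:E)%E.
  apply/funext => x; rewrite integralE; congr (_ - _)%E; apply: eq_integral => y _.
    by rewrite funeposE/= EFin_max.
  by rewrite funenegE/= EFin_max.
apply: emeasurable_funB.
  apply: (@measurable_fun_fubini_tonelli_F _ _ T (measurableTypeR R) R mu (EFin \o P)) => //.
    exact/measurable_EFinP.
  by move=> z /=; rewrite lee_fin /P le_max lexx orbT.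
apply: (@measurable_fun_fubini_tonelli_F _ _ T (measurableTypeR R) R mu (EFin \o N)) => //.
  exact/measurable_EFinP.
by move=> z /=; rewrite lee_fin /N le_max lexx orbT.
Qed.

(** A contour shift in real terms. [P] and [Q] play the real and imaginary parts of a holomorphic
    function of v + i b, and [d] is both the b-derivative of [P] and minus the v-derivative of [Q].
    The difference of the two integrals is the double integral of [d]; integrated in v first, it
    vanishes because [Q] dies at both ends. *)
Lemma Rintegral_CR_const (P Q d : R -> R -> R) (b0 b1 : R) (g : R -> R) :
  b0 < b1 ->
  (forall v b : R, b0 <= b <= b1 -> der (P v) b (d v b)) ->
  (forall v b : R, b0 <= b <= b1 -> der (Q ^~ b) v (- d v b)) ->
  (forall v b : R, b0 <= b <= b1 -> {for b, continuous (d v)}) ->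
  (forall b : R, b0 <= b <= b1 -> continuous (d ^~ b)) ->
  measurable_fun setT (fun p : R * R => d p.1 p.2) ->
  (forall v b : R, b0 <= b <= b1 -> `|d v b| <= g v) ->
  mu.-integrable setT (EFin \o g) ->
  (forall b : R, b0 <= b <= b1 -> Q v b @[v --> -oo] --> 0) ->
  (forall b : R, b0 <= b <= b1 -> Q v b @[v --> +oo] --> 0) ->
  mu.-integrable setT (EFin \o P ^~ b0) ->
  mu.-integrable setT (EFin \o P ^~ b1) ->
  \int[mu]_v P v b0 = \int[mu]_v P v b1.
Proof.
move=> b01 dP dQ cdb cdv md dg ig QNy Qy iP0 iP1.
have mI : measurable `[b0, b1] by exact: measurable_itv.
have Ib b : b \in `]b0, b1[ -> b0 <= b <= b1.
  by rewrite in_itv/= => /andP[/ltW -> /ltW ->].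
have cP v b : b0 <= b <= b1 -> {for b, continuous (P v)}.
  by move=> /(dP v)[dx _]; apply: differentiable_continuous; exact/derivable1_diffP.
have FTC v : \int[mu]_(b in `[b0, b1]) d v b = P v b1 - P v b0.
  rewrite /Rintegral (@continuous_FTC2 _ (d v) (P v))//.
  - by apply: continuous_in_subspaceT => x /set_mem/=; rewrite in_itv/=; exact: cdb.
  - split.
    + by move=> x /Ib/(dP v)[].
    + by apply: cvg_at_right_filter; apply: cP; rewrite lexx ltW.
    + by apply: cvg_at_left_filter; apply: cP; rewrite lexx ltW.
  - by move=> x /Ib/(dP v) h; rewrite derive1E; have [_ ->] := h.
apply/eqP; rewrite eq_sym -subr_eq0 -RintegralB//.
under eq_Rintegral do rewrite -FTC.
rewrite (@Rintegral_fubini setT `[b0, b1]%classic (fun p => d p.1 p.2)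
  (fun v => (b1 - b0) * g v))//=.
- apply/eqP; rewrite (_ : 0 = \int[mu]_(b in `[b0, b1]) 0); last first.
    by rewrite Rintegral_cst// mul0r.
  apply: eq_Rintegral => b /set_mem/=; rewrite in_itv/= => bI.
  have dvi : mu.-integrable setT (EFin \o d ^~ b).
    apply: integrable_le ig => //; first exact: continuous_measurable_fun (cdv _ bI).
    by move=> v _; exact: dg.
  have := @FTC_T (fun v => - Q v b) (d ^~ b) 0 0; rewrite subrr; apply => //.
  + move=> v; by have := derN (dQ v b bI); rewrite opprK.
  + exact: cdv.
  + by rewrite -oppr0; apply: cvgN; exact: QNy.
  + by rewrite -oppr0; apply: cvgN; exact: Qy.
- exact: (integrableZl measurableT (b1 - b0) ig).
- move=> v _; apply: (@le_trans _ _ (\int[mu]_(b in `[b0, b1]) (g v)%:E)%E).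
    apply: ge0_le_integral => //.
    + apply/measurable_EFinP; apply: measurableT_comp => //; apply: measurable_funTS.
      exact: (measurableT_comp md (pair1_measurable v)).
    + by move=> b bI; rewrite lee_fin dg.
  by rewrite integral_cst//= lebesgue_measure_itv/= lte_fin b01 -EFinD -EFinM mulrC.
Qed.

Section substitution.
Variables (phi phi' g : R -> R).
Hypothesis dphi : forall t : R, der phi t (phi' t).
Hypothesis cphi' : continuous phi'.
Hypothesis phi0 : forall t, 0 < phi t.
Hypothesis phiNy : phi t @[t --> -oo] --> 0.
Hypothesis phiy : phi t @[t --> +oo] --> +oo.
Hypothesis cg : continuous g.
Hypothesis ig : mu.-integrable `]0, +oo[ (EFin \o g).
Hypothesis igphi : mu.-integrable setT (EFin \o (fun t => g (phi t) * phi' t)).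

Let H v := \int[mu]_(x in `[0, v]) g x.

Let ig_seg v : mu.-integrable `[0, v] (EFin \o g).
Proof.
apply: continuous_compact_integrable; first exact: segment_compact.
exact: continuous_subspaceT.
Qed.

Let dH (v : R) : 0 < v -> der H v (g v).
Proof.
move=> v0; have vI : v < v + 1 by rewrite ltrDl.
have [dHv H'v] : derivable H v 1 /\ (H^`())%classic v = g v.
  exact: (continuous_FTC1_closed vI (ig_seg _) v0 (@cg v)).
by apply: DeriveDef; [exact: dHv|rewrite -derive1E].
Qed.

Let cphi : continuous phi.
Proof.
by move=> t; have [dt _] := dphi t; apply: differentiable_continuous; exact/derivable1_diffP.
Qed.

Let HE v : H v = \int[mu]_(x in `]0, +oo[) (g \_ `]0, v]) x.
Proof.
rewrite /H -Rintegral_itv_obnd_cbnd; last first.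
  by apply: integrableS (ig_seg v) => //; apply: subset_itv; rewrite bnd_simp.
rewrite -Rintegral_mkcondr; congr (Rintegral mu _ g); apply/seteqP; split=> x /=.
  by rewrite !in_itv/= andbT => /andP[-> ->].
by rewrite !in_itv/= andbT => -[_ ->].
Qed.

Let Hcvg (u : nat -> R) (f : R -> R) :
  (forall x : R, 0 < x -> (g \_ `]0, u n]) x @[n --> \oo] --> f x) ->
  H (u n) @[n --> \oo] --> \int[mu]_(x in `]0, +oo[) f x.
Proof.
move=> uf; rewrite [X in X @ _ --> _](_ : _ =
    fun n => \int[mu]_(x in `]0, +oo[) (g \_ `]0, u n]) x); last first.
  by apply/funext => n; exact: HE.
have [||||//] := @Rintegral_dominated_cvg `]0, +oo[%classic
    (fun n => g \_ `]0, u n]) f (fun x => `|g x|) (measurable_itv _).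
- move=> n; apply: measurable_funTS; apply/(measurable_restrictT _ (measurable_itv _)).
  by apply: measurable_funTS; exact: continuous_measurable_fun.
- by move=> x /=; rewrite in_itv/= andbT; exact: uf.
- by move=> n x _; rewrite patchE; case: ifPn => // _; rewrite normr0.
- exact: (integrable_abse ig).
Qed.

(** [H \o phi] is a primitive of the left integrand. Its limits at the two ends are 0 and the full
    integral of [g], by dominated convergence of the truncations of [g] to []0, phi t]]. *)
Lemma Rintegral_subst_T0y :
  \int[mu]_t (g (phi t) * phi' t) = \int[mu]_(x in `]0, +oo[) g x.
Proof.
have cvg_nS : (n.+1%:R : R) @[n --> \oo] --> +oo.
  by rewrite (cvg_shiftS (fun n => n%:R : R)); exact: cvgr_idn.
have memv (v x : R) : 0 < x -> (x \in `]0, v]%classic) = (x <= v).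
  move=> x0; apply/idP/idP => [/set_mem/=|xv]; first by rewrite in_itv/= x0.
  by apply/mem_set; rewrite /= in_itv/= x0.
rewrite -[RHS]subr0.
apply: (FTC_exhaust (F := H \o phi) measurableT _ _ _ bigcup_itvT _ _ _ _ igphi) => //.
- by move=> n; rewrite -subr_gt0 opprK ltr_wpDl.
- by move=> n m nm; rewrite lerN2 ler_nat.
- by move=> n m nm; rewrite ler_nat.
- by move=> t _; exact: is_derive1_comp (dH (phi0 t)) (dphi t).
- move=> t _; apply: cvgM; last exact: cphi'.
  by apply: continuous_comp; [exact: cphi|exact: cg].
- rewrite [X in _ --> X](_ : _ = \int[mu]_(x in `]0, +oo[) 0); last first.
    by rewrite /Rintegral integral0.
  apply: (@Hcvg (fun n => phi (- (n.+1%:R)))) => x x0.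
  have h : phi (- (n.+1%:R)) @[n --> \oo] --> 0.
    by apply: (cvg_comp (- (fun n => n.+1%:R : R)) phi) phiNy; exact/cvgNrNy.
  move/cvgrPdist_lt : h =>/(_ _ x0)[N _ HN].
  apply: cvg_near_cst; exists N => // n /= /HN; rewrite sub0r normrN => hx.
  rewrite patchE memv// leNgt (le_lt_trans (ler_norm _) hx)//.
- apply: (@Hcvg (fun n => phi (n.+1%:R))) => x x0.
  have /cvgryPge/(_ x)[N _ HN] := cvg_comp _ _ cvg_nS phiy.
  apply: cvg_near_cst; exists N => // n /= /HN hx.
  by rewrite patchE memv// hx.
Qed.

End substitution.

End integration.

(** * Rules for proving measurability by structure *)

Section measurability_rules.
Context {R : realType} d {T : measurableType d}.
Implicit Types (D : set T) (f g : T -> R).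

Lemma mfun_cst D (c : R) : measurable_fun D (fun=> c : R).
Proof. exact: measurable_cst. Qed.

Lemma mfunD D f g : measurable_fun D f -> measurable_fun D g ->
  measurable_fun D (fun x => f x + g x).
Proof. exact: measurable_funD. Qed.

Lemma mfunN D f : measurable_fun D f -> measurable_fun D (fun x => - f x).
Proof. by move=> h; apply: measurableT_comp. Qed.

Lemma mfunM D f g : measurable_fun D f -> measurable_fun D g ->
  measurable_fun D (fun x => f x * g x).
Proof. exact: measurable_funM. Qed.

Lemma mfunV D f : measurable_fun D f -> measurable_fun D (fun x => (f x)^-1).
Proof. by move=> h; apply: measurableT_comp => //; exact: measurable_inv. Qed.

Lemma mfun_norm D f : measurable_fun D f -> measurable_fun D (fun x => `|f x|).
Proof. by move=> h; apply: measurableT_comp. Qed.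

Lemma mfunX D f n : measurable_fun D f -> measurable_fun D (fun x => f x ^+ n).
Proof. by move=> h; exact: measurable_funX. Qed.

Lemma mfun_comp (F : R -> R) D f : continuous F -> measurable_fun D f ->
  measurable_fun D (fun x => F (f x)).
Proof. by move=> cF h; apply: measurableT_comp => //; exact: continuous_measurable_fun. Qed.

Lemma mfun_expR D f : measurable_fun D f -> measurable_fun D (fun x => expR (f x)).
Proof. by apply: mfun_comp; exact: continuous_expR. Qed.

Lemma mfun_cos D f : measurable_fun D f -> measurable_fun D (fun x => cos (f x)).
Proof. by apply: mfun_comp; exact: continuous_cos. Qed.

Lemma mfun_sin D f : measurable_fun D f -> measurable_fun D (fun x => sin (f x)).
Proof. by apply: mfun_comp; exact: continuous_sin. Qed.

Lemma mfun_sqrt D f : measurable_fun D f -> measurable_fun D (fun x => Num.sqrt (f x)).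
Proof. by apply: mfun_comp => x; exact: sqrt_continuous. Qed.

Lemma mfun_sinh D f : measurable_fun D f -> measurable_fun D (fun x => sinh (f x)).
Proof.
by apply: mfun_comp => x; apply: der_continuous; apply: der_sinh; exact: der_id.
Qed.

Lemma mfun_cosh D f : measurable_fun D f -> measurable_fun D (fun x => cosh (f x)).
Proof.
by apply: mfun_comp => x; apply: der_continuous; apply: der_cosh; exact: der_id.
Qed.

Lemma mfun_ln D f : measurable_fun D f -> measurable_fun D (fun x => ln (f x)).
Proof. by move=> h; apply: measurableT_comp => //; exact: measurable_ln. Qed.

End measurability_rules.

Lemma mfun_id {R : realType} (D : set R) : measurable_fun D (fun x : R => x).
Proof. exact: measurable_id. Qed.
Lemma mfun_fst {R : realType} (D : set (R * R)) : measurable_fun D (fun p : R * R => p.1).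
Proof. by apply: measurable_funTS; exact: measurable_fst. Qed.
Lemma mfun_snd {R : realType} (D : set (R * R)) : measurable_fun D (fun p : R * R => p.2).
Proof. by apply: measurable_funTS; exact: measurable_snd. Qed.

Ltac mfun_step := first [ assumption | match goal with
  | |- measurable_fun _ (fun _ => ?c) => apply: mfun_cst
  | |- measurable_fun _ (fun x => @?f x + @?g x) => apply: mfunD
  | |- measurable_fun _ (fun x => - @?f x) => apply: mfunN
  | |- measurable_fun _ (fun x => @?f x * @?g x) => apply: mfunM
  | |- measurable_fun _ (fun x => (@?f x)^-1) => apply: mfunV
  | |- measurable_fun _ (fun x => @?f x ^+ _) => apply: mfunX
  | |- measurable_fun _ (fun x => `|@?f x|) => apply: mfun_norm
  | |- measurable_fun _ (fun x => expR (@?f x)) => apply: mfun_expR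
  | |- measurable_fun _ (fun x => cos (@?f x)) => apply: mfun_cos
  | |- measurable_fun _ (fun x => sin (@?f x)) => apply: mfun_sin
  | |- measurable_fun _ (fun x => sinh (@?f x)) => apply: mfun_sinh
  | |- measurable_fun _ (fun x => cosh (@?f x)) => apply: mfun_cosh
  | |- measurable_fun _ (fun x => Num.sqrt (@?f x)) => apply: mfun_sqrt
  | |- measurable_fun _ (fun x => ln (@?f x)) => apply: mfun_ln
  | |- measurable_fun _ (fun x => x) => apply: mfun_id
  | |- measurable_fun _ (fun x => x.1) => apply: mfun_fst
  | |- measurable_fun _ (fun x => x.2) => apply: mfun_snd
  end
  | apply: mfun_cst | apply: mfun_id | apply: mfun_fst | apply: mfun_snd | apply: mfunD | apply: mfunN | apply: mfunM
  | apply: mfun_expR | apply: mfun_cos | apply: mfun_sin | apply: mfunV | apply: mfunX | apply: mfun_norm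
  | apply: mfun_sqrt | apply: mfun_ln | apply: mfun_sinh | apply: mfun_cosh ].
Ltac mfun := repeat mfun_step.

(** * Hyperbolic functions *)

Section hyperbolic.
Context {R : realType}.
Implicit Types x y : R.

Lemma sinhN x : sinh (- x) = - sinh x.
Proof. by rewrite /sinh opprK; lra. Qed.

Lemma coshN x : cosh (- x) = cosh x.
Proof. by rewrite /cosh opprK addrC. Qed.

Lemma coshD x y : cosh (x + y) = cosh x * cosh y + sinh x * sinh y.
Proof. by rewrite /cosh /sinh opprD !expRD; lra. Qed.

Lemma cosh2Bsinh2 x : cosh x ^+ 2 = 1 + sinh x ^+ 2.
Proof. by rewrite /cosh /sinh; have := expRxMexpNx_1 x; lra. Qed.

(** cosh y - 1 is half the square of exp(y/2) - exp(- y/2), and for y >= 0 that difference is at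
    least y/2. *)
Lemma cosh_ge_sqr x : 1 + x ^+ 2 / 8 <= cosh x.
Proof.
suff H y : 0 <= y -> 1 + y ^+ 2 / 8 <= cosh y.
  have [/H//|x0] := leP 0 x.
  by rewrite -coshN -sqrrN; apply: H; rewrite oppr_ge0 ltW.
move=> y0; rewrite /cosh.
have -> : y = y / 2 + y / 2 by lra.
rewrite opprD !expRD.
have := expRxMexpNx_1 (y / 2); have := expR_ge1Dx (y / 2).
have : expR (- (y / 2)) <= 1 by rewrite expR_le1; lra.
set p := expR _; set q := expR _ => h1 h2 h3.
have : (y / 2) ^+ 2 <= (q - p) ^+ 2 by rewrite ler_sqr ?nnegrE//; lra.
nra.
Qed.

Lemma cosh_ge1 x : 1 <= cosh x.
Proof. by have := cosh_ge_sqr x; have := sqr_ge0 x; lra. Qed.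

Lemma cosh_gt0 x : 0 < cosh x.
Proof. exact: lt_le_trans (cosh_ge1 x). Qed.

Lemma cosh_ge_expR x : expR `|x| / 2 <= cosh x.
Proof.
have [x0|x0] := leP 0 x; first by rewrite ger0_norm// /cosh; have := expR_ge0 (- x); lra.
by rewrite ltr0_norm// /cosh; have := expR_ge0 x; lra.
Qed.

Lemma sinh_gt0 x : 0 < x -> 0 < sinh x.
Proof. by move=> x0; rewrite /sinh divr_gt0// subr_gt0 ltr_expR; lra. Qed.

End hyperbolic.

(** * Exponential majorants and the size of K_0 *)

Section dominating_functions.
Context {R : realType}.
Notation mu := (@lebesgue_measure R).

Lemma cvgy_expRN (c : R) : 0 < c -> expR (- (c * x)) @[x --> +oo] --> 0.
Proof.
move=> c0; apply: (cvg_comp (fun x => c * x) (fun x => expR (- x)) _ (@cvgr_expR R)).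
exact: gt0_cvgMry.
Qed.

Lemma integral_expR_0y (c : R) : 0 < c ->
  (\int[mu]_(x in `]0%R, +oo[) (expR (- (c * x)))%:E = (c^-1)%:E)%E.
Proof.
move=> c0.
rewrite (@ge0_FTC_0y _ (fun x => - (c^-1) * expR (- (c * x))) _ (- c^-1) 0) //.
- by rewrite sub0r opprK.
- move=> x _; derive.
  field; exact: lt0r_neq0.
- by move=> x _; apply: der_continuous; derive.
- apply: cvg_at_right_filter.
  rewrite -[X in _ --> X](_ : - c^-1 * expR (- (c * 0)) = _); last first.
    by rewrite mulr0 oppr0 expR0 mulr1.
  apply: cvgM; first exact: cvg_cst.
  apply: continuous_comp; last exact: continuous_expR.
  by apply: cvgN; apply: cvgM; [exact: cvg_cst|].
- by rewrite -[X in _ --> X](mulr0 (- c^-1)); apply: cvgM; [exact: cvg_cst|exact: cvgy_expRN].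
Qed.

Lemma integrable_expR_0y (c : R) : 0 < c ->
  mu.-integrable `]0, +oo[ (EFin \o (fun x => expR (- (c * x)))).
Proof.
move=> c0; apply/integrableP; split; first by apply/measurable_EFinP; mfun.
under eq_integral do rewrite /= ger0_norm ?expR_ge0//.
by rewrite integral_expR_0y// ltry.
Qed.

Lemma Rintegral_expR_0y (c : R) : 0 < c ->
  \int[mu]_(x in `]0, +oo[) expR (- (c * x)) = c^-1.
Proof. by move=> c0; rewrite /Rintegral integral_expR_0y. Qed.

Lemma integrable_expR_norm (c : R) : 0 < c ->
  mu.-integrable setT (EFin \o (fun x => expR (- (c * `|x|)))).
Proof.
move=> c0; apply/integrableP; split; first by apply/measurable_EFinP; mfun.
under eq_integral do rewrite /= ger0_norm ?expR_ge0//.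
rewrite ge0_symfun_integralT; last 3 first.
- by move=> x; exact: expR_ge0.
- move=> x; apply: continuous_comp; last exact: continuous_expR.
  by apply: cvgN; apply: cvgM; [exact: cvg_cst|exact: norm_continuous].
- by move=> x /=; rewrite normrN.
rewrite -set_itvcy -integral_itv_obnd_cbnd; last by apply/measurable_EFinP; mfun.
suff -> : (\int[mu]_(x in `]0%R, +oo[) (expR (- (c * `|x|)))%:E = (c^-1)%:E)%E by exact: ltry.
rewrite -integral_expR_0y//.
by apply: eq_integral => x; rewrite mem_itv0y => x0; rewrite gtr0_norm.
Qed.

Lemma Rintegral_expR_norm (c : R) : 0 < c ->
  \int[mu]_x expR (- (c * `|x|)) = 2 / c.
Proof.
move=> c0; rewrite Rintegral_even; last 2 first.
- exact: integrable_expR_norm.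
- by move=> x; rewrite normrN.
congr (2 * _); rewrite -(Rintegral_expR_0y c0); apply: eq_Rintegral => x.
by rewrite mem_itv0y => x0; rewrite gtr0_norm.
Qed.

Lemma integrable_expR_sqrt (c : R) : 0 < c ->
  mu.-integrable `]0, +oo[ (EFin \o (fun x => expR (- (c * Num.sqrt x)) / Num.sqrt x)).
Proof.
move=> c0; apply/integrableP; split; first by apply/measurable_EFinP; mfun.
under eq_integral do rewrite /= ger0_norm ?divr_ge0 ?expR_ge0 ?sqrtr_ge0//.
have dS (x : R) : 0 < x -> der Num.sqrt x (2 * Num.sqrt x)^-1.
  by move=> x0; exact: is_derive1_sqrt.
suff -> : (\int[mu]_(x in `]0%R, +oo[) (expR (- (c * Num.sqrt x)) / Num.sqrt x)%:E =
    (0 - - (2 / c))%:E)%E by exact: ltry.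
apply: (@ge0_FTC_0y _ (fun x => - (2 / c) * expR (- (c * Num.sqrt x)))).
- move=> x x0; apply: der_eq.
    by apply: derM; [exact: der_cst|apply: der_expR; apply: derN; apply: derM; [exact: der_cst|exact: dS]].
  by rewrite /=; field; rewrite (lt0r_neq0 c0) sqrtr_eq0 -ltNge x0.
- move=> x x0; apply: cvgM.
    apply: continuous_comp; last exact: continuous_expR.
    by apply: cvgN; apply: cvgM; [exact: cvg_cst|exact: sqrt_continuous].
  by apply: cvgV; [rewrite sqrtr_eq0 -ltNge x0|exact: sqrt_continuous].
- apply: cvg_at_right_filter.
  rewrite -[X in _ --> X](_ : - (2 / c) * expR (- (c * Num.sqrt 0)) = _); last first.
    by rewrite sqrtr0 mulr0 oppr0 expR0 mulr1.
  apply: cvgM; first exact: cvg_cst.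
  apply: continuous_comp; last exact: continuous_expR.
  by apply: cvgN; apply: cvgM; [exact: cvg_cst|exact: sqrt_continuous].
- rewrite -[X in _ --> X](mulr0 (- (2 / c))); apply: cvgM; first exact: cvg_cst.
  apply: (cvg_comp (fun x : R => Num.sqrt x) (fun x => expR (- (c * x))) _ (cvgy_expRN c0)).
  apply/cvgryPge => A; near=> x.
  have Ax : A ^+ 2 <= x by near: x; apply: nbhs_pinfty_ge; exact: num_real.
  by rewrite (le_trans (ler_norm A))// -sqrtr_sqr ler_sqrt// (le_trans (sqr_ge0 A)).
- by move=> x _; rewrite divr_ge0 ?expR_ge0 ?sqrtr_ge0.
Unshelve. all: by end_near. Qed.

(** The integral over the line of exp(2 - w) exp(- sqrt w |t|). Up to a constant it is the true size
    of 2 K_0(w) at infinity; the exponent must be exactly w to cancel the growth of J later. *)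
Definition K0_bound (w : R) := 2 * expR 2 * (expR (- w) / Num.sqrt w).

(** With s = sqrt w |t|, w cosh t is at least w + s^2/8, and (s - 4)^2 >= 0 gives s^2/8 >= s - 2;
    hence the constant exp 2. *)
Lemma cosh_kernel_le (w t : R) : 0 < w ->
  expR (- (w * cosh t)) <= expR 2 * expR (- w) * expR (- (Num.sqrt w * `|t|)).
Proof.
move=> w0; rewrite -!expRD ler_expR.
have /sqr_sqrtr ws := ltW w0.
have := ler_wpM2l (ltW w0) (cosh_ge_sqr t).
have := sqr_ge0 (Num.sqrt w * `|t| - 4).
by rewrite sqrrB exprMn ws -normrX (ger0_norm (sqr_ge0 t)); lra.
Qed.

Lemma integrable_cosh_kernel (w : R) : 0 < w ->
  mu.-integrable setT (EFin \o (fun t => expR (- (w * cosh t)))).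
Proof.
move=> w0; have s0 : 0 < Num.sqrt w by rewrite sqrtr_gt0.
apply: (integrable_le (g := fun t => expR 2 * expR (- w) * expR (- (Num.sqrt w * `|t|)))) => //.
- by mfun.
- by move=> t _; rewrite ger0_norm ?expR_ge0// cosh_kernel_le.
- exact: (integrableZl measurableT (expR 2 * expR (- w)) (integrable_expR_norm s0)).
Qed.

Lemma Rintegral_cosh_kernel_le (w : R) : 0 < w ->
  \int[mu]_t expR (- (w * cosh t)) <= K0_bound w.
Proof.
move=> w0; have s0 : 0 < Num.sqrt w by rewrite sqrtr_gt0.
apply: (@le_trans _ _ (\int[mu]_t (expR 2 * expR (- w) * expR (- (Num.sqrt w * `|t|))))).
  apply: le_Rintegral => //; first exact: integrable_cosh_kernel.
    exact: (integrableZl measurableT (expR 2 * expR (- w)) (integrable_expR_norm s0)).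
  by move=> t _; exact: cosh_kernel_le.
rewrite RintegralZl//; last exact: integrable_expR_norm.
by rewrite Rintegral_expR_norm// /K0_bound; lra.
Qed.

(** Translating by ln (p / q) balances the two exponentials: both acquire the coefficient p q. Every
    two-sided exponent met later is reduced to a hyperbolic cosine in this way. *)
Lemma two_sided_expE (p q s : R) : 0 < p -> 0 < q ->
  p ^+ 2 * expR (- (s + ln (p / q))) + q ^+ 2 * expR (s + ln (p / q)) = 2 * p * q * cosh s.
Proof.
move=> p0 q0; have pq : p / q \is Num.pos by rewrite posrE divr_gt0.
rewrite opprD !expRD expRN lnK// expRN lnK// /cosh expRN; field.
by rewrite expR_eq0 !lt0r_neq0.
Qed.

Lemma integrable_two_sided_exp (p q : R) : 0 < p -> 0 < q ->
  mu.-integrable setT (EFin \o (fun s => expR (- (p ^+ 2 * expR (- s) + q ^+ 2 * expR s)))).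
Proof.
move=> p0 q0; have w0 : 0 < 2 * p * q by rewrite !mulr_gt0.
have := integrable_shift (- ln (p / q)) (integrable_cosh_kernel w0).
apply: eq_integrable => // s _ /=.
by rewrite -two_sided_expE// subrK.
Qed.

Lemma Rintegral_two_sided_exp (p q : R) : 0 < p -> 0 < q ->
  \int[mu]_s expR (- (p ^+ 2 * expR (- s) + q ^+ 2 * expR s)) <= K0_bound (2 * p * q).
Proof.
move=> p0 q0; have w0 : 0 < 2 * p * q by rewrite !mulr_gt0.
rewrite (Rintegral_shift (ln (p / q)) (integrable_two_sided_exp p0 q0)).
under eq_Rintegral do rewrite two_sided_expE//.
exact: Rintegral_cosh_kernel_le.
Qed.

Lemma two_sided_exp_bound (A B : R) : 0 < A -> 0 < B ->
  mu.-integrable setT (EFin \o (fun s => expR (- (A * expR (- s) + B * expR s)))) /\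
  \int[mu]_s expR (- (A * expR (- s) + B * expR s)) <= K0_bound (2 * (Num.sqrt A * Num.sqrt B)).
Proof.
move=> A0 B0; have [a0 b0] : 0 < Num.sqrt A /\ 0 < Num.sqrt B by rewrite !sqrtr_gt0.
have := integrable_two_sided_exp a0 b0; have := Rintegral_two_sided_exp a0 b0.
by rewrite !sqr_sqrtr ?(ltW A0) ?(ltW B0)// mulrA.
Qed.

End dominating_functions.

(** * Fourier series *)

Section fourier.
Context {R : realType}.
Notation mu := (@lebesgue_measure R).
Notation I := (`[- pi, pi]%classic : set R).
Implicit Types (f g h psi q : R -> R) (u t : R) (N : nat).

Lemma lt_Npipi : - pi < pi :> R.
Proof. by have := (@pi_gt0 R); lra. Qed.

(** A class stable under sums and products and integrable on [I], so that integrability in the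
    Fourier part is settled by the shape of the integrand. *)
Definition bounded_mfun f := measurable_fun setT f /\ exists M, forall t, `|f t| <= M.

Lemma bounded_mfunD f g : bounded_mfun f -> bounded_mfun g ->
  bounded_mfun (fun t => f t + g t).
Proof.
move=> [mf [M fM]] [mg [M' gM]]; split; first by mfun.
by exists (M + M') => t; rewrite (le_trans (ler_normD _ _))// lerD.
Qed.

Lemma bounded_mfunM f g : bounded_mfun f -> bounded_mfun g ->
  bounded_mfun (fun t => f t * g t).
Proof.
move=> [mf [M fM]] [mg [M' gM]]; split; first by mfun.
by exists (M * M') => t; rewrite normrM ler_pM.
Qed.

Lemma bounded_mfunC (c : R) : bounded_mfun (fun=> c).
Proof. by split; [mfun|exists `|c|]. Qed.

Lemma bounded_mfunN f : bounded_mfun f -> bounded_mfun (fun t => - f t).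
Proof.
move=> [mf [M fM]]; split; first by mfun.
by exists M => t; rewrite normrN.
Qed.

Lemma bounded_mfun_sin f : measurable_fun setT f -> bounded_mfun (fun t => sin (f t)).
Proof. by move=> mf; split; [mfun|exists 1 => t; exact: sin_max]. Qed.

Lemma bounded_mfun_cos f : measurable_fun setT f -> bounded_mfun (fun t => cos (f t)).
Proof. by move=> mf; split; [mfun|exists 1 => t; exact: cos_max]. Qed.

Lemma bounded_mfun_sum (F : nat -> R -> R) m n : (forall k, bounded_mfun (F k)) ->
  bounded_mfun (fun t => \sum_(m <= k < n) F k t).
Proof.
move=> bF; elim: n => [|n IH].
  by under eq_fun do rewrite big_geq//; exact: bounded_mfunC.
have [mn|nm] := leqP m n; last by under eq_fun do rewrite big_geq//; exact: bounded_mfunC.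
by under eq_fun do rewrite big_nat_recr//=; exact: bounded_mfunD.
Qed.

Lemma bounded_mfun_integrable f : bounded_mfun f -> mu.-integrable I (EFin \o f).
Proof.
move=> [mf [M fM]]; apply: (integrable_le (g := fun=> M)) => //.
- exact: measurable_funTS.
apply/integrableP; split; first by apply/measurable_EFinP; mfun.
by rewrite /= integral_cst//= lebesgue_measure_itv/= lte_fin lt_Npipi -EFinD -EFinM ltry.
Qed.

Lemma RI_D f g : bounded_mfun f -> bounded_mfun g ->
  \int[mu]_(t in I) (f t + g t) = \int[mu]_(t in I) f t + \int[mu]_(t in I) g t.
Proof. by move=> bf bg; rewrite RintegralD//; exact: bounded_mfun_integrable. Qed.

Lemma RI_Z f (c : R) : bounded_mfun f ->
  \int[mu]_(t in I) (c * f t) = c * \int[mu]_(t in I) f t.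
Proof. by move=> bf; rewrite RintegralZl//; exact: bounded_mfun_integrable. Qed.

Lemma RI_sum (F : nat -> R -> R) m n : (forall k, bounded_mfun (F k)) ->
  \int[mu]_(t in I) (\sum_(m <= k < n) F k t) = \sum_(m <= k < n) \int[mu]_(t in I) F k t.
Proof.
move=> bF; elim: n => [|n IH].
  by rewrite big_geq//; under eq_Rintegral do rewrite big_geq//; rewrite Rintegral_cst// mul0r.
have [mn|nm] := leqP m n; last first.
  by rewrite big_geq//; under eq_Rintegral do rewrite big_geq//; rewrite Rintegral_cst// mul0r.
rewrite big_nat_recr//= -IH -RI_D//; last exact: bounded_mfun_sum.
by apply: eq_Rintegral => t _; rewrite big_nat_recr.
Qed.

Lemma RI_cst (c : R) : \int[mu]_(t in I) c = 2 * pi * c.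
Proof.
rewrite Rintegral_cst//= lebesgue_measure_itv/= lte_fin lt_Npipi -EFinD/=; ring.
Qed.

Lemma sin_addMpi (k : nat) (x : R) : sin (x + pi * k%:R) = (-1) ^+ k * sin x.
Proof.
elim: k => [|k IH]; first by rewrite mulr0 addr0 expr0 mul1r.
rewrite -natr1 mulrDr mulr1 addrA sinD cospi sinpi IH exprS; lra.
Qed.

Lemma RI_cos (k : nat) u : (0 < k)%N ->
  \int[mu]_(t in I) cos (k%:R * (t - u)) = 0.
Proof.
move=> k0; have kR : k%:R != 0 :> R by rewrite pnatr_eq0 -lt0n.
pose F t := k%:R^-1 * sin (k%:R * (t - u)).
have dF t : der F t (cos (k%:R * (t - u))) by derive; field.
have cF : continuous F by move=> t; exact: der_continuous (dF t).
rewrite /Rintegral (@continuous_FTC2 _ _ F).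
- have -> : F pi = F (- pi); last by rewrite -EFinB /= subrr.
  rewrite /F; congr (_ * _).
  have -> : k%:R * (pi - u) = - (k%:R * u) + pi * k%:R :> R by ring.
  have -> : k%:R * (- pi - u) = - (k%:R * u + pi * k%:R) :> R by ring.
  by rewrite sinN !sin_addMpi sinN; ring.
- exact: lt_Npipi.
- apply: continuous_subspaceT => t; apply: der_continuous; derive; reflexivity.
- split; [by move=> t _; have [] := dF t|apply: cvg_at_right_filter; exact: cF|apply: cvg_at_left_filter; exact: cF].
- by move=> t _; rewrite derive1E; have [_ ->] := dF t.
Qed.

(** Half the usual Dirichlet kernel: its mass over a period is pi. *)
Definition dirichlet N t := 2^-1 + \sum_(1 <= n < N.+1) cos (n%:R * t).

Lemma dirichletE N t :
  2 * sin (t / 2) * dirichlet N t = sin ((N%:R + 2^-1) * t).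
Proof.
rewrite /dirichlet; elim: N => [|N IH].
  by rewrite big_geq// addr0 add0r mulrAC divff ?pnatr_eq0// mul1r mulrC.
rewrite big_nat_recr//= addrA mulrDr IH.
have -> : (N.+1%:R + 2^-1) * t = N.+1%:R * t + t / 2 by field.
have -> : (N%:R + 2^-1) * t = N.+1%:R * t - t / 2 by rewrite -[N.+1%:R]natr1; field.
by rewrite sinB sinD; ring.
Qed.

Lemma RI_dirichlet N u : \int[mu]_(t in I) dirichlet N (t - u) = pi.
Proof.
rewrite RI_D; last 2 first.
- exact: bounded_mfunC.
- by apply: bounded_mfun_sum => k; apply: bounded_mfun_cos; mfun.
rewrite RI_cst RI_sum; last by move=> k; apply: bounded_mfun_cos; mfun.
rewrite big_nat big1 ?addr0; first by field.
by move=> k /andP[k0 _]; exact: RI_cos.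
Qed.

(** The numerator in the closed form of the Dirichlet kernel. A product of two distinct such
    functions contains only cosines of positive integer frequency, so they are orthogonal on [I];
    each has squared norm pi. *)
Let e u N t := sin ((N%:R + 2^-1) * (t - u)).

Let bm_e u N : bounded_mfun (e u N).
Proof. by apply: bounded_mfun_sin; mfun. Qed.

Let e_orth u N M : (N < M)%N -> \int[mu]_(t in I) (e u N t * e u M t) = 0.
Proof.
move=> NM.
have eE t : e u N t * e u M t = 2^-1 * (cos ((M - N)%N%:R * (t - u)) + - cos ((N + M).+1%:R * (t - u))).
  have h1 : (N%:R + 2^-1) * (t - u) - (M%:R + 2^-1) * (t - u) = - ((M - N)%N%:R * (t - u)).
    by rewrite natrB 1?ltnW//; ring.
  have h2 : (N%:R + 2^-1) * (t - u) + (M%:R + 2^-1) * (t - u) = (N + M).+1%:R * (t - u).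
    by rewrite -[(N + M).+1%:R]natr1 natrD; field.
  by rewrite -h2 -cosN -h1 cosB cosD /e; field.
under eq_Rintegral do rewrite eE.
rewrite RI_Z; last first.
  by apply: bounded_mfunD; [|apply: bounded_mfunN]; apply: bounded_mfun_cos; mfun.
rewrite RI_D; last 2 first.
- by apply: bounded_mfun_cos; mfun.
- by apply: bounded_mfunN; apply: bounded_mfun_cos; mfun.
rewrite RI_cos ?subn_gt0//.
under eq_Rintegral do rewrite -mulN1r.
rewrite RI_Z; last by apply: bounded_mfun_cos; mfun.
by rewrite RI_cos// mulr0 addr0 mulr0.
Qed.

Let e_norm u N : \int[mu]_(t in I) (e u N t * e u N t) = pi.
Proof.
have eE t : e u N t * e u N t = 2^-1 + (- 2^-1) * cos ((N + N).+1%:R * (t - u)).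
  have h2 : (N%:R + 2^-1) * (t - u) + (N%:R + 2^-1) * (t - u) = (N + N).+1%:R * (t - u).
    by rewrite -[(N + N).+1%:R]natr1 natrD; field.
  by rewrite -h2 cosD /e; have := cos2Dsin2 ((N%:R + 2^-1) * (t - u)); lra.
under eq_Rintegral do rewrite eE.
rewrite RI_D; last 2 first.
- exact: bounded_mfunC.
- by apply: bounded_mfunM; [exact: bounded_mfunC|apply: bounded_mfun_cos; mfun].
rewrite RI_cst RI_Z; last by apply: bounded_mfun_cos; mfun.
by rewrite RI_cos// mulr0 addr0; field.
Qed.

(* Bessel's inequality for the orthogonal system [sin ((N + 1/2) (t - u))]. *)
Lemma riemann_lebesgue h u : bounded_mfun h ->
  \int[mu]_(t in I) (h t * sin ((N%:R + 2^-1) * (t - u))) @[N --> \oo] --> 0.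
Proof.
move=> bh; pose c N := \int[mu]_(t in I) (h t * e u N t).
have pi0 := (@pi_gt0 R).
(* The remainder of [h] after projection on the first M functions. Its squared norm drops by c_M^2 /
   pi at each step and stays nonnegative, so the squares c_N^2 are summable and tend to 0. *)
pose r M t := h t + - \sum_(0 <= N < M) (c N / pi) * e u N t.
have br M : bounded_mfun (r M).
  apply: bounded_mfunD => //; apply: bounded_mfunN; apply: bounded_mfun_sum => k.
  by apply: bounded_mfunM; [exact: bounded_mfunC|].
have re M : \int[mu]_(t in I) (r M t * e u M t) = c M.
  have rE t : r M t * e u M t = h t * e u M t + -1 * \sum_(0 <= N < M) (c N / pi) * (e u N t * e u M t).
    rewrite /r mulrDl mulN1r mulNr mulr_suml; congr (_ - _).
    by apply: eq_bigr => k _; rewrite mulrA.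
  under eq_Rintegral do rewrite rE.
  have bs : bounded_mfun (fun t => \sum_(0 <= N < M) (c N / pi) * (e u N t * e u M t)).
    apply: bounded_mfun_sum => k.
    by apply: bounded_mfunM; [exact: bounded_mfunC|exact: bounded_mfunM].
  rewrite RI_D; [|exact: bounded_mfunM|by apply: bounded_mfunM; [exact: bounded_mfunC|]].
  rewrite RI_Z// RI_sum; last first.
    by move=> k; apply: bounded_mfunM; [exact: bounded_mfunC|exact: bounded_mfunM].
  rewrite big_nat big1 ?mulr0 ?addr0// => k /andP[_ kM].
  by rewrite RI_Z ?e_orth ?mulr0//; exact: bounded_mfunM.
have r2 M : \int[mu]_(t in I) (r M.+1 t * r M.+1 t) =
    \int[mu]_(t in I) (r M t * r M t) - c M ^+ 2 / pi.
  have rE t : r M.+1 t * r M.+1 t = r M t * r M t +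
      (- (2 * (c M / pi)) * (r M t * e u M t) + (c M / pi) ^+ 2 * (e u M t * e u M t)).
    have -> : r M.+1 t = r M t - (c M / pi) * e u M t.
      by rewrite /r big_nat_recr//= opprD addrA.
    by ring.
  under eq_Rintegral do rewrite rE.
  have b1 := bounded_mfunM (br M) (br M).
  have b2 := bounded_mfunM (br M) (bm_e u M).
  have b3 := bounded_mfunM (bm_e u M) (bm_e u M).
  have b2' := bounded_mfunM (bounded_mfunC (- (2 * (c M / pi)))) b2.
  have b3' := bounded_mfunM (bounded_mfunC ((c M / pi) ^+ 2)) b3.
  rewrite (RI_D b1 (bounded_mfunD b2' b3')) (RI_D b2' b3') (RI_Z _ b2) (RI_Z _ b3) re e_norm.
  have F (x p : R) : p != 0 -> - (2 * (x / p)) * x + (x / p) ^+ 2 * p = - (x ^+ 2 / p).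
    by move=> p0; field.
  by congr (_ + _); exact: F (lt0r_neq0 pi0).
have sumE M : \int[mu]_(t in I) (r M t * r M t) =
    \int[mu]_(t in I) (h t * h t) - (\sum_(0 <= N < M) c N ^+ 2) / pi.
  elim: M => [|M IH].
    rewrite big_geq// mul0r subr0; apply: eq_Rintegral => t _.
    by rewrite /r big_geq// subr0.
  by rewrite r2 IH big_nat_recr//= mulrDl; ring.
pose B := \int[mu]_(t in I) (h t * h t) * pi.
have bound M : \sum_(0 <= N < M) c N ^+ 2 <= B.
  have : 0 <= \int[mu]_(t in I) (r M t * r M t).
    by apply: Rintegral_ge0 => t _; rewrite -expr2 sqr_ge0.
  by rewrite sumE subr_ge0 ler_pdivrMr.
have cv : cvgn (series (fun N => c N ^+ 2)).
  apply: nondecreasing_is_cvgn.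
    apply/nondecreasing_seqP => n; rewrite /series/= big_nat_recr//= lerDl sqr_ge0//.
  by exists B => _ [n _ <-]; exact: bound.
have c20 := cvg_series_cvg_0 cv.
apply/cvgrPdist_lt => eps eps0.
have e20 : 0 < eps ^+ 2 by rewrite exprn_gt0.
move/cvgrPdist_lt: c20 => /(_ _ e20)[K _ HK].
exists K => // n /= /HK; rewrite !sub0r !normrN.
rewrite ger0_norm ?sqr_ge0// -real_normK ?num_real//.
by rewrite ltr_pXn2r// nnegrE// ltW.
Qed.

(** A weak form of Jordan's inequality. From x cos x <= sin x at x = t/2, sin t is at least t cos^2
    (t/2), and cos^2 (t/2) >= 1/2 because cos t >= 0. *)
Lemma jordan_sin (t : R) : 0 <= t <= pi / 2 -> t / 2 <= sin t.
Proof.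
move=> /andP[t0 tpi]; have pi0 := (@pi_gt0 R).
have tan_le (x : R) : 0 <= x <= pi / 2 -> x * cos x <= sin x.
  move=> /andP[x0 xpi].
  pose F (y : R) := sin y - y * cos y.
  have dF y : der F y (y * sin y) by derive; ring.
  have [c cx] : exists2 c, c \in `[0, x] & F x - F 0 = c * sin c * (x - 0).
    apply: (@MVT_segment _ F (fun y => y * sin y)) => //; first by move=> y _; exact: dF.
    by apply: continuous_subspaceT => y; exact: der_continuous (dF y).
  rewrite {2}/F sin0 mul0r subrr !subr0 => FE.
  rewrite -subr_ge0 -[leRHS]/(F x) FE; move: cx; rewrite in_itv/= => /andP[c0 cx].
  by rewrite !mulr_ge0// sin_ge0_pi// c0/=; lra.
have t2 : 0 <= t / 2 <= pi / 2 by apply/andP; lra.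
have h := tan_le _ t2.
have c0 : 0 <= cos (t / 2) by apply: cos_ge0_pihalf; lra.
have ct : 0 <= cos t by apply: cos_ge0_pihalf; lra.
have tE : t = t / 2 + t / 2 by lra.
have sE : sin t = 2 * (sin (t / 2) * cos (t / 2)) by rewrite {1}tE sinD; ring.
have cE : cos t = 2 * cos (t / 2) ^+ 2 - 1.
  by rewrite {1}tE cosD; have := cos2Dsin2 (t / 2); lra.
have := ler_wpM2r c0 h; nra.
Qed.

Section pointwise.
Variables (psi : R -> R) (C : R).
Hypothesis C0 : 0 <= C.
Hypothesis mpsi : measurable_fun setT psi.
Hypothesis lip : forall u t, -pi <= u <= pi -> -pi <= t <= pi ->
  `|psi u - psi t| <= C * `|u - t|.
Hypothesis per : psi (- pi) = psi pi.
Hypothesis bpsi : bounded_mfun psi.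

(** The bound is in terms of the distance on the circle. When t - u exceeds pi the short way round
    passes through pi and - pi, where [psi] takes the same value; its length 2 pi - (t - u) is
    controlled by [jordan_sin] at pi - (t - u)/2. *)
Let lip_sin u t : -pi <= u <= pi -> -pi <= t <= pi ->
  `|psi t - psi u| <= 4 * C * `|sin ((t - u) / 2)|.
Proof.
wlog ut : u t / u <= t.
  move=> H uI tI; have [/H|/ltW/H] := leP u t; first exact.
  by move=> /(_ tI uI); rewrite distrC -[u - t]opprB mulNr sinN normrN.
move=> uI tI; have pi0 := (@pi_gt0 R).
have /andP[u1 u2] := uI; have /andP[t1 t2] := tI.
have [h|h] := leP (t - u) pi.
  have hj : (t - u) / 2 / 2 <= sin ((t - u) / 2) by apply: jordan_sin; apply/andP; lra.
  apply: le_trans (lip tI uI) _; rewrite ger0_norm ?subr_ge0//.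
  rewrite ger0_norm; last by lra.
  by have := ler_wpM2l C0 hj; lra.
have hj : (pi - (t - u) / 2) / 2 <= sin (pi - (t - u) / 2).
  by apply: jordan_sin; apply/andP; lra.
have sE : sin (pi - (t - u) / 2) = sin ((t - u) / 2).
  by rewrite sinB sinpi cospi; ring.
rewrite sE in hj; rewrite [X in _ <= _ * X]ger0_norm; last by lra.
have -> : psi t - psi u = (psi t - psi pi) + (psi (- pi) - psi u) by rewrite per; ring.
have piI : (- (pi : R) <= pi) && ((pi : R) <= pi) by rewrite lexx andbT; lra.
have NpiI : (- (pi : R) <= - pi) && (- (pi : R) <= pi) by rewrite lexx; lra.
apply: le_trans (ler_normD _ _) _.
have := lip tI piI; have := lip NpiI uI.
rewrite [`|- pi - u|]ler0_norm; last by lra.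
rewrite [`|t - pi|]ler0_norm; last by lra.
by have := ler_wpM2l C0 hj; lra.
Qed.

Definition fourier_sum N u := \int[mu]_(t in I) (psi t * dirichlet N (t - u)).

(** The factor left after dividing by the denominator of the Dirichlet kernel. It is bounded by
    [lip_sin], and where the sine vanishes division by 0 makes it 0. *)
Let h u t := (psi t - psi u) / (2 * sin ((t - u) / 2)).

Let h_bound u t : -pi <= u <= pi -> -pi <= t <= pi -> `|h u t| <= 2 * C.
Proof.
move=> uI tI; rewrite /h normrM normfV.
have [s0|s0] := eqVneq (sin ((t - u) / 2)) 0.
  by rewrite s0 mulr0 normr0 invr0 mulr0 mulr_ge0.
rewrite ler_pdivrMr ?normr_gt0 ?mulf_neq0// normrM.
by rewrite (le_trans (lip_sin uI tI))// (ger0_norm (ler0n _ 2)); lra.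
Qed.

Let bm_dirichlet N u : bounded_mfun (fun t => dirichlet N (t - u)).
Proof.
apply: bounded_mfunD; first exact: bounded_mfunC.
by apply: bounded_mfun_sum => k; apply: bounded_mfun_cos; mfun.
Qed.

Let h' u := h u \_ I.

Let bm_h u : -pi <= u <= pi -> bounded_mfun (h' u).
Proof.
move=> uI; split.
  apply/(measurable_restrictT _ (measurable_itv _)); apply: measurable_funTS.
  by rewrite /h; mfun.
exists (2 * C) => t; rewrite /h' patchE; case: ifPn => [/set_mem/=|_].
  by rewrite in_itv/=; exact: h_bound.
by rewrite normr0 mulr_ge0.
Qed.

Let fourier_sumE N u : -pi <= u <= pi ->
  fourier_sum N u = pi * psi u +
    \int[mu]_(t in I) (h' u t * sin ((N%:R + 2^-1) * (t - u))).
Proof.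
move=> uI.
have -> : pi * psi u = \int[mu]_(t in I) (psi u * dirichlet N (t - u)).
  by rewrite (RI_Z _ (bm_dirichlet N u)) RI_dirichlet mulrC.
rewrite -RI_D; last 2 first.
- exact: bounded_mfunM (bounded_mfunC _) (bm_dirichlet N u).
- by apply: bounded_mfunM; [exact: bm_h|apply: bounded_mfun_sin; mfun].
apply: eq_Rintegral => t tI.
rewrite /h' patchE tI -dirichletE /h.
have [s0|s0] := eqVneq (sin ((t - u) / 2)) 0; last by field.
(* At zeros of the sine the quotient is 0 by convention, but there [lip_sin] forces psi t = psi u,
   so the identity survives. *)
rewrite s0 mulr0 invr0 mulr0 mul0r addr0.
have : psi t - psi u = 0.
  apply/eqP; rewrite -normr_le0; move: tI => /set_mem/=; rewrite in_itv/= => tI.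
  by rewrite (le_trans (lip_sin uI tI))// s0 normr0 mulr0.
by move/subr0_eq => ->.
Qed.

Lemma fourier_sum_cvg u : -pi <= u <= pi -> fourier_sum N u @[N --> \oo] --> pi * psi u.
Proof.
move=> uI.
have -> : fourier_sum ^~ u = fun N => pi * psi u +
    \int[mu]_(t in I) (h' u t * sin ((N%:R + 2^-1) * (t - u))).
  by apply/funext => N; exact: fourier_sumE.
rewrite -[X in _ --> X]addr0; apply: cvgD; first exact: cvg_cst.
exact: riemann_lebesgue (bm_h uI).
Qed.

(** Uniformity in N and u is what permits passing to the limit under the integral against [q] by
    dominated convergence. *)
Lemma fourier_sum_bound : exists M, forall N u, -pi <= u <= pi -> `|fourier_sum N u| <= M.
Proof.
have [_ [M psiM]] := bpsi.
exists (pi * M + 2 * pi * (2 * C)) => N u uI; rewrite fourier_sumE//.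
have pi0 := (@pi_gt0 R).
apply: le_trans (ler_normD _ _) _; rewrite normrM gtr0_norm//.
apply: lerD; first by rewrite ler_wpM2l// ltW.
rewrite -RI_cst; apply: norm_Rintegral_le => //.
- apply: measurable_funTS; apply: mfunM; first by have [] := bm_h uI.
  by mfun.
- move=> t _; rewrite normrM -[leRHS]mulr1; apply: ler_pM => //; last exact: sin_max.
  rewrite /h' patchE; case: ifPn => [/set_mem/=|_]; last by rewrite normr0 mulr_ge0.
  by rewrite in_itv/=; exact: h_bound.
- by apply: bounded_mfun_integrable; exact: bounded_mfunC.
Qed.

(** The finite sum is the integral of [q] against the N-th Fourier sum of [psi]: oddness of [q]
    removes the constant and cosine terms. Pointwise convergence with a uniform bound then replaces
    any theory of square-integrable functions. *)
Lemma parseval_sine q : bounded_mfun q -> (forall u, q (- u) = - q u) ->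
  \sum_(1 <= n < N.+1) (\int[mu]_(u in I) (q u * sin (n%:R * u))) *
    (\int[mu]_(t in I) (psi t * sin (n%:R * t))) @[N --> \oo] -->
  pi * \int[mu]_(u in I) (q u * psi u).
Proof.
move=> bq qodd.
have odd0 g : bounded_mfun g -> (forall u, g (- u) = - g u) -> \int[mu]_(u in I) g u = 0.
  move=> bg godd; rewrite Rintegral_mkcond; apply: Rintegral_odd.
    rewrite -restrict_EFin; apply: (integrable_mkcond _ _).1 => //.
    exact: bounded_mfun_integrable.
  move=> u; rewrite !patchE.
  have -> : (- u \in I) = (u \in I).
    by apply/idP/idP => /set_mem/=; rewrite in_itv/= => ?; apply/mem_set; rewrite /= in_itv/=; lra.
  by case: ifP => _; rewrite ?godd ?oppr0.
pose As n := \int[mu]_(t in I) (psi t * sin (n%:R * t)).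
pose Ac n := \int[mu]_(t in I) (psi t * cos (n%:R * t)).
have bs n : bounded_mfun (fun t : R => sin (n%:R * t)) by apply: bounded_mfun_sin; mfun.
have bc n : bounded_mfun (fun t : R => cos (n%:R * t)) by apply: bounded_mfun_cos; mfun.
have sumE N u : fourier_sum N u = 2^-1 * \int[mu]_(t in I) psi t +
    \sum_(1 <= n < N.+1) (Ac n * cos (n%:R * u) + As n * sin (n%:R * u)).
  have dE t : psi t * dirichlet N (t - u) = 2^-1 * psi t + \sum_(1 <= n < N.+1)
      (cos (n%:R * u) * (psi t * cos (n%:R * t)) + sin (n%:R * u) * (psi t * sin (n%:R * t))).
    rewrite /dirichlet mulrDr mulrC; congr (_ + _); rewrite mulr_sumr.
    by apply: eq_bigr => n _; rewrite mulrBr cosB; ring.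
  rewrite /fourier_sum; under eq_Rintegral do rewrite dE.
  have b1 n := bounded_mfunM (bounded_mfunC (cos (n%:R * u))) (bounded_mfunM bpsi (bc n)).
  have b2 n := bounded_mfunM (bounded_mfunC (sin (n%:R * u))) (bounded_mfunM bpsi (bs n)).
  rewrite RI_D; last 2 first.
  - exact: bounded_mfunM (bounded_mfunC _) bpsi.
  - by apply: bounded_mfun_sum => n; exact: bounded_mfunD.
  rewrite RI_Z// RI_sum; last by move=> n; exact: bounded_mfunD.
  congr (_ + _); apply: eq_bigr => n _; rewrite RI_D//.
  by rewrite !RI_Z; [rewrite /Ac /As; ring|exact: bounded_mfunM..].
have bS N : bounded_mfun (fun u => \sum_(1 <= n < N.+1) (Ac n * cos (n%:R * u) + As n * sin (n%:R * u))).
  by apply: bounded_mfun_sum => n; apply: bounded_mfunD; apply: bounded_mfunM => //; exact: bounded_mfunC.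
have bfs N : bounded_mfun (fourier_sum N).
  have -> : fourier_sum N = fun u => 2^-1 * \int[mu]_(t in I) psi t +
    \sum_(1 <= n < N.+1) (Ac n * cos (n%:R * u) + As n * sin (n%:R * u)).
    by apply/funext => u; exact: sumE.
  by apply: bounded_mfunD => //; exact: bounded_mfunC.
have E N : \sum_(1 <= n < N.+1) (\int[mu]_(u in I) (q u * sin (n%:R * u))) *
    (\int[mu]_(t in I) (psi t * sin (n%:R * t))) =
    \int[mu]_(u in I) (q u * fourier_sum N u).
  have qE u : q u * fourier_sum N u = (2^-1 * \int[mu]_(t in I) psi t) * q u +
     \sum_(1 <= n < N.+1) (Ac n * (q u * cos (n%:R * u)) + As n * (q u * sin (n%:R * u))).
    rewrite sumE mulrDr mulrC; congr (_ + _); rewrite mulr_sumr.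
    by apply: eq_bigr => n _; ring.
  under [RHS]eq_Rintegral do rewrite qE.
  have b1 n := bounded_mfunM (bounded_mfunC (Ac n)) (bounded_mfunM bq (bc n)).
  have b2 n := bounded_mfunM (bounded_mfunC (As n)) (bounded_mfunM bq (bs n)).
  rewrite RI_D; last 2 first.
  - exact: bounded_mfunM (bounded_mfunC _) bq.
  - by apply: bounded_mfun_sum => n; exact: bounded_mfunD.
  rewrite (RI_Z _ bq) (odd0 q)// mulr0 add0r RI_sum; last by move=> n; exact: bounded_mfunD.
  apply: eq_bigr => n _; rewrite RI_D// !RI_Z; [|exact: bounded_mfunM..].
  rewrite [X in _ = _ * X + _]odd0; first by rewrite mulr0 add0r mulrC.
    exact: bounded_mfunM.
  by move=> u; rewrite qodd mulrN cosN mulNr.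
have -> := funext E.
have [M fM] := fourier_sum_bound.
have [_ [Q qQ]] := bq.
have -> : pi * \int[mu]_(u in I) (q u * psi u) = \int[mu]_(u in I) (q u * (pi * psi u)).
  by rewrite -RI_Z; [apply: eq_Rintegral => u _; ring|exact: bounded_mfunM].
have [||||_ //] := @Rintegral_dominated_cvg _ I (fun N u => q u * fourier_sum N u)
  (fun u => q u * (pi * psi u)) (fun=> Q * M) (measurable_itv _).
- by move=> N; apply: measurable_funTS; have [] := bounded_mfunM bq (bfs N).
- move=> u /=; rewrite in_itv/= => uI; apply: cvgM; first exact: cvg_cst.
  exact: fourier_sum_cvg.
- move=> N u /=; rewrite in_itv/= => uI; rewrite normrM; apply: ler_pM => //.
  exact: fM.
- by apply: bounded_mfun_integrable; exact: bounded_mfunC.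
Qed.

End pointwise.

End fourier.

(** * The Gamma function on vertical lines *)

Section elementary_bounds.
Context {R : realType}.

Lemma exprn_fact_le_expR (x : R) k : 0 <= x -> x ^+ k / k`!%:R <= expR x.
Proof.
move=> x0; case: k => [|k]; first by rewrite expr0 fact0 divr1 -expR0 ler_expR.
by have := @expR_ge1Dxn _ x k x0; lra.
Qed.

Lemma sin_le_norm (x : R) : `|sin x| <= `|x|.
Proof.
have dF y : der (@sin R) y (cos y) by derive; ring.
wlog x0 : x / 0 <= x => [H|].
  have [/H//|/ltW x0] := leP 0 x.
  by rewrite -normrN -sinN -[leRHS]normrN; apply: H; rewrite oppr_ge0.
have [c _] : exists2 c, c \in `[0, x] & sin x - sin 0 = cos c * (x - 0).
  have dF' (y : R) : y \in `]0, x[ -> is_derive y 1 (@sin R) (cos y) by move=> _; exact: dF.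
  apply: (MVT_segment x0 dF').
  by apply: continuous_subspaceT => y; exact: continuous_sin.
rewrite sin0 !subr0 => ->; rewrite normrM ler_piMl//; exact: cos_max.
Qed.

Lemma cos_ge (x : R) : 1 - x ^+ 2 / 2 <= cos x.
Proof.
have xE : x = x / 2 + x / 2 by lra.
have cE : cos x = 1 - 2 * sin (x / 2) ^+ 2.
  by rewrite {1}xE cosD; have := cos2Dsin2 (x / 2); lra.
have := sin_le_norm (x / 2); rewrite -ler_sqr ?nnegrE// !real_normK ?num_real//.
by rewrite cE; lra.
Qed.

(** [cosh_ge_sqr] at ln a. It bounds a squared logarithm by powers of a, so that Gamma integrals of
    it become moments. *)
Lemma ln_sqr_le (a : R) : 0 < a -> ln a ^+ 2 <= 4 * (a + a^-1 - 2).
Proof.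
move=> a0; have := cosh_ge_sqr (ln a).
by rewrite /cosh expRN lnK ?posrE//; lra.
Qed.

Lemma exp_series_cvg (x : R) : \sum_(0 <= k < N) x ^+ k / k`!%:R @[N --> \oo] --> expR x.
Proof. exact: is_cvg_series_exp_coeff. Qed.

Lemma sum_exprn_fact_le (x : R) N : 0 <= x ->
  \sum_(0 <= k < N) x ^+ k / k`!%:R <= expR x.
Proof.
move=> x0; have h : \sum_(0 <= k < n) x ^+ k / k`!%:R @[n --> \oo] --> expR x.
  exact: exp_series_cvg.
rewrite -(cvg_lim _ h)//; apply: nondecreasing_cvgn_le; last by apply/cvg_ex; exists (expR x).
apply/nondecreasing_seqP => n; rewrite big_nat_recr//= lerDl.
by rewrite divr_ge0// exprn_ge0.
Qed.

(* With [q = 1 / sqrt x] this is the bound by [exp (2 sqrt x)]. *)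
Lemma sum_exprn_fact2_le (x q : R) N : 0 <= x -> 0 < q ->
  \sum_(0 <= k < N) x ^+ k / (k`!%:R * k`!%:R) <= expR (q * x + q^-1).
Proof.
move=> x0 q0; rewrite expRD.
apply: (@le_trans _ _ ((\sum_(0 <= k < N) (q * x) ^+ k / k`!%:R) * expR q^-1)); last first.
  by rewrite ler_wpM2r ?expR_ge0// sum_exprn_fact_le// mulr_ge0// ltW.
rewrite mulr_suml; apply: ler_sum => k _.
have f0 : 0 < k`!%:R :> R by rewrite ltr0n fact_gt0.
have -> : x ^+ k / (k`!%:R * k`!%:R) = (q * x) ^+ k / k`!%:R * (q^-1 ^+ k / k`!%:R).
  rewrite exprMn exprVn; field.
  by rewrite (lt0r_neq0 f0) expf_neq0// lt0r_neq0.
rewrite ler_wpM2l//.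
  by rewrite divr_ge0 ?exprn_ge0// mulr_ge0// ltW.
by apply: exprn_fact_le_expR; rewrite invr_ge0 ltW.
Qed.

End elementary_bounds.

(** * Euler's integral at k + 1 + i nu: recurrence, nonvanishing, bounds for the inverse *)

Section gamma.
Context {R : realType}.
Notation mu := (@lebesgue_measure R).
Implicit Types (nu : R) (k : nat).

Lemma gamma_kernel_le k (t : R) : 0 < t ->
  t ^+ k * expR (- t) <= k`!%:R * 2 ^+ k * expR (- (2^-1 * t)).
Proof.
move=> t0; have f0 : 0 < k`!%:R :> R by rewrite ltr0n fact_gt0.
have t2 : 0 <= t / 2 by lra.
have := exprn_fact_le_expR k t2; rewrite ler_pdivrMr// => h.
have -> : - (2^-1 * t) = t / 2 - t by lra.
rewrite expRD; have := ler_wpM2r (expR_ge0 (- t)) h.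
rewrite expr_div_n -(ler_pM2l (exprn_gt0 k (ltr0Sn R 1))) => {}h.
apply: le_trans (le_trans h _); last by rewrite le_eqVlt; apply/orP; left; apply/eqP; ring.
by rewrite le_eqVlt; apply/orP; left; apply/eqP; field; rewrite expf_neq0.
Qed.

Lemma integrable_gamma_kernel k (h : R -> R) : measurable_fun setT h ->
  (forall t, `|h t| <= 1) ->
  mu.-integrable `]0, +oo[ (EFin \o (fun t => t ^+ k * expR (- t) * h t)).
Proof.
move=> mh h1; have c0 : 0 < 2^-1 :> R by [].
apply: (integrable_le (g := fun t => k`!%:R * 2 ^+ k * expR (- (2^-1 * t)))) => //.
- by apply: measurable_funTS; mfun.
- move=> t /=; rewrite in_itv/= andbT => t0.
  rewrite normrM ger0_norm ?mulr_ge0 ?expR_ge0 ?exprn_ge0 ?(ltW t0)//.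
  rewrite -[leRHS]mulr1 ler_pM ?mulr_ge0 ?expR_ge0 ?exprn_ge0 ?(ltW t0)//.
  exact: gamma_kernel_le.
- exact: (integrable_scale (k`!%:R * 2 ^+ k) measurable_itv0y (integrable_expR_0y c0)).
Qed.

(* [gamRe nu k] and [gamIm nu k] are the real and imaginary parts of
   [Gamma (k + 1 + i nu)], and [rgamRe], [rgamIm] those of its inverse. *)
Definition gamRe nu k := \int[mu]_(t in `]0, +oo[) (t ^+ k * expR (- t) * cos (nu * ln t)).
Definition gamIm nu k := \int[mu]_(t in `]0, +oo[) (t ^+ k * expR (- t) * sin (nu * ln t)).

Let ic nu k : mu.-integrable `]0, +oo[ (EFin \o (fun t => t ^+ k * expR (- t) * cos (nu * ln t))).
Proof. by apply: integrable_gamma_kernel => [|t]; [mfun|exact: cos_max]. Qed.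

Let is_ nu k : mu.-integrable `]0, +oo[ (EFin \o (fun t => t ^+ k * expR (- t) * sin (nu * ln t))).
Proof. by apply: integrable_gamma_kernel => [|t]; [mfun|exact: sin_max]. Qed.

Let cvg0 k (h : R -> R) : (forall t, `|h t| <= 1) ->
  t ^+ k.+1 * expR (- t) * h t @[t --> 0^'+] --> 0.
Proof.
move=> h1; apply: norm_cvg0.
apply: (@squeeze_cvgr _ _ _ _ (fun=> 0) (fun t : R => t)); last 2 first.
- exact: cvg_cst.
- by apply: cvg_at_right_filter; exact: cvg_id.
near=> t; have t0 : 0 < t by near: t; exact: nbhs_right_gt.
have t1 : t <= 1 by near: t; apply: nbhs_right_le.
rewrite normr_ge0/= normrM ger0_norm ?mulr_ge0 ?expR_ge0 ?exprn_ge0 ?(ltW t0)//.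
rewrite -[leRHS]mulr1 ler_pM ?mulr_ge0 ?expR_ge0 ?exprn_ge0 ?(ltW t0)//.
rewrite -[leRHS]mulr1 ler_pM ?expR_ge0 ?exprn_ge0 ?(ltW t0)//.
  by rewrite exprS ler_piMr ?(ltW t0)// exprn_ile1// ltW.
by rewrite expR_le1 oppr_le0 ltW.
Unshelve. all: by end_near. Qed.

Let cvgy k (h : R -> R) : (forall t, `|h t| <= 1) ->
  t ^+ k * expR (- t) * h t @[t --> +oo] --> 0.
Proof.
move=> h1; have c0 : 0 < 2^-1 :> R by [].
apply: norm_cvg0.
apply: (@squeeze_cvgr _ _ _ _ (fun=> 0) (fun t : R => k`!%:R * 2 ^+ k * expR (- (2^-1 * t)))); last 2 first.
- exact: cvg_cst.
- rewrite -[X in _ --> X](mulr0 (k`!%:R * 2 ^+ k)).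
  by apply: cvgM; [exact: cvg_cst|exact: cvgy_expRN].
near=> t; have t0 : 0 < t by near: t; apply: nbhs_pinfty_gt; exact: num_real.
rewrite normr_ge0/= normrM ger0_norm ?mulr_ge0 ?expR_ge0 ?exprn_ge0 ?(ltW t0)//.
rewrite -[leRHS]mulr1 ler_pM ?mulr_ge0 ?expR_ge0 ?exprn_ge0 ?(ltW t0)//.
exact: gamma_kernel_le.
Unshelve. all: by end_near. Qed.

Let dln_id (t : R) : 0 < t -> der (@ln R) t t^-1.
Proof. by move=> t0; apply: der_eq; [exact: der_ln t0 (der_id t)|rewrite mul1r]. Qed.

(** The real part of Gamma(s + 1) = s Gamma(s) at s = k + 1 + i nu, by integrating the derivative of
    t^(k+1) exp(- t) cos(nu ln t). [gamImS] is the imaginary part. *)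
Lemma gamReS nu k : gamRe nu k.+1 = k.+1%:R * gamRe nu k - nu * gamIm nu k.
Proof.
pose F t := t ^+ k.+1 * expR (- t) * cos (nu * ln t).
pose f t := (k.+1%:R * (t ^+ k * expR (- t) * cos (nu * ln t)) -
   nu * (t ^+ k * expR (- t) * sin (nu * ln t))) - t ^+ k.+1 * expR (- t) * cos (nu * ln t).
have dF t : 0 < t -> der F t (f t).
  move=> t0; have dl := dln_id t0.
  by derive; rewrite /f exprS; field; exact: lt0r_neq0.
have i1 := integrable_scale k.+1%:R measurable_itv0y (ic nu k).
have i2 := integrable_scale nu measurable_itv0y (is_ nu k).
have i3 := integrable_sub measurable_itv0y i1 i2.
have fi : mu.-integrable `]0, +oo[ (EFin \o f) := integrable_sub measurable_itv0y i3 (ic nu k.+1).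
have := FTC_0y dF _ (cvg0 k (fun t => cos_max (nu * ln t))) (cvgy k.+1 (fun t => cos_max (nu * ln t))) fi.
rewrite subrr RintegralB// RintegralB// !RintegralZl// -/(gamRe _ _) -/(gamIm _ _) -/(gamRe _ _).
move=> h; suff : k.+1%:R * gamRe nu k - nu * gamIm nu k - gamRe nu k.+1 = 0 by lra.
apply: h => t t0; have dl := dln_id t0; apply: der_continuous.
by rewrite /f; derive.
Qed.

Lemma gamImS nu k : gamIm nu k.+1 = k.+1%:R * gamIm nu k + nu * gamRe nu k.
Proof.
pose F t := t ^+ k.+1 * expR (- t) * sin (nu * ln t).
pose f t := (k.+1%:R * (t ^+ k * expR (- t) * sin (nu * ln t)) +
   nu * (t ^+ k * expR (- t) * cos (nu * ln t))) - t ^+ k.+1 * expR (- t) * sin (nu * ln t).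
have dF t : 0 < t -> der F t (f t).
  move=> t0; have dl := dln_id t0.
  by derive; rewrite /f exprS; field; exact: lt0r_neq0.
have i1 := integrable_scale k.+1%:R measurable_itv0y (is_ nu k).
have i2 := integrable_scale nu measurable_itv0y (ic nu k).
have i3 := integrable_add measurable_itv0y i1 i2.
have fi : mu.-integrable `]0, +oo[ (EFin \o f) := integrable_sub measurable_itv0y i3 (is_ nu k.+1).
have := FTC_0y dF _ (cvg0 k (fun t => sin_max (nu * ln t))) (cvgy k.+1 (fun t => sin_max (nu * ln t))) fi.
rewrite subrr RintegralB// RintegralD// !RintegralZl// -/(gamRe _ _) -/(gamIm _ _) -/(gamIm _ _).
move=> h; suff : k.+1%:R * gamIm nu k + nu * gamRe nu k - gamIm nu k.+1 = 0 by lra.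
apply: h => t t0; have dl := dln_id t0; apply: der_continuous.
by rewrite /f; derive.
Qed.

Lemma gamRe0 k : gamRe 0 k = k`!%:R.
Proof.
elim: k => [|k IH]; last by rewrite gamReS mul0r subr0 IH factS natrM.
rewrite fact0 -[RHS]invr1 -(Rintegral_expR_0y ltr01); apply: eq_Rintegral => t _.
by rewrite expr0 mul0r cos0 mulr1 !mul1r.
Qed.

Definition gamSq nu k := gamRe nu k ^+ 2 + gamIm nu k ^+ 2.

Lemma gamSqS nu k : gamSq nu k.+1 = (k.+1%:R ^+ 2 + nu ^+ 2) * gamSq nu k.
Proof. by rewrite /gamSq gamReS gamImS; ring. Qed.

Lemma gamSq_ge0 nu k : 0 <= gamSq nu k.
Proof. by rewrite addr_ge0// sqr_ge0. Qed.

(* The mass of [t ^ k exp (- t) / k!] concentrates near [t = k], so for large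
   [k] the phase of [Gamma (k + 1 + i nu)] is close to that of [k ^ (i nu)]. *)
Lemma gamSq_neq0_large nu k : 2 * nu ^+ 2 < k.+1%:R -> gamSq nu k.+1 != 0.
Proof.
move=> kl; apply/eqP => g0.
have K0 : 0 < k.+1%:R :> R by [].
have [A0 B0] : gamRe nu k.+1 = 0 /\ gamIm nu k.+1 = 0.
  have := sqr_ge0 (gamRe nu k.+1); have := sqr_ge0 (gamIm nu k.+1).
  move: g0; rewrite /gamSq => g0 h1 h2.
  by split; apply/eqP; rewrite -sqrf_eq0; apply/eqP; lra.
pose m j t := t ^+ j * expR (- t) * cos (0 * ln t) : R.
(* [l] is the Gamma kernel times cos(nu ln(t/(k+1))), whose integral is 0 if Gamma vanishes. [r] is
   a lower bound for it, from [cos_ge] and [ln_sqr_le]; its integral is a combination of factorials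
   equal to k! (k + 1 - 2 nu^2), which is positive. *)
pose l (t : R) := (cos (nu * ln k.+1%:R) * (t ^+ k.+1 * expR (- t) * cos (nu * ln t)) +
  sin (nu * ln k.+1%:R) * (t ^+ k.+1 * expR (- t) * sin (nu * ln t))).
pose r (t : R) := (1 + 4 * nu ^+ 2) * m k.+1 t -
  ((2 * nu ^+ 2 / k.+1%:R) * m k.+2 t + (2 * nu ^+ 2 * k.+1%:R) * m k t).
have I1 := integrable_scale (cos (nu * ln k.+1%:R)) measurable_itv0y (ic nu k.+1).
have I2 := integrable_scale (sin (nu * ln k.+1%:R)) measurable_itv0y (is_ nu k.+1).
have J1 := integrable_scale (1 + 4 * nu ^+ 2) measurable_itv0y (ic 0 k.+1).
have J2 := integrable_scale (2 * nu ^+ 2 / k.+1%:R) measurable_itv0y (ic 0 k.+2).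
have J3 := integrable_scale (2 * nu ^+ 2 * k.+1%:R) measurable_itv0y (ic 0 k).
have J23 := integrable_add measurable_itv0y J2 J3.
have li : mu.-integrable `]0, +oo[ (EFin \o l) := integrable_add measurable_itv0y I1 I2.
have ri : mu.-integrable `]0, +oo[ (EFin \o r) := integrable_sub measurable_itv0y J1 J23.
have : \int[mu]_(t in `]0, +oo[) r t <= \int[mu]_(t in `]0, +oo[) l t.
  apply: le_Rintegral => // t /=; rewrite in_itv/= andbT => t0.
  have -> : l t = t ^+ k.+1 * expR (- t) * cos (nu * ln (t / k.+1%:R)).
    by rewrite ln_div ?posrE// mulrBr cosB /l; ring.
  have -> : r t = t ^+ k.+1 * expR (- t) *
      (1 - 2 * nu ^+ 2 * (t / k.+1%:R + (t / k.+1%:R)^-1 - 2)).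
    rewrite /r /m mul0r cos0 !exprS; move: (lt0r_neq0 t0) (lt0r_neq0 K0).
    by move: (k.+1%:R : R) => c t0' c0; field; rewrite t0' c0.
  rewrite ler_wpM2l ?mulr_ge0 ?expR_ge0 ?exprn_ge0 ?(ltW t0)//.
  apply: le_trans (cos_ge _); rewrite exprMn.
  have tk : 0 < t / k.+1%:R by rewrite divr_gt0.
  move: tk; move: (t / k.+1%:R) => a tk.
  by have := ler_wpM2l (sqr_ge0 nu) (ln_sqr_le tk); lra.
have im j : mu.-integrable `]0, +oo[ (EFin \o m j) := ic 0 j.
rewrite RintegralB// RintegralD// RintegralD// !RintegralZl//.
rewrite -!/(gamRe _ _) -/(gamIm _ _) A0 B0 !gamRe0 !mulr0 addr0.
rewrite !factS !natrM.
have f0 : 0 < k`!%:R :> R by rewrite ltr0n fact_gt0.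
have -> : (1 + 4 * nu ^+ 2) * (k.+1%:R * k`!%:R) -
    (2 * nu ^+ 2 / k.+1%:R * (k.+2%:R * (k.+1%:R * k`!%:R)) + 2 * nu ^+ 2 * k.+1%:R * k`!%:R) =
    k`!%:R * (k.+1%:R - 2 * nu ^+ 2) :> R.
  rewrite -[k.+2%:R]natr1; move: (lt0r_neq0 K0).
  by move: (k.+1%:R : R) => c c0; field.
by rewrite leNgt mulr_gt0// subr_gt0.
Qed.

(** A zero at k = 0 would propagate through the recurrence to every k, against
    [gamSq_neq0_large]. *)
Lemma gamSq0_gt0 nu : 0 < gamSq nu 0.
Proof.
rewrite lt_neqAle gamSq_ge0 andbT eq_sym; apply/eqP => g0.
have gz k : gamSq nu k = 0 by elim: k => // k IH; rewrite gamSqS IH mulr0.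
have := @gamSq_neq0_large nu (Num.truncn (2 * nu ^+ 2)) (truncnS_gt _).
by rewrite gz eqxx.
Qed.

(** Each step of the recurrence multiplies by (k+1)^2 + nu^2 >= (k+1)^2. Hence 1/Gamma(k + 1 + i nu)
    is bounded by a constant over k!, which drives all convergence in the series for J. *)
Lemma gamSq_ge nu k : gamSq nu 0 * k`!%:R ^+ 2 <= gamSq nu k.
Proof.
elim: k => [|k IH]; first by rewrite fact0 expr1n mulr1.
rewrite gamSqS factS natrM exprMn; have := gamSq_ge0 nu k; have := sqr_ge0 nu.
by move=> h1 h2; have := ler_wpM2l (sqr_ge0 k.+1%:R) IH; nra.
Qed.

Lemma gamSq_gt0 nu k : 0 < gamSq nu k.
Proof.
apply: lt_le_trans (gamSq_ge nu k); rewrite mulr_gt0 ?gamSq0_gt0// exprn_gt0//.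
Qed.

Definition rgamRe nu k := gamRe nu k / gamSq nu k.
Definition rgamIm nu k := - (gamIm nu k / gamSq nu k).
Definition rgam_bound nu := (Num.sqrt (gamSq nu 0))^-1.

Let rgam_le nu k x : x ^+ 2 <= gamSq nu k ->
  `|x / gamSq nu k| <= rgam_bound nu / k`!%:R.
Proof.
move=> xg; have g0 := gamSq_gt0 nu k; have g00 := gamSq0_gt0 nu.
have f0 : 0 < k`!%:R :> R by rewrite ltr0n fact_gt0.
have s0 : 0 < Num.sqrt (gamSq nu 0) by rewrite sqrtr_gt0.
rewrite normrM normfV (gtr0_norm g0) ler_pdivrMr//.
rewrite /rgam_bound -invfM mulrC ler_pdivlMr ?mulr_gt0//.
rewrite -ler_sqr ?nnegrE; [|by rewrite !mulr_ge0// ltW|exact: ltW].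
rewrite !exprMn real_normK ?num_real// (sqr_sqrtr (ltW g00)) [leRHS]expr2.
apply: ler_pM => //; [exact: sqr_ge0|by rewrite mulr_ge0 ?sqr_ge0// (ltW g00)|exact: gamSq_ge].
Qed.

Lemma rgamRe_le nu k : `|rgamRe nu k| <= rgam_bound nu / k`!%:R.
Proof. by apply: rgam_le; rewrite lerDl sqr_ge0. Qed.

Lemma rgamIm_le nu k : `|rgamIm nu k| <= rgam_bound nu / k`!%:R.
Proof. by rewrite normrN; apply: rgam_le; rewrite lerDr sqr_ge0. Qed.

Lemma rgam_mulRe nu k : rgamRe nu k * gamRe nu k - rgamIm nu k * gamIm nu k = 1.
Proof.
have g0 := lt0r_neq0 (gamSq_gt0 nu k).
rewrite /rgamRe /rgamIm mulNr opprK.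
by move: g0; rewrite /gamSq => g0; field.
Qed.

Lemma rgam_mulIm nu k : rgamRe nu k * gamIm nu k + rgamIm nu k * gamRe nu k = 0.
Proof. by rewrite /rgamRe /rgamIm; ring. Qed.

End gamma.

(** * The Bessel function of imaginary order *)

Section complex_limits.
Context {R : realType}.
Lemma normc_le_add (a b : R) : `|a +i* b| <= (`|a| + `|b|)%:C.
Proof.
rewrite normc_def lecR /=.
rewrite -[leRHS]ger0_norm ?addr_ge0// -sqrtr_sqr ler_wsqrtr//.
rewrite sqrrD !real_normK ?num_real//.
by have := mulr_ge0 (normr_ge0 a) (normr_ge0 b); lra.
Qed.

Lemma cvg_complex (u v : nat -> R) (a b : R) :
  u n @[n --> \oo] --> a -> v n @[n --> \oo] --> b ->
  (u n +i* v n : R[i]) @[n --> \oo] --> (a +i* b : R[i]).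
Proof.
move=> ua vb; apply/cvgrPdist_lt => e e0.
have [eR e0'] : e = (complex.Re e)%:C /\ 0 < complex.Re e.
  by case: e e0 => x y; rewrite ltcE /= => /andP[/eqP -> ->].
rewrite eR; have e2 : 0 < complex.Re e / 2 by rewrite divr_gt0.
move/cvgrPdist_lt : ua => /(_ _ e2) ua; move/cvgrPdist_lt : vb => /(_ _ e2) vb.
near=> n.
have h1 : `|a - u n| < complex.Re e / 2 by near: n.
have h2 : `|b - v n| < complex.Re e / 2 by near: n.
apply: (@le_lt_trans _ _ (`|a - u n| + `|b - v n|)%:C); first exact: normc_le_add.
by rewrite ltcR; lra.
Unshelve. all: by end_near. Qed.

End complex_limits.

(** * The power series of J and Weber's Laplace transform *)

Section bessel_series.
Context {R : realType}.
Notation mu := (@lebesgue_measure R).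

Section bounded_coefficients.
Variables (c : nat -> R) (M : R).
Hypothesis cM : forall k, `|c k| <= M / k`!%:R.

Definition bes_sum (x : R) N := \sum_(0 <= k < N) (-1) ^+ k * x ^+ k / k`!%:R * c k.
Definition bes (x : R) := limn (bes_sum x).

Let M0 : 0 <= M.
Proof. by have := le_trans (normr_ge0 _) (cM 0); rewrite fact0 divr1. Qed.

Let abs_sum_le (x q : R) N : 0 < q ->
  \sum_(0 <= k < N) `|(-1) ^+ k * x ^+ k / k`!%:R * c k| <= M * expR (q * `|x| + q^-1).
Proof.
move=> q0; have := ler_wpM2l M0 (sum_exprn_fact2_le N (normr_ge0 x) q0).
apply: le_trans; rewrite mulr_sumr; apply: ler_sum => k _.
rewrite !normrM normrX normrN1 expr1n mul1r normfV normr_nat normrX.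
have f0 : 0 < k`!%:R :> R by rewrite ltr0n fact_gt0.
have -> : M * (`|x| ^+ k / (k`!%:R * k`!%:R)) = `|x| ^+ k / k`!%:R * (M / k`!%:R).
  by field; rewrite lt0r_neq0.
by rewrite ler_wpM2l ?divr_ge0 ?exprn_ge0.
Qed.

(** The parameter [q] is kept free because it is chosen in two ways: a fixed small rate gives a
    bound integrable against an exponential, and q = 1 / sqrt x gives the growth exp(2 sqrt x). *)
Lemma bes_sum_le (x q : R) N : 0 < q -> `|bes_sum x N| <= M * expR (q * `|x| + q^-1).
Proof. by move=> q0; apply: le_trans (ler_norm_sum _ _ _) (abs_sum_le _ _ q0). Qed.

Lemma cvg_bes (x : R) : bes_sum x N @[N --> \oo] --> bes x.
Proof.
suff : cvgn (bes_sum x) by [].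
have nd : nondecreasing_seq (fun N => \sum_(0 <= k < N) `|(-1) ^+ k * x ^+ k / k`!%:R * c k|).
  by apply/nondecreasing_seqP => n; rewrite big_nat_recr//= lerDl.
apply: normed_cvg; apply: (nondecreasing_is_cvgn nd).
exists (M * expR (1 * `|x| + 1^-1)) => _ [N _ <-].
exact: abs_sum_le.
Qed.

Lemma bes_le (x q : R) : 0 < q -> `|bes x| <= M * expR (q * `|x| + q^-1).
Proof.
move=> q0; have h : `|bes_sum x N| @[N --> \oo] --> `|bes x| by apply: cvg_norm; exact: cvg_bes.
rewrite -(cvg_lim _ h)//; apply: limr_le; first by apply/cvg_ex; eexists; exact: h.
by apply: nearW => N; exact: bes_sum_le.
Qed.

Lemma measurable_bes_sum d (T : measurableType d) (D : set T) (f : T -> R) N :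
  measurable_fun D f -> measurable_fun D (fun x => bes_sum (f x) N).
Proof.
move=> mf; rewrite /bes_sum; apply: measurable_sum => k.
by mfun.
Qed.

Lemma measurable_bes : measurable_fun setT bes.
Proof.
apply: (measurable_fun_cvg (h := fun N x => bes_sum x N)) => //.
- by move=> N; apply: measurable_bes_sum.
- by move=> x _; exact: cvg_bes.
Qed.

End bounded_coefficients.

Implicit Types nu X p : R.

(* With [t = nu * ln X / 2], [bes_re nu X * sin t + bes_im nu X * cos t] is
   [Im J_(i nu) (2 sqrt X)]. *)
Definition bes_re nu X := bes (rgamRe nu) X.
Definition bes_im nu X := bes (rgamIm nu) X.

Lemma bes_re_le nu X q : 0 < q -> `|bes_re nu X| <= rgam_bound nu * expR (q * `|X| + q^-1).
Proof. by move=> q0; apply: bes_le => //; exact: rgamRe_le. Qed.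

Lemma bes_im_le nu X q : 0 < q -> `|bes_im nu X| <= rgam_bound nu * expR (q * `|X| + q^-1).
Proof. by move=> q0; apply: bes_le => //; exact: rgamIm_le. Qed.

Lemma measurable_bes_re nu d (T : measurableType d) (D : set T) (f : T -> R) :
  measurable_fun D f -> measurable_fun D (fun x => bes_re nu (f x)).
Proof.
by move=> mf; apply: measurableT_comp => //; apply: measurable_bes; exact: rgamRe_le.
Qed.

Lemma measurable_bes_im nu d (T : measurableType d) (D : set T) (f : T -> R) :
  measurable_fun D f -> measurable_fun D (fun x => bes_im nu (f x)).
Proof.
by move=> mf; apply: measurableT_comp => //; apply: measurable_bes; exact: rgamIm_le.
Qed.

Lemma rgam_bound_ge0 nu : 0 <= rgam_bound nu.
Proof. by rewrite invr_ge0 sqrtr_ge0. Qed.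

(** The phase is an independent argument, since multiplication by K moves it away from nu ln X /
    2. *)
Definition bessel_mix nu X t := bes_re nu X * sin t + bes_im nu X * cos t.

Lemma bessel_mix_le nu X t q : 0 < q ->
  `|bessel_mix nu X t| <= 2 * rgam_bound nu * expR (q * `|X| + q^-1).
Proof.
move=> q0; apply: le_trans (ler_normD _ _) _; rewrite !normrM.
have h1 : `|bes_re nu X| * `|sin t| <= `|bes_re nu X| by rewrite ler_piMr// sin_max.
have h2 : `|bes_im nu X| * `|cos t| <= `|bes_im nu X| by rewrite ler_piMr// cos_max.
by have := bes_re_le nu X q0; have := bes_im_le nu X q0; lra.
Qed.

Lemma integrable_gamma_cos nu p phi k : 0 < p ->
  mu.-integrable `]0, +oo[ (EFin \o (fun X => X ^+ k * expR (- (p * X)) * cos (nu * ln X + phi))).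
Proof.
move=> p0.
have c0 : 0 < p / 2 by rewrite divr_gt0.
apply: (integrable_le (g := fun X => (2 / p) ^+ k * k`!%:R * expR (- (p / 2 * X)))) => //.
- by apply: measurable_funTS; mfun.
- move=> t /=; rewrite in_itv/= andbT => t0.
  rewrite normrM ger0_norm ?mulr_ge0 ?expR_ge0 ?exprn_ge0 ?(ltW t0)//.
  apply: (@le_trans _ _ (t ^+ k * expR (- (p * t)))).
    by rewrite ler_piMr ?mulr_ge0 ?expR_ge0 ?exprn_ge0 ?(ltW t0)// cos_max.
  have f0 : 0 < k`!%:R :> R by rewrite ltr0n fact_gt0.
  have t2 : 0 <= p * t / 2 by rewrite divr_ge0 ?mulr_ge0// ltW.
  have := exprn_fact_le_expR k t2; rewrite ler_pdivrMr// => h.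
  have -> : t ^+ k = (2 / p) ^+ k * (p * t / 2) ^+ k.
    by rewrite -exprMn; congr (_ ^+ _); field; exact: lt0r_neq0.
  have q0 : 0 <= (2 / p) ^+ k by rewrite exprn_ge0// divr_ge0// ltW.
  have -> : - (p * t) = - (p / 2 * t) - p * t / 2 by lra.
  rewrite expRD -[leLHS]mulrA -[leRHS]mulrA; apply: ler_wpM2l => //.
  rewrite mulrCA [leRHS]mulrC; apply: ler_wpM2l; first exact: expR_ge0.
  by rewrite expRN ler_pdivrMr ?expR_gt0// [leRHS]mulrC.
- exact: (integrable_scale _ measurable_itv0y (integrable_expR_0y c0)).
Qed.

Lemma measurable_mix nu d (T : measurableType d) (D : set T) (f g : T -> R) :
  measurable_fun D f -> measurable_fun D g ->
  measurable_fun D (fun x => bessel_mix nu (f x) (g x)).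
Proof.
move=> mf mg; apply: mfunD; apply: mfunM.
- exact: measurable_bes_re.
- exact: mfun_sin.
- exact: measurable_bes_im.
- exact: mfun_cos.
Qed.

(** After scaling by p this is the real part of p^(-k-1) exp(i (phi - nu ln p)) Gamma(k + 1 + i
    nu). *)
Lemma Rintegral_gamma_cos nu p phi k : 0 < p ->
  \int[mu]_(X in `]0, +oo[) (X ^+ k * expR (- (p * X)) * cos (nu * ln X + phi)) =
  p^-1 ^+ k.+1 * (gamRe nu k * cos (phi - nu * ln p) - gamIm nu k * sin (phi - nu * ln p)).
Proof.
move=> p0; have ip0 : 0 < p^-1 by rewrite invr_gt0.
set s := phi - nu * ln p.
have I1 := integrable_gamma_kernel k (h := fun t => cos (nu * ln t)) ltac:(mfun) (fun t => cos_max _).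
have I2 := integrable_gamma_kernel k (h := fun t => sin (nu * ln t)) ltac:(mfun) (fun t => sin_max _).
have I3 := integrable_sub measurable_itv0y (integrable_scale (cos s) measurable_itv0y I1)
  (integrable_scale (sin s) measurable_itv0y I2).
have I4 := integrable_gamma_cos nu phi k p0.
rewrite (Rintegral_scale_0y ip0 I4) exprS -mulrA; congr (_ * _).
rewrite [gamRe nu k * _]mulrC [gamIm nu k * _]mulrC.
rewrite -!(RintegralZl (mu := mu))// -(RintegralB (mu := mu))//; last 2 first.
- exact: (integrable_scale (cos s) measurable_itv0y I1).
- exact: (integrable_scale (sin s) measurable_itv0y I2).
rewrite -(RintegralZl (mu := mu))//; apply: eq_Rintegral => t; rewrite mem_itv0y => t0.
have -> : nu * ln (p^-1 * t) + phi = nu * ln t + s.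
  by rewrite lnM ?posrE// lnV ?posrE// /s; ring.
rewrite exprMn mulrA divff ?lt0r_neq0// mul1r cosD; ring.
Qed.

(** Term by term, the Gamma value produced by the integral cancels the reciprocal Gamma coefficient
    and leaves the exponential series at - 1/p. The integrability is returned as well, since later
    rescalings of the integral rely on it. *)
Lemma weber nu p phi : 0 < p ->
  mu.-integrable `]0, +oo[ (EFin \o (fun X => expR (- (p * X)) * bessel_mix nu X (nu * ln X + phi))) /\
  \int[mu]_(X in `]0, +oo[) (expR (- (p * X)) * bessel_mix nu X (nu * ln X + phi)) =
  p^-1 * expR (- p^-1) * sin (phi - nu * ln p).
Proof.
move=> p0; have ip0 : 0 < p^-1 by rewrite invr_gt0.
pose th X := nu * ln X + phi; set psi := phi - nu * ln p.
pose h N X := expR (- (p * X)) * (bes_sum (rgamRe nu) X N * sin (th X) +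
  bes_sum (rgamIm nu) X N * cos (th X)).
(* A phase shift by pi/2 writes the sine terms as cosines, so that [Rintegral_gamma_cos] covers
   both. *)
have cosBh (t : R) : cos (t - pi / 2) = sin t by rewrite cosB cos_pihalf sin_pihalf; ring.
have sinBh (t : R) : sin (t - pi / 2) = - cos t by rewrite sinB cos_pihalf sin_pihalf; ring.
have kc k phi' := integrable_gamma_cos nu phi' k p0.
pose w k X := (-1) ^+ k / k`!%:R * rgamRe nu k * (X ^+ k * expR (- (p * X)) * cos (nu * ln X + (phi - pi / 2))) +
  (-1) ^+ k / k`!%:R * rgamIm nu k * (X ^+ k * expR (- (p * X)) * cos (nu * ln X + phi)).
have hw N X : h N X = \sum_(0 <= k < N) w k X.
  rewrite /h /bes_sum !mulr_suml -big_split/= mulr_sumr; apply: eq_bigr => k _.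
  by rewrite /w addrA -/(th X) cosBh; ring.
have wi k : mu.-integrable `]0, +oo[ (EFin \o w k).
  apply: (integrable_add measurable_itv0y);
    by apply: (integrable_scale _ measurable_itv0y); exact: kc.
have wE k : \int[mu]_(X in `]0, +oo[) w k X = (-1) ^+ k / k`!%:R * p^-1 ^+ k.+1 * sin psi.
  rewrite RintegralD//; last 2 first.
  - by apply: (integrable_scale _ measurable_itv0y); exact: kc.
  - by apply: (integrable_scale _ measurable_itv0y); exact: kc.
  rewrite !RintegralZl// ?Rintegral_gamma_cos//; try exact: kc.
  rewrite addrAC -/psi cosBh sinBh.
  transitivity ((-1) ^+ k / k`!%:R * p^-1 ^+ k.+1 * (sin psi *
     (rgamRe nu k * gamRe nu k - rgamIm nu k * gamIm nu k) +
     cos psi * (rgamRe nu k * gamIm nu k + rgamIm nu k * gamRe nu k))); first ring.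
  by rewrite rgam_mulRe rgam_mulIm; ring.
have hE N : \int[mu]_(X in `]0, +oo[) h N X =
    p^-1 * sin psi * \sum_(0 <= k < N) (- p^-1) ^+ k / k`!%:R.
  under eq_Rintegral do rewrite hw.
  rewrite (Rintegral_sumn N measurable_itv0y wi).2.
  rewrite mulr_sumr; apply: eq_bigr => k _; rewrite wE [(- _ ^-1) ^+ k]exprNn exprS.
  by generalize (sin psi) (p^-1) => a b; ring.
(* With q = p/2 the partial sums grow at most like exp(p X / 2), so half of the decay exp(- p X)
   survives as a majorant. *)
have c0 : 0 < p / 2 by rewrite divr_gt0.
have [||||I H] := @Rintegral_dominated_cvg R `]0, +oo[ h
   (fun X => expR (- (p * X)) * bessel_mix nu X (th X))
   (fun X => 2 * rgam_bound nu * expR ((p / 2)^-1) * expR (- (p / 2 * X))) measurable_itv0y.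
- move=> N; apply: measurable_funTS; rewrite /h.
  by repeat first [apply: measurable_bes_sum | mfun_step]; rewrite /th; mfun.
- move=> X _; apply: cvgM; first exact: cvg_cst.
  by apply: cvgD; apply: cvgM; try exact: cvg_cst; apply: cvg_bes; [exact: rgamRe_le|exact: rgamIm_le].
- move=> N X /=; rewrite in_itv/= andbT => X0.
  rewrite /h normrM ger0_norm ?expR_ge0//.
  have h1 := bes_sum_le (rgamRe_le nu) X N c0.
  have h2 := bes_sum_le (rgamIm_le nu) X N c0.
  have -> : expR (- (p / 2 * X)) = expR (- (p * X)) * expR (p / 2 * X).
    by rewrite -expRD; congr expR; lra.
  rewrite mulrCA; apply: ler_wpM2l; first exact: expR_ge0.
  move: h1 h2; rewrite (gtr0_norm X0) [p / 2 * X + _]addrC expRD => h1 h2.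
  apply: le_trans (ler_normD _ _) _; rewrite !normrM.
  have h3 := ler_piMr (normr_ge0 (bes_sum (rgamRe nu) X N)) (sin_max (th X)).
  have h4 := ler_piMr (normr_ge0 (bes_sum (rgamIm nu) X N)) (cos_max (th X)).
  lra.
- exact: (integrable_scale _ measurable_itv0y (integrable_expR_0y c0)).
rewrite (_ : (fun N => _) = fun N => p^-1 * sin psi * \sum_(0 <= k < N) (- p^-1) ^+ k / k`!%:R) in H;
  last by apply/funext => N; exact: hE.
split; first exact: I.
apply: (cvg_unique _ H) => //; rewrite mulrAC.
have E := exp_series_cvg (x := - p^-1).
by apply: cvgM; [exact: cvg_cst|exact: E].
Qed.

Lemma imag_orderE n : 'i%C * n%:R = 0 +i* n%:R :> R[i].
Proof.
have -> : n%:R = n%:R +i* 0 :> R[i] by rewrite -[RHS]/((n%:R)%:C) rmorph_nat.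
by apply/eqP; rewrite eq_complex/= !mul0r !mul1r subr0 add0r !eqxx.
Qed.

Lemma cpow_realimag (s a b : R) :
  cpow s (a +i* b) = (expR (a * ln s) * cos (b * ln s)) +i* (expR (a * ln s) * sin (b * ln s)).
Proof.
rewrite /cpow /cexp; apply/eqP; rewrite eq_complex/=.
by rewrite !mulr0 !subr0 !mul0r !add0r !subr0 !addr0 !eqxx.
Qed.

Lemma cgamma_imag n k : cgamma ('i%C * n%:R + k%:R + 1) = gamRe n%:R k +i* gamIm n%:R k :> R[i].
Proof.
have sE : 'i%C * n%:R + k%:R + 1 - 1 = k%:R +i* n%:R :> R[i].
  have kE : k%:R = k%:R +i* 0 :> R[i] by rewrite -[RHS]/((k%:R)%:C) rmorph_nat.
  rewrite addrK imag_orderE kE; apply/eqP; rewrite eq_complex/=.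
  by rewrite add0r addr0 !eqxx.
have E (t : R) : 0 < t -> expR (k%:R * ln t) = t ^+ k.
  by move=> t0; rewrite expRM_natl lnK.
rewrite /cgamma /Cintegral sE; congr (_ +i* _); apply: eq_Rintegral => t;
  rewrite mem_itv0y => t0; rewrite cpow_realimag/= E//; ring.
Qed.

(** The factor (sqrt X)^(i n) has modulus 1 and phase n ln X / 2; it rotates the reciprocal Gamma
    value, whose parts are [rgamRe] and [rgamIm]. *)
Lemma besselJ_term n k (X : R) : 0 < X ->
  (-1) ^+ k * cpow (2 * Num.sqrt X / 2) ('i%C * n%:R + (2 * k)%:R)
      / ((k`!)%:R * cgamma ('i%C * n%:R + k%:R + 1)) =
  ((-1) ^+ k * X ^+ k / k`!%:R) %:C *
   ((rgamRe n%:R k * cos (n%:R * ln X / 2) - rgamIm n%:R k * sin (n%:R * ln X / 2)) +i*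
    (rgamRe n%:R k * sin (n%:R * ln X / 2) + rgamIm n%:R k * cos (n%:R * ln X / 2))) :> R[i].
Proof.
move=> X0; have sX : 0 < Num.sqrt X by rewrite sqrtr_gt0.
have -> : 2 * Num.sqrt X / 2 = Num.sqrt X by rewrite mulrAC divff ?mul1r.
have lE : ln X = 2 * ln (Num.sqrt X).
  by rewrite -{1}(sqr_sqrtr (ltW X0)) lnXn// mulr_natl.
have -> : 'i%C * n%:R + (2 * k)%:R = (2 * k)%:R +i* n%:R :> R[i].
  have kE : (2 * k)%:R = (2 * k)%:R +i* 0 :> R[i] by rewrite -[RHS]/(((2 * k)%:R)%:C) rmorph_nat.
  by rewrite imag_orderE kE; apply/eqP; rewrite eq_complex/= add0r addr0 !eqxx.
rewrite cpow_realimag.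
have -> : expR ((2 * k)%:R * ln (Num.sqrt X)) = X ^+ k.
  by rewrite expRM_natl lnK ?posrE// exprM sqr_sqrtr// ltW.
set A := rgamRe _ _; set B := rgamIm _ _.
have g1 : (A +i* B) * cgamma ('i%C * n%:R + k%:R + 1) = 1.
  rewrite cgamma_imag; apply/eqP; rewrite eq_complex/=.
  by rewrite rgam_mulRe rgam_mulIm !eqxx.
have g0 : cgamma ('i%C * n%:R + k%:R + 1) != 0 :> R[i].
  by apply: contra_eq_neq g1 => ->; rewrite mulr0 eq_sym oner_eq0.
have -> : (cgamma ('i%C * n%:R + k%:R + 1) : R[i]) = (A +i* B)^-1.
  by apply: (mulfI (_ : A +i* B != 0)); [apply: contra_eq_neq g1 => ->; rewrite mul0r eq_sym oner_eq0|rewrite g1 divff//; apply: contra_eq_neq g1 => ->; rewrite mul0r eq_sym oner_eq0].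
rewrite invfM invrK.
have -> : (-1) ^+ k = ((-1) ^+ k)%:C :> R[i] by rewrite rmorphXn/= rmorphN1.
have -> : (k`!%:R)^-1 = (k`!%:R^-1)%:C :> R[i] by rewrite fmorphV/= rmorph_nat.
have -> : n%:R * ln (Num.sqrt X) = n%:R * ln X / 2 by rewrite lE; field.
move: (cos _) (sin _) (k`!%:R^-1) => c s f.
by apply/eqP; rewrite eq_complex/=; apply/andP; split; apply/eqP; ring.
Qed.

Lemma Im_besselJ n (X : R) : 0 < X ->
  complex.Im (besselJ ('i%C * n%:R) (2 * Num.sqrt X)) = bessel_mix n%:R X (n%:R * ln X / 2).
Proof.
move=> X0; set t := n%:R * ln X / 2.
suff -> : besselJ ('i%C * n%:R) (2 * Num.sqrt X) =
    (bes_re n%:R X * cos t - bes_im n%:R X * sin t) +i* bessel_mix n%:R X t by [].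
have ca : bes_sum (rgamRe n%:R) X N @[N --> \oo] --> bes_re n%:R X.
  by apply: cvg_bes; exact: rgamRe_le.
have cb : bes_sum (rgamIm n%:R) X N @[N --> \oo] --> bes_im n%:R X.
  by apply: cvg_bes; exact: rgamIm_le.
rewrite /besselJ; apply: cvg_lim => //.
rewrite [X in X @ _ --> _](_ : _ = fun N =>
   (bes_sum (rgamRe n%:R) X N * cos t - bes_sum (rgamIm n%:R) X N * sin t) +i*
   (bes_sum (rgamRe n%:R) X N * sin t + bes_sum (rgamIm n%:R) X N * cos t)); last first.
  apply/funext => N; elim: N => [|N IH].
    by rewrite /bes_sum !big_geq// !mul0r subr0 addr0.
  rewrite big_nat_recr//= IH besselJ_term// /bes_sum !(@big_nat_recr _ _ _ N)//= -/t.
  apply/eqP; rewrite eq_complex/= -!/(bes_sum _ _ _); apply/andP; split; apply/eqP; ring.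
by apply: cvg_complex; [apply: cvgB|apply: cvgD]; apply: cvgM => //; exact: cvg_cst.
Qed.

End bessel_series.

(** * The product of the two Bessel functions *)

Section kernel.
Context {R : realType}.
Notation mu := (@lebesgue_measure R).
Implicit Types nu X x y s : R.

Lemma integral_norm_le (D : set R) (f g : R -> R) (c B : R) :
  measurable D -> measurable_fun D f -> 0 <= c ->
  (forall x, D x -> `|f x| <= c * g x) -> mu.-integrable D (EFin \o g) ->
  \int[mu]_(x in D) g x <= B ->
  (\int[mu]_(x in D) `|f x|%:E <= (c * B)%:E)%E.
Proof.
move=> mdom mf c0 fg ig gB.
have icg := integrable_scale c mdom ig.
apply: (@le_trans _ _ (\int[mu]_(x in D) (c * g x)%:E)%E).
  apply: ge0_le_integral => //.
  - by apply/measurable_EFinP; apply: mfun_norm.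
  - by have /integrableP[] := icg.
rewrite -[leLHS]fineK; last exact: integrable_fin_num icg.
have -> : fine (\int[mu]_(x in D) (c * g x)%:E)%E = \int[mu]_(x in D) (c * g x) by [].
by rewrite lee_fin RintegralZl// ler_wpM2l.
Qed.

(** For t <= 0 the second exponential is at most 1. For t > 0, exp(2 a t) <= exp(2 t), and the
    quadratic term of the exponential series at c exp t gives the constant 2 / c^2. *)
Lemma exp_weight_le (a c t : R) : 0 < a <= 1 -> 0 < c ->
  expR (a * t) * expR (- (c * expR t)) <= (1 + 2 / c ^+ 2) * expR (- (a * `|t|)).
Proof.
move=> /andP[a0 a1] c0.
have c2 : 0 <= 2 / c ^+ 2 by rewrite divr_ge0// sqr_ge0.
have [t0|t0] := leP t 0.
  rewrite ler0_norm// mulrN opprK mulrC ler_wpM2r ?expR_ge0//.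
  apply: (@le_trans _ _ 1); last by rewrite lerDl.
  by rewrite expR_le1 oppr_le0 mulr_ge0 ?expR_ge0// ltW.
rewrite gtr0_norm// -(ler_pM2r (expR_gt0 (a * t))) -[leRHS]mulrA.
have -> : expR (- (a * t)) * expR (a * t) = 1 by rewrite -expRD addNr expR0.
rewrite mulr1.
have h : expR (a * t) * expR (a * t) <= expR t ^+ 2.
  by rewrite -expRD -expRM_natl ler_expR; nra.
apply: (@le_trans _ _ (2 / c ^+ 2)); last by rewrite lerDr.
rewrite mulrAC; apply: (@le_trans _ _ (expR t ^+ 2 * expR (- (c * expR t)))).
  by rewrite ler_wpM2r ?expR_ge0.
have := @exprn_fact_le_expR _ (c * expR t) 2 (mulr_ge0 (ltW c0) (expR_ge0 _)).
have -> : 2`!%:R = 2 :> R by [].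
rewrite exprMn => hh.
rewrite expRN ler_pdivrMr ?expR_gt0// [leRHS]mulrAC ler_pdivlMr ?exprn_gt0//; lra.
Qed.

Lemma integrable_exp_weight (a c : R) (f : R -> R) : 0 < a <= 1 -> 0 < c ->
  measurable_fun setT f -> (forall t, `|f t| <= expR (a * t) * expR (- (c * expR t))) ->
  mu.-integrable setT (EFin \o f).
Proof.
move=> a01 c0 mf fb; have /andP[a0 _] := a01.
apply: (integrable_le (g := fun t => (1 + 2 / c ^+ 2) * expR (- (a * `|t|)))) => //.
- by move=> t _; apply: le_trans (fb t) _; exact: exp_weight_le.
- exact: (integrable_scale _ measurableT (integrable_expR_norm a0)).
Qed.

(* [K_(i nu) (2 sqrt X)], and [Im J_(i nu) * K_(i nu)] at the same point. *)
Definition besK nu X := 2^-1 * \int[mu]_t (expR (- (2 * Num.sqrt X * cosh t)) * cos (nu * t)).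

Definition JK nu X := bessel_mix nu X (nu * ln X / 2) * besK nu X.

Lemma measurable_besK nu : measurable_fun setT (besK nu).
Proof.
apply: mfunM; first exact: mfun_cst.
have := @measurable_Rintegral R _ R (fun p => expR (- (2 * Num.sqrt p.1 * cosh p.2)) * cos (nu * p.2)).
by apply; mfun.
Qed.

Lemma measurable_JK nu : measurable_fun setT (JK nu).
Proof.
apply: mfunM; last exact: measurable_besK.
by apply: measurable_mix; mfun.
Qed.

Let ik nu X (h : R -> R) : 0 < X -> measurable_fun setT h -> (forall t, `|h t| <= 1) ->
  mu.-integrable setT (EFin \o (fun t => expR (- (2 * Num.sqrt X * cosh t)) * h t)).
Proof.
move=> X0 mh h1; have w0 : 0 < 2 * Num.sqrt X by rewrite mulr_gt0// sqrtr_gt0.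
apply: integrable_le (integrable_cosh_kernel w0) => //; first by mfun.
by move=> t _; rewrite normrM ger0_norm ?expR_ge0// ler_piMr ?expR_ge0.
Qed.

(** Against the even kernel, cos(nu t) may be absorbed into the phase of [bessel_mix], because the
    sine part thereby added is odd and integrates to 0. Translating t by ln (sqrt X) then makes the
    exponent X exp(- t) + exp t, linear in X, which is what a Laplace transform in X requires. *)
Lemma JK_repr nu X : 0 < X -> JK nu X = 2^-1 *
  \int[mu]_t (expR (- (X * expR (- t) + 1 * expR t)) * bessel_mix nu X (nu * (ln X - t))).
Proof.
move=> X0; have s0 : 0 < Num.sqrt X by rewrite sqrtr_gt0.
have lE : ln X = 2 * ln (Num.sqrt X).
  by rewrite -{1}(sqr_sqrtr (ltW X0)) lnXn// mulr_natl.
set a := nu * ln X / 2.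
have ic := ik nu X0 (h := fun t => cos (nu * t)) ltac:(mfun) (fun t => cos_max _).
have is_ := ik nu X0 (h := fun t => sin (nu * t)) ltac:(mfun) (fun t => sin_max _).
pose m t := expR (- (2 * Num.sqrt X * cosh t)) * bessel_mix nu X (a - nu * t).
pose b := bes_im nu X * sin a - bes_re nu X * cos a.
have mE t : m t = bessel_mix nu X a * (expR (- (2 * Num.sqrt X * cosh t)) * cos (nu * t)) +
    b * (expR (- (2 * Num.sqrt X * cosh t)) * sin (nu * t)).
  by rewrite /m /bessel_mix /b sinB cosB; ring.
have mi : mu.-integrable setT (EFin \o m).
  have -> : m = fun t => _ := funext mE.
  by apply: integrable_add => //; exact: integrable_scale.
have J1 : \int[mu]_t m t = bessel_mix nu X a * (2 * besK nu X).
  under eq_Rintegral do rewrite mE.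
  rewrite RintegralD//; try exact: integrable_scale.
  rewrite !RintegralZl// (Rintegral_odd is_) => [|t]; last by rewrite coshN mulrN sinN mulrN.
  by rewrite mulr0 addr0 /besK mulrA mulfV// mul1r.
rewrite /JK -/a; apply: (mulfI (_ : 2 != 0 :> R)) => //.
rewrite mulrCA -J1 mulrA mulfV// mul1r (Rintegral_shift (- ln (Num.sqrt X)) mi).
apply: eq_Rintegral => t _; rewrite /m; congr (expR (- _) * bessel_mix _ _ _); last first.
  by rewrite /a lE; field.
transitivity (Num.sqrt X ^+ 2 * expR (- t) + 1 * expR t); last by rewrite (sqr_sqrtr (ltW X0)).
rewrite /cosh opprB expRB expRD expRN lnK ?posrE//.
by field; rewrite (lt0r_neq0 s0) (lt0r_neq0 (expR_gt0 t)).
Qed.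

Definition mix_bound nu := 4 * rgam_bound nu * expR 2.

Lemma mix_bound_ge0 nu : 0 <= mix_bound nu.
Proof. by rewrite !mulr_ge0 ?expR_ge0 ?rgam_bound_ge0. Qed.

(** The bound of [bessel_mix_le] at 2 x for the choice q = 1 / sqrt(2 x). *)
Definition mix_sup nu x := 2 * rgam_bound nu * expR (2 * Num.sqrt (2 * x)).

Lemma mix_sup_ge0 nu x : 0 <= mix_sup nu x.
Proof. by rewrite !mulr_ge0 ?expR_ge0 ?rgam_bound_ge0. Qed.

Lemma mix_le_sup nu x t : 0 < x -> `|bessel_mix nu (2 * x) t| <= mix_sup nu x.
Proof.
move=> x0; have X0 : 0 < 2 * x by rewrite mulr_gt0.
have s0 : 0 < Num.sqrt (2 * x) by rewrite sqrtr_gt0.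
have q0 : 0 < (Num.sqrt (2 * x))^-1 by rewrite invr_gt0.
have := bessel_mix_le nu (2 * x) t q0; rewrite (gtr0_norm X0) invrK.
have -> // : (Num.sqrt (2 * x))^-1 * (2 * x) + Num.sqrt (2 * x) = 2 * Num.sqrt (2 * x).
by rewrite -{2}(sqr_sqrtr (ltW X0)); field; rewrite lt0r_neq0.
Qed.

(** With w = 2 sqrt(2 x), the growth exp w in [mix_sup] cancels the decay exp(- w) in [K0_bound].
    What remains is a multiple of 1 / sqrt w, and w >= sqrt x. *)
Lemma mix_sup_K0_le nu x : 0 < x ->
  mix_sup nu x * K0_bound (2 * Num.sqrt (2 * x)) <= mix_bound nu / Num.sqrt (Num.sqrt x).
Proof.
move=> x0; have s0 : 0 < Num.sqrt (2 * x) by rewrite sqrtr_gt0 mulr_gt0.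
have w0 : 0 < 2 * Num.sqrt (2 * x) by rewrite mulr_gt0.
rewrite /mix_sup; set w := 2 * Num.sqrt (2 * x) in w0 *; set r := rgam_bound nu.
have -> : 2 * r * expR w * K0_bound w = mix_bound nu / Num.sqrt w.
  by rewrite /K0_bound /mix_bound expRN -/r; field; rewrite expR_eq0 lt0r_neq0// sqrtr_gt0.
rewrite ler_wpM2l ?mix_bound_ge0// lef_pV2 ?posrE ?sqrtr_gt0//.
apply: ler_wsqrtr; rewrite /w; apply: (@le_trans _ _ (Num.sqrt (2 * x))).
  by apply: ler_wsqrtr; lra.
by have := ltW s0; lra.
Qed.

Lemma JK_le nu x : 0 < x -> `|JK nu (2 * x)| <= mix_bound nu / Num.sqrt (Num.sqrt x).
Proof.
move=> x0; have X0 : 0 < 2 * x by rewrite mulr_gt0.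
apply: le_trans (mix_sup_K0_le nu x0).
rewrite /JK normrM ler_pM//; first exact: mix_le_sup.
have w0 : 0 < 2 * Num.sqrt (2 * x) by rewrite mulr_gt0// sqrtr_gt0.
have := Rintegral_cosh_kernel_le w0 => h.
rewrite /besK normrM ger0_norm//.
suff h' : `|\int[mu]_t (expR (- (2 * Num.sqrt (2 * x) * cosh t)) * cos (nu * t))| <=
    \int[mu]_t expR (- (2 * Num.sqrt (2 * x) * cosh t)).
  by apply: le_trans (le_trans h' h); rewrite ler_piMl// invf_le1 ?ler1n.
apply: norm_Rintegral_le => //; first by mfun.
  by move=> t _; rewrite normrM ger0_norm ?expR_ge0// ler_piMr ?expR_ge0// cos_max.
exact: integrable_cosh_kernel.
Qed.

(** The common majorant in x: the bound x^(-1/4) for the product J K times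
    [K0_bound (a * Num.sqrt x)], as [K0_bound_dom] records. It is integrable at both ends of the
    half-line. *)
Definition dom nu (a : R) x := mix_bound nu * (2 * expR 2 / Num.sqrt a) * (expR (- (a * Num.sqrt x)) / Num.sqrt x).

Lemma integrable_dom nu (a : R) : 0 < a -> mu.-integrable `]0, +oo[ (EFin \o dom nu a).
Proof. by move=> a0; exact: (integrable_scale _ measurable_itv0y (integrable_expR_sqrt a0)). Qed.

Lemma K0_bound_dom nu (a : R) x : 0 < a -> 0 < x ->
  mix_bound nu / Num.sqrt (Num.sqrt x) * K0_bound (a * Num.sqrt x) = dom nu a x.
Proof.
move=> a0 x0; have s0 : 0 < Num.sqrt x by rewrite sqrtr_gt0.
rewrite /K0_bound /dom (sqrtrM _ (ltW a0)).
rewrite -{5}(sqr_sqrtr (ltW s0)); field.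
by rewrite !lt0r_neq0 ?sqrtr_gt0.
Qed.


(* The substitution [v = lapl_angle t] turns the exponent left by Weber's
   formula into [- s * sinh v]. *)
Definition lapl_angle (t : R) := ln (1 + 2 * expR t).
Definition lapl_angle' (t : R) := 2 * expR t / (1 + 2 * expR t).

Let den0 (t : R) : 0 < 1 + 2 * expR t.
Proof. by have := expR_gt0 t; lra. Qed.

Lemma sinh_lapl_angle t :
  sinh (lapl_angle t) = expR t + expR t / (1 + 2 * expR t).
Proof.
rewrite /sinh /lapl_angle expRN lnK ?posrE//; field.
by rewrite lt0r_neq0.
Qed.

Let der_lapl_angle (t : R) : der lapl_angle t (lapl_angle' t).
Proof.
have h : der (fun t => 1 + 2 * expR t) t (2 * expR t) by derive; ring.
exact: (@der_ln _ (fun t => 1 + 2 * expR t) t _ (den0 t) h).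
Qed.

Lemma expR_cvgNy : expR t @[t --> -oo] --> (0 : R).
Proof.
by apply/cvgNy_compNP; exact: cvgr_expR.
Qed.

Lemma sinh_ge_sqr (v : R) : 0 <= v -> v ^+ 2 / 4 <= sinh v.
Proof.
move=> v0; have := @expR_ge1Dxn _ v 1 v0; rewrite /sinh => h.
have : expR (- v) <= 1 by rewrite expR_le1 oppr_le0.
by move: h; have -> : 2`!%:R = 2 :> R by []; move=> ? ?; lra.
Qed.

(** s sinh v is at least s v^2 / 4, and (sqrt s v - 2)^2 >= 0 makes this at least sqrt s v - 1. *)
Lemma sinh_exp_le s (v : R) : 0 < s -> 0 <= v ->
  expR (- (s * sinh v)) <= expR 1 * expR (- (Num.sqrt s * v)).
Proof.
move=> s0 v0; rewrite -expRD ler_expR.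
have := ler_wpM2l (ltW s0) (sinh_ge_sqr v0).
have := sqr_ge0 (Num.sqrt s * v - 2); rewrite sqrrB exprMn (sqr_sqrtr (ltW s0)).
by lra.
Qed.

Lemma integrable_sinh_kernel s (h : R -> R) : 0 < s -> measurable_fun setT h ->
  (forall t, `|h t| <= 1) ->
  mu.-integrable `]0, +oo[ (EFin \o (fun v => expR (- (s * sinh v)) * h v)).
Proof.
move=> s0 mh h1; have q0 : 0 < Num.sqrt s by rewrite sqrtr_gt0.
apply: (integrable_le (g := fun v => expR 1 * expR (- (Num.sqrt s * v)))) => //.
- by apply: measurable_funTS; mfun.
- move=> v /=; rewrite in_itv/= andbT => v0.
  rewrite normrM ger0_norm ?expR_ge0//.
  apply: le_trans (sinh_exp_le s0 (ltW v0)).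
  by rewrite ler_piMr ?expR_ge0.
- exact: (integrable_scale _ measurable_itv0y (integrable_expR_0y q0)).
Qed.

Lemma JK_kernel_integrable nu x : 0 < x ->
  mu.-integrable setT (EFin \o (fun t =>
    expR (- (2 * x * expR (- t) + 1 * expR t)) * bessel_mix nu (2 * x) (nu * (ln (2 * x) - t)))).
Proof.
move=> x0; have X0 : 0 < 2 * x by rewrite mulr_gt0.
have [ei _] := two_sided_exp_bound X0 ltr01.
apply: (integrable_le _ _ _ (integrable_scale (mix_sup nu x) measurableT ei)) => //.
  by apply: mfunM; [mfun|apply: measurable_mix; mfun].
move=> t _; rewrite normrM ger0_norm ?expR_ge0// mulrC.
by rewrite ler_wpM2r ?expR_ge0// mix_le_sup.
Qed.

(** Completing the square gives exp(- 4 x / s) <= exp(s/4) exp(- 2 sqrt x); one factor exp(- sqrt x)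
    pays for x^(1/4), and the other is the one in [dom nu 1 x]. *)
Lemma laplace_dom nu s x : 0 < s -> 0 < x ->
  2^-1 * expR (- (4 * x / s)) * (mix_bound nu / Num.sqrt (Num.sqrt x)) <= expR (s / 4) * dom nu 1 x.
Proof.
move=> s0 x0; have r0 : 0 < Num.sqrt x by rewrite sqrtr_gt0.
rewrite -(K0_bound_dom nu ltr01 x0) mul1r [leLHS]mulrC [leRHS]mulrCA.
apply: ler_wpM2l; first by rewrite divr_ge0 ?mix_bound_ge0 ?sqrtr_ge0.
rewrite /K0_bound; set r := Num.sqrt x in r0 *.
have xE : x = r ^+ 2 by rewrite sqr_sqrtr// ltW.
have q0 : 0 < Num.sqrt r by rewrite sqrtr_gt0.
have h1 : expR (- (4 * x / s)) <= expR (s / 4) * expR (- (2 * r)).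
  rewrite -expRD ler_expR -subr_ge0.
  have -> : s / 4 + - (2 * r) - - (4 * x / s) = (2 * r - s / 2) ^+ 2 / s.
    by rewrite xE; field; rewrite lt0r_neq0.
  by rewrite divr_ge0 ?sqr_ge0// ltW.
have h2 : Num.sqrt r <= expR r.
  have := sqr_ge0 (Num.sqrt r - 1); rewrite sqrrB (sqr_sqrtr (ltW r0)).
  by have := expR_ge1Dx r; have := ltW r0; lra.
have h3 : expR (- (2 * r)) <= expR (- r) / Num.sqrt r.
  rewrite ler_pdivlMr// -[leRHS]mul1r; have -> : - r = - (2 * r) + r by lra.
  by rewrite expRD mul1r ler_wpM2l// expR_ge0.
have h4 : 1 <= expR 2 :> R by have := expR_ge1Dx (2 : R); lra.
apply: (@le_trans _ _ (expR (s / 4) * (expR (- r) / Num.sqrt r))).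
  apply: (@le_trans _ _ (expR (- (4 * x / s)))).
    by rewrite ler_piMl ?expR_ge0// invf_le1 ?ler1n.
  by apply: le_trans h1 _; rewrite ler_wpM2l// expR_ge0.
apply: ler_wpM2l; first exact: expR_ge0.
by apply: ler_peMl; [rewrite divr_ge0 ?expR_ge0// ltW|lra].
Qed.

(** After Fubini the x-integral at fixed t is an instance of [weber]; a translation of t and the
    substitution [lapl_angle] bring the remaining integral to the half-line. *)
Lemma laplace_JK nu s : 0 < s ->
  \int[mu]_(x in `]0, +oo[) (JK nu (2 * x) * expR (- (4 * x / s))) =
  - (s / 8) * \int[mu]_(v in `]0, +oo[) (expR (- (s * sinh v)) * sin (nu * v)).
Proof.
move=> s0.
pose F (p : R * R) := (2^-1 * expR (- (4 * p.1 / s))) *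
  (expR (- (2 * p.1 * expR (- p.2) + 1 * expR p.2)) * bessel_mix nu (2 * p.1) (nu * (ln (2 * p.1) - p.2))).
have mF : measurable_fun setT F.
  rewrite /F; apply: mfunM; first by mfun.
  by apply: mfunM; [mfun|apply: measurable_mix; mfun].
transitivity (\int[mu]_(x in `]0, +oo[) \int[mu]_t F (x, t)).
  apply: eq_Rintegral => x; rewrite mem_itv0y => x0.
  have X0 : 0 < 2 * x by rewrite mulr_gt0.
  rewrite (JK_repr nu X0) mulrAC -RintegralZl//.
  exact: JK_kernel_integrable.
rewrite (@Rintegral_fubini R `]0, +oo[ setT F (fun x => expR (s / 4) * dom nu 1 x))//; last 2 first.
- exact: (integrable_scale _ measurable_itv0y (integrable_dom nu ltr01)).
- move=> x /=; rewrite in_itv/= andbT => x0.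
  have X0 : 0 < 2 * x by rewrite mulr_gt0.
  have [ei eK] := two_sided_exp_bound X0 ltr01.
  rewrite sqrtr1 mulr1 in eK.
  have c0 : 0 <= 2^-1 * expR (- (4 * x / s)) by rewrite mulr_ge0 ?expR_ge0// invr_ge0.
  apply: le_trans (integral_norm_le (c := 2^-1 * expR (- (4 * x / s)) * mix_sup nu x) measurableT _ _ _ ei eK) _.
  + exact: (measurableT_comp mF (pair1_measurable x)).
  + by rewrite mulr_ge0// mix_sup_ge0.
  + move=> t _; rewrite /F/= normrM (ger0_norm c0) -[leRHS]mulrA.
    apply: ler_wpM2l => //; rewrite normrM (ger0_norm (expR_ge0 _)) mulrC.
    by apply: ler_wpM2r; [exact: expR_ge0|exact: mix_le_sup].
  + rewrite lee_fin -[leLHS]mulrA; apply: le_trans (laplace_dom nu s0 x0).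
    by apply: ler_wpM2l => //; exact: mix_sup_K0_le.
(* In the variable X = 2 x, the exponents 4 x / s and 2 x exp(- t) add up to p t times X. *)
pose p t := 2 / s + expR (- t).
have p0 t : 0 < p t by rewrite addr_gt0 ?expR_gt0// divr_gt0.
pose G t := expR (- expR t) * ((p t)^-1 * expR (- (p t)^-1) * sin (- (nu * t) - nu * ln (p t))).
have Gi : mu.-integrable setT (EFin \o G).
  apply: (@integrable_exp_weight 1 1) => //.
  - by rewrite ltr01 lexx.
  - by rewrite /G /p; mfun.
  - move=> t; rewrite mul1r mul1r /G normrM ger0_norm ?expR_ge0// mulrC ler_wpM2r ?expR_ge0//.
    rewrite normrM (le_trans (ler_piMr _ (sin_max _)))//.
    rewrite ger0_norm ?mulr_ge0 ?expR_ge0 ?invr_ge0 ?(ltW (p0 t))//.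
    rewrite (le_trans (ler_piMr _ _))// ?invr_ge0 ?(ltW (p0 t))//.
      by rewrite expR_le1 oppr_le0 invr_ge0 ltW.
    rewrite -[leRHS]invrK -expRN lef_pV2 ?posrE ?expR_gt0//.
    by rewrite lerDr divr_ge0// ltW.
(* One factor 1/2 comes from [JK_repr], the other from the change of variable X = 2 x. *)
transitivity (4^-1 * \int[mu]_t G t).
  rewrite -RintegralZl//.
  apply: eq_Rintegral => t _.
  have [wi wE] := weber nu (- (nu * t)) (p0 t).
  rewrite /G -wE (Rintegral_scale_0y (ltr0Sn R 1) wi).
  have wi2 := integrable_scale_0y (ltr0Sn R 1) wi.
  rewrite (_ : 4^-1 * _ = (2^-1 * expR (- expR t)) * \int[mu]_(x in `]0, +oo[)
     (expR (- (p t * (2 * x))) * bessel_mix nu (2 * x) (nu * ln (2 * x) - nu * t))); last by field.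
  rewrite -RintegralZl//; apply: eq_Rintegral => x _.
  rewrite /F/= mulrBr mul1r !mulrA; congr (_ * _).
  rewrite -!mulrA -!expRD; congr (_ * expR _); rewrite /p; field; exact: lt0r_neq0.
pose g v := expR (- (s * sinh v)) * sin (nu * v).
(* Translation by ln s makes 1/p equal to s exp t / (1 + 2 exp t). The total exponent becomes - s
   sinh (lapl_angle t) and the phase - nu (lapl_angle t), while the prefactor 1/p is s/2 times
   [lapl_angle' t]. *)
have GE t : G (t + ln s) = - (s / 2) * (g (lapl_angle t) * lapl_angle' t).
  have E0 := expR_gt0 t.
  have pE : p (t + ln s) = (1 + 2 * expR t) / (expR t * s).
    rewrite /p expRN expRD lnK ?posrE//; field.
    by rewrite !lt0r_neq0.
  have d0 : 0 < (1 + 2 * expR t) / (expR t * s) by rewrite divr_gt0// mulr_gt0.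
  have -> : g (lapl_angle t) = - (expR (- expR (t + ln s)) * (expR (- (p (t + ln s))^-1) *
      sin (- (nu * (t + ln s)) - nu * ln (p (t + ln s))))).
    rewrite /g mulrA -expRD -[RHS]mulrN -sinN; congr (expR _ * sin _).
      by rewrite sinh_lapl_angle pE expRD lnK ?posrE//; field; rewrite !lt0r_neq0.
    rewrite pE /lapl_angle ln_div ?posrE ?mulr_gt0// lnM ?posrE// expRK; ring.
  rewrite /G /lapl_angle' {1}pE.
  move: (expR (- expR _)) (expR (- (p _)^-1)) (sin _) (E0) (den0 t) => b c d.
  by move: (expR t) => a a0 a1; field; rewrite !lt0r_neq0.
rewrite (Rintegral_shift (ln s) Gi).
have Gsi := integrable_shift (ln s) Gi.
have gi : mu.-integrable setT (EFin \o (fun t => g (lapl_angle t) * lapl_angle' t)).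
  have := integrable_scale (- (s / 2))^-1 measurableT Gsi.
  apply: eq_integrable => // t _ /=; rewrite GE mulrA mulVf ?mul1r//.
  by rewrite oppr_eq0 lt0r_neq0// divr_gt0.
under eq_Rintegral do rewrite GE.
rewrite RintegralZl// (@Rintegral_subst_T0y R lapl_angle lapl_angle' g)//.
- by rewrite mulrA; congr (_ * _); field.
- move=> t; apply: der_continuous; apply: derM.
    by apply: derM; [exact: der_cst|apply: der_expR; exact: der_id].
  apply: derV; first exact: lt0r_neq0.
  by apply: derD; [exact: der_cst|apply: derM; [exact: der_cst|apply: der_expR; exact: der_id]].
- by move=> t; rewrite /lapl_angle ln_gt0// ltrDl mulr_gt0// expR_gt0.
- have h : (1 + 2 * expR t) @[t --> -oo] --> (1 + 2 * 0 : R).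
    by apply: cvgD; [exact: cvg_cst|apply: cvgM; [exact: cvg_cst|exact: expR_cvgNy]].
  rewrite mulr0 addr0 in h; rewrite /lapl_angle -ln1.
  exact: (cvg_comp _ _ h (continuous_ln ltr01)).
- apply/cvgryPge => A; near=> t.
  apply: (@le_trans _ _ t); first by near: t; apply: nbhs_pinfty_ge; exact: num_real.
  rewrite -[leLHS]expRK /lapl_angle ler_ln ?posrE ?expR_gt0//.
  by have := expR_gt0 t; lra.
- by move=> v; apply: der_continuous; rewrite /g; derive.
- by apply: integrable_sinh_kernel => //; [mfun|move=> t; exact: sin_max].
Unshelve. all: by end_near. Qed.


Lemma integrable_cos_exp (c y : R) : 0 < c ->
  mu.-integrable setT (EFin \o (fun t => expR t * expR (- (c * expR t)) * cos (y * expR t))).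
Proof.
move=> c0; apply: (@integrable_exp_weight 1 c) => //; [by rewrite ltr01 lexx|by mfun|].
move=> t; rewrite mul1r normrM ger0_norm ?mulr_ge0 ?expR_ge0//.
by rewrite ler_piMr ?mulr_ge0 ?expR_ge0// cos_max.
Qed.

(** The bound does not depend on the damping [e], so it serves both for integrability and for the
    limit e -> 0. It rests on exp v <= 2 (1 + sinh v). *)
Lemma ratio_le (e y v : R) : 0 <= e -> 1 <= y -> 0 <= v ->
  0 <= (e + sinh v) / ((e + sinh v) ^+ 2 + y ^+ 2) <= 4 * expR (- v).
Proof.
move=> e0 y1 v0.
have sv : expR v <= 2 * (1 + sinh v).
  have : expR (- v) <= 1 by rewrite expR_le1 oppr_le0.
  by rewrite /sinh; have := expR_gt0 v; lra.
have s0 : 0 <= sinh v by apply: le_trans (sinh_ge_sqr v0); rewrite divr_ge0// sqr_ge0.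
set c := e + sinh v; have c0 : 0 <= c by rewrite addr_ge0.
have d0 : 0 < c ^+ 2 + y ^+ 2 by nra.
apply/andP; split; first by rewrite divr_ge0// ltW.
rewrite ler_pdivrMr// expRN mulrAC ler_pdivlMr ?expR_gt0//.
apply: (@le_trans _ _ (c * (2 * (1 + c)))).
  by apply: ler_wpM2l => //; rewrite /c; lra.
have y2 : 1 <= y ^+ 2 by rewrite exprn_ege1.
by have := sqr_ge0 (c - 1); lra.
Qed.

Lemma integrable_ratio nu (e y : R) : 0 <= e -> 1 <= y ->
  mu.-integrable `]0, +oo[ (EFin \o (fun v =>
     sin (nu * v) * ((e + sinh v) / ((e + sinh v) ^+ 2 + y ^+ 2)))).
Proof.
move=> e0 y1.
apply: (integrable_le _ _ _ (integrable_scale 4 measurable_itv0y (integrable_expR_0y ltr01))) => //.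
  by apply: measurable_funTS; mfun.
move=> v /=; rewrite in_itv/= andbT mul1r => v0.
have /andP[h1 h2] := ratio_le e0 y1 (ltW v0).
rewrite normrM [`|_ / _|]ger0_norm//; apply: le_trans h2.
by rewrite ler_piMl// sin_max.
Qed.

Lemma Rintegral_cos_exp (c y : R) : 0 < c ->
  \int[mu]_t (expR t * expR (- (c * expR t)) * cos (y * expR t)) = c / (c ^+ 2 + y ^+ 2).
Proof.
move=> c0; have d0 : 0 < c ^+ 2 + y ^+ 2 by rewrite ltr_wpDr ?sqr_ge0// exprn_gt0.
have d1 := lt0r_neq0 d0.
pose F (t : R) := expR (- (c * expR t)) * ((y * sin (y * expR t) - c * cos (y * expR t)) / (c ^+ 2 + y ^+ 2)).
pose f (t : R) := expR t * expR (- (c * expR t)) * cos (y * expR t).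
have E0 : expR (- (c * 0)) * ((y * sin (y * 0) - c * cos (y * 0)) / (c ^+ 2 + y ^+ 2)) =
    - (c / (c ^+ 2 + y ^+ 2)).
  by rewrite !mulr0 oppr0 expR0 sin0 cos0; lra.
rewrite (@FTC_T R F f (- (c / (c ^+ 2 + y ^+ 2))) 0).
- by rewrite sub0r opprK.
- by move=> t; derive; rewrite /f; field.
- by move=> t; apply: der_continuous; derive.
- have h : {for 0, continuous (fun e => expR (- (c * e)) *
      ((y * sin (y * e) - c * cos (y * e)) / (c ^+ 2 + y ^+ 2)))}.
    by apply: der_continuous; derive.
  by rewrite -E0; exact: (cvg_comp _ _ expR_cvgNy h).
- apply: norm_cvg0; apply: (@squeeze_cvgr _ _ _ _ (fun=> 0)
     (fun t => (`|y| + c) / (c ^+ 2 + y ^+ 2) * expR (- (c * t)))); last 2 first.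
  + exact: cvg_cst.
  + rewrite -[X in _ `=>` nbhs X](mulr0 ((`|y| + c) / (c ^+ 2 + y ^+ 2))).
    by apply: cvgM; [exact: cvg_cst|exact: cvgy_expRN].
  near=> t; rewrite normr_ge0/= /F normrM ger0_norm ?expR_ge0// mulrC.
  apply: ler_pM; rewrite ?expR_ge0//.
    rewrite normrM normfV (gtr0_norm d0) ler_wpM2r ?invr_ge0 ?(ltW d0)//.
    apply: le_trans (ler_normB _ _) _; rewrite !normrM (gtr0_norm c0).
    by apply: lerD; [rewrite ler_piMr// sin_max|rewrite ler_piMr ?cos_max// ltW].
  rewrite ler_expR lerN2 ler_wpM2l ?(ltW c0)//.
  by have := expR_ge1Dx t; lra.
- exact: integrable_cos_exp.
Unshelve. all: by end_near. Qed.

(* The damping [e] makes the integral absolutely convergent, uniformly enough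
   for Fubini; the limit [e -> 0] is taken after rotating the contour. *)
Definition K0_damped (e y x : R) :=
  2^-1 * \int[mu]_t (expR (- (4 * x * expR (- t) + e * expR t)) * cos (y * expR t)).

Let JKdom nu s x : 0 < s -> 0 < x ->
  `|JK nu (2 * x) * expR (- (4 * x / s))| <= 2 * expR (s / 4) * dom nu 1 x.
Proof.
move=> s0 x0; have h2 := laplace_dom nu s0 x0; have h1 := JK_le nu x0.
rewrite [`|_ * expR _|]normrM [`|expR _|]ger0_norm ?expR_ge0//.
have := ler_wpM2r (expR_ge0 (- (4 * x / s))) h1; lra.
Qed.

(** Fubini twice: the x-integral at fixed t is the Laplace transform of the product kernel, and
    after exchanging t with v the t-integral is the Laplace transform of a cosine in the variable
    exp t, at e + sinh v. *)
Lemma JK_K0_damped nu (e y : R) : 0 < e -> 1 <= y ->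
  \int[mu]_(x in `]0, +oo[) (JK nu (2 * x) * K0_damped e y x) =
  - 16^-1 * \int[mu]_(v in `]0, +oo[)
     (sin (nu * v) * ((e + sinh v) / ((e + sinh v) ^+ 2 + y ^+ 2))).
Proof.
move=> e0 y1; have se0 : 0 < Num.sqrt e by rewrite sqrtr_gt0.
have mJK : measurable_fun setT (fun p : R * R => JK nu (2 * p.1)).
  by apply: (measurableT_comp (measurable_JK nu)); mfun.
pose F (p : R * R) := (JK nu (2 * p.1) * 2^-1) *
  (expR (- (4 * p.1 * expR (- p.2) + e * expR p.2)) * cos (y * expR p.2)).
have mF : measurable_fun setT F by rewrite /F; mfun.
have sE x : 0 < x -> 2 * (Num.sqrt (4 * x) * Num.sqrt e) = 4 * Num.sqrt e * Num.sqrt x.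
  move=> x0; rewrite sqrtrM//; have -> : 4 = 2 ^+ 2 :> R by rewrite expr2 -natrM.
  by rewrite sqrtr_sqr ger0_norm//; ring.
transitivity (\int[mu]_(x in `]0, +oo[) \int[mu]_t F (x, t)).
  apply: eq_Rintegral => x; rewrite mem_itv0y => x0.
  have X0 : 0 < 4 * x by rewrite mulr_gt0.
  have [ei _] := two_sided_exp_bound X0 e0.
  rewrite /K0_damped mulrA -RintegralZl//.
  apply: (integrable_le _ _ _ ei) => //; first by mfun.
  by move=> t _; rewrite normrM ger0_norm ?expR_ge0// ler_piMr ?expR_ge0// cos_max.
rewrite (@Rintegral_fubini R `]0, +oo[ setT F (dom nu (4 * Num.sqrt e)))//; last 2 first.
- by apply: integrable_dom; rewrite mulr_gt0.
- move=> x /=; rewrite in_itv/= andbT => x0.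
  have X0 : 0 < 4 * x by rewrite mulr_gt0.
  have [ei eK] := two_sided_exp_bound X0 e0.
  rewrite sE// in eK.
  have w0 : 0 < 4 * Num.sqrt e by rewrite mulr_gt0.
  apply: le_trans (integral_norm_le (c := `|JK nu (2 * x) * 2^-1|) measurableT _ _ _ ei eK) _ => //.
  + exact: (measurableT_comp mF (pair1_measurable x)).
  + move=> t _; rewrite /F/= normrM; apply: ler_wpM2l => //.
    by rewrite normrM ger0_norm ?expR_ge0// ler_piMr ?expR_ge0// cos_max.
  + rewrite lee_fin -K0_bound_dom//; apply: ler_wpM2r.
      by rewrite /K0_bound !mulr_ge0 ?expR_ge0 ?invr_ge0 ?sqrtr_ge0.
    apply: le_trans (JK_le nu x0); rewrite normrM (ger0_norm (_ : 0 <= 2^-1)) ?invr_ge0//.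
    by rewrite ler_piMr// invf_le1 ?ler1n.
pose H (p : R * R) := (- 16^-1 * (expR p.1 * expR (- (e * expR p.1)) * cos (y * expR p.1))) *
  (expR (- (expR p.1 * sinh p.2)) * sin (nu * p.2)).
have mH : measurable_fun setT H by rewrite /H; mfun.
transitivity (\int[mu]_t \int[mu]_(v in `]0, +oo[) H (t, v)).
  apply: eq_Rintegral => t _; have E0 := expR_gt0 t.
  have h0 := @integrable_sinh_kernel _ (fun v => sin (nu * v)) E0 ltac:(mfun) (fun v => sin_max _).
  have -> : \int[mu]_(v in `]0, +oo[) H (t, v) =
    - 16^-1 * (expR t * expR (- (e * expR t)) * cos (y * expR t)) *
      \int[mu]_(x in `]0, +oo[) (expR (- (expR t * sinh x)) * sin (nu * x)).
    by rewrite -RintegralZl.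
  (* Regrouped so that [laplace_JK] applies at s = exp t, where 4 x exp(- t) = 4 x / s; the constant
     - 1/16 is 1/2 times - 1/8. *)
  rewrite (_ : - 16^-1 * (expR t * expR (- (e * expR t)) * cos (y * expR t)) *
      \int[mu]_(x in `]0, +oo[) (expR (- (expR t * sinh x)) * sin (nu * x)) =
    2^-1 * expR (- (e * expR t)) * cos (y * expR t) * (- (expR t / 8) *
     \int[mu]_(x in `]0, +oo[) (expR (- (expR t * sinh x)) * sin (nu * x)))); last by field.
  rewrite -laplace_JK// -RintegralZl//; last first.
    apply: (integrable_le _ _ _ (integrable_scale (2 * expR (expR t / 4)) measurable_itv0y (integrable_dom nu ltr01))) => //.
      apply: measurable_funTS; apply: mfunM; last by mfun.
      by apply: (measurableT_comp (measurable_JK nu)); mfun.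
    by move=> x /=; rewrite in_itv/= andbT; exact: JKdom.
  apply: eq_Rintegral => x _; rewrite /F/= opprD expRD expRN -expRN; ring.
(* The v-integral is of order exp(- t/2) by [sinh_exp_le], which reduces the factor exp t to
   exp(t/2); the damping makes this integrable at +oo. *)
rewrite (@Rintegral_fubini R setT `]0, +oo[ H (fun t => expR 1 * (expR (2^-1 * t) * expR (- (e * expR t)))))//; last 2 first.
- apply: (integrable_scale _ measurableT).
  apply: (@integrable_exp_weight 2^-1 e) => //; [|by mfun|].
    by rewrite invr_gt0 ltr0n/= invf_le1 ?ler1n.
  by move=> t; rewrite ger0_norm// mulr_ge0 ?expR_ge0.
- move=> t _; have E0 := expR_gt0 t.
  have q0 : 0 < Num.sqrt (expR t) by rewrite sqrtr_gt0.
  have gi := integrable_scale (expR 1) measurable_itv0y (integrable_expR_0y q0).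
  have gE : \int[mu]_(v in `]0, +oo[) (expR 1 * expR (- (Num.sqrt (expR t) * v))) <=
     expR 1 * (Num.sqrt (expR t))^-1.
    by rewrite RintegralZl ?Rintegral_expR_0y//; exact: integrable_expR_0y.
  have c0 : 0 <= 16^-1 * (expR t * expR (- (e * expR t))) by rewrite !mulr_ge0 ?expR_ge0.
  apply: le_trans (integral_norm_le (c := 16^-1 * (expR t * expR (- (e * expR t)))) measurable_itv0y _ c0 _ gi gE) _.
  + by apply: measurable_funTS; exact: (measurableT_comp mH (pair1_measurable t)).
  + move=> v /=; rewrite in_itv/= andbT => v0.
    rewrite /H/= normrM; apply: ler_pM => //.
      rewrite normrM normrN; have -> : `|16^-1| = 16^-1 :> R by rewrite ger0_norm.
      apply: ler_wpM2l; first by rewrite invr_ge0.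
      by rewrite normrM ger0_norm ?mulr_ge0 ?expR_ge0// ler_piMr ?mulr_ge0 ?expR_ge0// cos_max.
    rewrite normrM ger0_norm ?expR_ge0//; apply: le_trans (sinh_exp_le E0 (ltW v0)).
    by rewrite ler_piMr ?expR_ge0// sin_max.
  + rewrite lee_fin.
    have sqE : Num.sqrt (expR t) = expR (2^-1 * t).
      apply/eqP; rewrite -(eqrXn2 (ltn0Sn 1)) ?sqrtr_ge0 ?expR_ge0// sqr_sqrtr ?expR_ge0//.
      by rewrite -expRM_natl mulrA mulfV// mul1r.
    rewrite sqE; set W := expR (- (e * expR t)).
    have -> : expR t = expR (2^-1 * t) * expR (2^-1 * t) by rewrite -expRD; congr expR; lra.
    have -> : 16^-1 * (expR (2^-1 * t) * expR (2^-1 * t) * W) * (expR 1 / expR (2^-1 * t)) =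
       16^-1 * (expR 1 * (expR (2^-1 * t) * W)) by field; rewrite expR_eq0.
    by rewrite ler_piMl ?mulr_ge0 ?expR_ge0// invf_le1 ?ler1n.
rewrite -RintegralZl//; last exact: integrable_ratio (ltW e0) y1.
apply: eq_Rintegral => v; rewrite mem_itv0y => v0.
have c0 : 0 < e + sinh v by rewrite addr_gt0// sinh_gt0.
rewrite -Rintegral_cos_exp// mulrA -RintegralZl//; last exact: integrable_cos_exp.
apply: eq_Rintegral => t _; rewrite /H/=.
have -> : - ((e + sinh v) * expR t) = - (e * expR t) + - (expR t * sinh v) by ring.
rewrite expRD; ring.
Qed.

End kernel.

(** * Rotating the contour *)

Section rotation.
Context {R : realType}.
Notation mu := (@lebesgue_measure R).
Implicit Types nu x y e v b : R.

Definition c4 : R := cos (pi / 4).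

Lemma sin_pi4 : sin (pi / 4) = c4.
Proof.
have s1 : sin (pi / 2 - pi / 4 : R) = cos (pi / 4) by rewrite sinB sin_pihalf cos_pihalf; ring.
by rewrite /c4 -s1; congr sin; lra.
Qed.

Lemma c4_gt0 : 0 < c4.
Proof. by have := @pi_gt0 R => h; apply: cos_gt0_pihalf; apply/andP; split; lra. Qed.

Lemma c4_le_cos b : 0 <= b <= pi / 4 -> c4 <= cos b.
Proof.
move=> /andP[b0 b1]; rewrite /c4.
have := @pi_gt0 R => pi0.
move: b1; rewrite le_eqVlt => /orP[/eqP ->//|b1].
by rewrite ltW// ltr_cos// in_itv/=; apply/andP; split; lra.
Qed.

Lemma sin_quarter_ge0 b : 0 <= b <= pi / 4 -> 0 <= sin b.
Proof.
move=> /andP[b0 b1]; have := @pi_gt0 R => pi0.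
by apply: sin_ge0_pi; apply/andP; split; lra.
Qed.

Section contour.
Variables (x y e : R).
Hypotheses (x0 : 0 < x) (y0 : 0 < y) (e0 : 0 < e).

(* [P + i Q] is [exp (- 4 x e^(-z) - (e - i y) e^z)] at [z = v + i b]. *)
Let A v b := 4 * x * (expR (- v) * cos b) + expR v * (e * cos b + y * sin b).
Let B v b := 4 * x * (expR (- v) * sin b) + expR v * (y * cos b - e * sin b).
Let P v b := expR (- A v b) * cos (B v b).
Let Q v b := expR (- A v b) * sin (B v b).
Let Ab v b := - (4 * x * (expR (- v) * sin b)) + expR v * (y * cos b - e * sin b).
Let Bb v b := 4 * x * (expR (- v) * cos b) - expR v * (y * sin b + e * cos b).
Let d v b := expR (- A v b) * (- (Ab v b) * cos (B v b) - Bb v b * sin (B v b)).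
(** A lower bound for the exponent [A v b], uniform over 0 <= b <= pi/4: cos b is replaced by its
    least value [c4] and the nonnegative term in sin b is dropped. *)
Let low v := c4 * (4 * x) * expR (- v) + c4 * e * expR v.
(** Chosen so that [k1 * low v] exceeds the sum of the bounds for [Ab] and [Bb]: its first term
    handles exp(- v), its second exp v. *)
Let k1 := 2 / c4 + 2 * (e + y) / (e * c4).

Let A_ge v b : 0 <= b <= pi / 4 -> low v <= A v b.
Proof.
move=> bI; have cb := c4_le_cos bI; have sb := sin_quarter_ge0 bI.
have p1 : 0 < 4 * x * expR (- v) by rewrite !mulr_gt0// expR_gt0.
have p2 : 0 < e * expR v by rewrite mulr_gt0// expR_gt0.
have p3 : 0 < y * expR v by rewrite mulr_gt0// expR_gt0.
rewrite /A /low; have h1 := ler_wpM2l (ltW p1) cb; have h2 := ler_wpM2l (ltW p2) cb.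
have h3 := mulr_ge0 (ltW p3) sb; lra.
Qed.

Let expA_le v b : 0 <= b <= pi / 4 -> expR (- A v b) <= expR (- low v).
Proof. by move=> bI; rewrite ler_expR lerN2 A_ge. Qed.

Let low_int (c : R) : 0 < c -> mu.-integrable setT (EFin \o (fun v => expR (- (c * low v)))).
Proof.
move=> c0.
have a0 : 0 < c * (c4 * (4 * x)) by rewrite !mulr_gt0// c4_gt0.
have b0 : 0 < c * (c4 * e) by rewrite !mulr_gt0// c4_gt0.
have [h _] := two_sided_exp_bound a0 b0.
apply: eq_integrable h => // v _; rewrite /low /=; congr (expR (- _))%:E; ring.
Qed.

(** The derivative carries a factor linear in [low v]; half of the decay exp(- low v) absorbs it,
    since y <= 2 exp(y/2). *)
Let d_le v b : 0 <= b <= pi / 4 -> `|d v b| <= 2 * k1 * expR (- (2^-1 * low v)).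
Proof.
move=> bI; have c0 := c4_gt0; have E0 := expR_gt0 v; have F0 := expR_gt0 (- v).
pose a := c4 * (4 * x) * expR (- v); pose w := c4 * e * expR v.
have a0 : 0 < a by rewrite !mulr_gt0.
have w0 : 0 < w by rewrite !mulr_gt0.
have lowE : low v = a + w by [].
have cos1 (t : R) : -1 <= cos t <= 1 by rewrite -ler_norml cos_max.
have sin1 (t : R) : -1 <= sin t <= 1 by rewrite -ler_norml sin_max.
have kE : k1 * low v = 8 * x * expR (- v) + 2 * (e + y) * expR v +
    (2 / c4 * w + 2 * (e + y) / (e * c4) * a).
  by rewrite lowE /k1 /a /w; field; rewrite !lt0r_neq0.
have k0 : 0 <= 2 / c4 * w + 2 * (e + y) / (e * c4) * a.
  by rewrite addr_ge0// !mulr_ge0// ?invr_ge0 ?addr_ge0 ?mulr_ge0// ltW.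
have h (p q s t : R) : 0 <= p -> -1 <= s <= 1 -> -1 <= t <= 1 -> `|p * s * t| <= p.
  move=> p0 hs ht; rewrite !normrM ger0_norm// -mulrA ler_piMr//.
  by rewrite mulr_ile1// ler_norml.
have dk : `|- (Ab v b) * cos (B v b) - Bb v b * sin (B v b)| <= k1 * low v.
  apply: (@le_trans _ _ (`|Ab v b| + `|Bb v b|)).
    apply: le_trans (ler_normB _ _) _; rewrite !normrM normrN.
    by apply: lerD; rewrite ler_piMr// ?cos_max ?sin_max.
  have hA : `|Ab v b| <= 4 * x * expR (- v) + (y + e) * expR v.
    rewrite ler_norml /Ab; have /andP[s1 s2] := sin1 b; have /andP[s3 s4] := cos1 b.
    have p1 : 0 < 4 * x * expR (- v) by rewrite !mulr_gt0.
    have p2 : 0 < e * expR v by rewrite mulr_gt0.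
    have p3 : 0 < y * expR v by rewrite mulr_gt0.
    by apply/andP; split; nra.
  have hB : `|Bb v b| <= 4 * x * expR (- v) + (y + e) * expR v.
    rewrite ler_norml /Bb; have /andP[s1 s2] := sin1 b; have /andP[s3 s4] := cos1 b.
    have p1 : 0 < 4 * x * expR (- v) by rewrite !mulr_gt0.
    have p2 : 0 < e * expR v by rewrite mulr_gt0.
    have p3 : 0 < y * expR v by rewrite mulr_gt0.
    by apply/andP; split; nra.
  by rewrite kE; lra.
have l2 : low v <= 2 * expR (2^-1 * low v).
  by have := expR_ge1Dx (2^-1 * low v); lra.
have k10 : 0 <= k1 by rewrite addr_ge0// !mulr_ge0// ?invr_ge0 ?addr_ge0 ?mulr_ge0// ltW.
rewrite /d normrM ger0_norm ?expR_ge0//.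
apply: (@le_trans _ _ (expR (- low v) * (k1 * low v))).
  by apply: ler_pM; rewrite ?expR_ge0//; exact: expA_le.
have -> : expR (- (2^-1 * low v)) = expR (- low v) * expR (2^-1 * low v).
  by rewrite -expRD; congr expR; lra.
rewrite [leRHS]mulrCA; apply: ler_wpM2l; first exact: expR_ge0.
by have := ler_wpM2l k10 l2; lra.
Qed.

Let low_y : expR (- low v) @[v --> +oo] --> 0.
Proof.
have q0 : 0 < c4 * e by rewrite mulr_gt0// c4_gt0.
apply: norm_cvg0; apply: (@squeeze_cvgr _ _ _ _ (fun=> 0) (fun v => expR (- (c4 * e * v)))).
- near=> v; rewrite normr_ge0/= ger0_norm ?expR_ge0// ler_expR lerN2 /low.
  have h := ler_wpM2l (ltW q0) (expR_ge1Dx v).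
  have h2 : 0 < c4 * (4 * x) * expR (- v) by rewrite !mulr_gt0 ?c4_gt0 ?expR_gt0.
  lra.
- exact: cvg_cst.
- exact: cvgy_expRN.
Unshelve. all: by end_near. Qed.

Let low_Ny : expR (- low v) @[v --> -oo] --> 0.
Proof.
apply/cvgNy_compNP.
have q0 : 0 < c4 * (4 * x) by rewrite !mulr_gt0// c4_gt0.
apply: norm_cvg0; apply: (@squeeze_cvgr _ _ _ _ (fun=> 0) (fun v => expR (- (c4 * (4 * x) * v)))).
- near=> v; rewrite normr_ge0/= ger0_norm ?expR_ge0// ler_expR lerN2 /low opprK.
  have h := ler_wpM2l (ltW q0) (expR_ge1Dx v).
  have h2 : 0 < c4 * e * expR (- v) by rewrite !mulr_gt0 ?c4_gt0 ?expR_gt0.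
  lra.
- exact: cvg_cst.
- exact: cvgy_expRN.
Unshelve. all: by end_near. Qed.

Let Q_le v b : 0 <= b <= pi / 4 -> `|Q v b| <= expR (- low v).
Proof.
move=> bI; rewrite /Q normrM ger0_norm ?expR_ge0//.
by apply: le_trans (expA_le v bI); rewrite ler_piMr ?expR_ge0// sin_max.
Qed.

Let P_int b : 0 <= b <= pi / 4 -> mu.-integrable setT (EFin \o P ^~ b).
Proof.
move=> bI; have := low_int ltr01; under eq_fun do rewrite mul1r.
move=> h; apply: (integrable_le _ _ _ h) => //.
  by rewrite /P /A /B; mfun.
move=> v _; rewrite /P normrM ger0_norm ?expR_ge0//.
by apply: le_trans (expA_le v bI); rewrite ler_piMr ?expR_ge0// cos_max.
Qed.

(** On the line of imaginary part pi/4 the oscillating factor exp(i y exp z) has modulus exp(- c4 y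
    exp v), a decay that is still present at e = 0. *)
Lemma rotated_integral :
  \int[mu]_v (expR (- (4 * x * expR (- v) + e * expR v)) * cos (y * expR v)) =
  \int[mu]_v (expR (- (c4 * (4 * x * expR (- v) + (y + e) * expR v))) *
              cos (c4 * (4 * x * expR (- v) + (y - e) * expR v))).
Proof.
have pi0 := @pi_gt0 R.
have I0 : 0 <= (0 : R) <= pi / 4 by rewrite lexx/=; lra.
have I1 : 0 <= (pi / 4 : R) <= pi / 4 by rewrite lexx andbT; lra.
transitivity (\int[mu]_v P v 0).
  apply: eq_Rintegral => v _; rewrite /P /A /B cos0 sin0 !mulr0 !mulr1 subr0 addr0.
  by congr (expR (- _) * cos _); ring.
transitivity (\int[mu]_v P v (pi / 4)); last first.
  apply: eq_Rintegral => v _; rewrite /P /A /B sin_pi4 -/c4.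
  by congr (expR (- _) * cos _); ring.
apply: (@Rintegral_CR_const _ P Q d 0 (pi / 4) (fun v => 2 * k1 * expR (- (2^-1 * low v)))).
- lra.
- by move=> v b _; rewrite /P /A /B; derive; rewrite /d /A /B /Ab /Bb; ring.
- by move=> v b _; rewrite /Q /A /B; derive; rewrite /d /A /B /Ab /Bb; ring.
- by move=> v b _; apply: der_continuous; rewrite /d /A /B /Ab /Bb; derive.
- by move=> b _ v; apply: der_continuous; rewrite /d /A /B /Ab /Bb; derive.
- by rewrite /d /A /B /Ab /Bb; mfun.
- by move=> v b bI; exact: d_le.
- by apply: (integrable_scale _ measurableT); apply: low_int.
- move=> b bI; apply: norm_cvg0; apply: (@squeeze_cvgr _ _ _ _ (fun=> 0) (fun v => expR (- low v))).
  + by apply: nearW => v; rewrite normr_ge0/= Q_le.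
  + exact: cvg_cst.
  + exact: low_Ny.
- move=> b bI; apply: norm_cvg0; apply: (@squeeze_cvgr _ _ _ _ (fun=> 0) (fun v => expR (- low v))).
  + by apply: nearW => v; rewrite normr_ge0/= Q_le.
  + exact: cvg_cst.
  + exact: low_y.
- exact: P_int.
- exact: P_int.
Qed.

End contour.

(** The right-hand side of [rotated_integral] at e = 0, halved. At y = cosh u it is [ReK0 x u], by
    [ReK0E]. *)
Definition K0r y x := 2^-1 * \int[mu]_v (expR (- (c4 * (4 * x * expR (- v) + y * expR v))) *
              cos (c4 * (4 * x * expR (- v) + y * expR v))).

Lemma rot_dom y x : 0 < y -> 0 < x ->
  mu.-integrable setT (EFin \o (fun v => expR (- (c4 * (4 * x * expR (- v) + y * expR v))))) /\
  \int[mu]_v expR (- (c4 * (4 * x * expR (- v) + y * expR v))) <=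
    K0_bound (4 * c4 * Num.sqrt y * Num.sqrt x).
Proof.
move=> y0 x0; have c0 := c4_gt0.
have a0 : 0 < c4 * (4 * x) by rewrite !mulr_gt0.
have b0 : 0 < c4 * y by rewrite mulr_gt0.
have := two_sided_exp_bound a0 b0.
have -> : 2 * (Num.sqrt (c4 * (4 * x)) * Num.sqrt (c4 * y)) = 4 * c4 * Num.sqrt y * Num.sqrt x.
  rewrite !sqrtrM ?(ltW c0)//; have -> : 4 = 2 ^+ 2 :> R by rewrite expr2 -natrM.
  rewrite sqrtr_sqr ger0_norm// -{3}(sqr_sqrtr (ltW c0)); ring.
have E v : - (c4 * (4 * x) * expR (- v) + c4 * y * expR v) =
  - (c4 * (4 * x * expR (- v) + y * expR v)) by ring.
by under eq_fun do rewrite E.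
Qed.

(** On the rotated line the decay rate is y + e >= y, so the bound is uniform in the damping and
    dominates the passage to the limit. *)
Lemma K0_damped_le e y x : 0 < e -> 0 < y -> 0 < x ->
  `|K0_damped e y x| <= K0_bound (4 * c4 * Num.sqrt y * Num.sqrt x).
Proof.
move=> e0 y0 x0; rewrite /K0_damped rotated_integral//.
have [ei eK] := rot_dom y0 x0; rewrite normrM ger0_norm//.
apply: (@le_trans _ _ (\int[mu]_v expR (- (c4 * (4 * x * expR (- v) + y * expR v))))) => //.
rewrite (le_trans (ler_piMl _ _))//; first by rewrite invf_le1 ?ler1n.
apply: norm_Rintegral_le => //; first by mfun.
move=> v _; rewrite normrM ger0_norm ?expR_ge0//.
rewrite (le_trans (ler_piMr _ (cos_max _))) ?expR_ge0// ler_expR lerN2.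
rewrite ler_wpM2l ?(ltW c4_gt0)// lerD2l ler_wpM2r ?expR_ge0// lerDl ltW//.
Qed.

Lemma K0_damped_cvg y x : 0 < y -> 0 < x -> K0_damped k.+1%:R^-1 y x @[k --> \oo] --> K0r y x.
Proof.
move=> y0 x0; apply: cvgM; first exact: cvg_cst.
rewrite (_ : (fun k : nat => _) = fun k : nat =>
  \int[mu]_v (expR (- (c4 * (4 * x * expR (- v) + (y + k.+1%:R^-1) * expR v))) *
              cos (c4 * (4 * x * expR (- v) + (y - k.+1%:R^-1) * expR v)))); last first.
  by apply/funext => k; rewrite rotated_integral// invr_gt0.
have [ei _] := rot_dom y0 x0.
have h0 : (k.+1%:R^-1 : R) @[k --> \oo] --> 0 by exact: cvg_harmonic.
have [||||//] := @Rintegral_dominated_cvg R setT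
  (fun (k : nat) v => expR (- (c4 * (4 * x * expR (- v) + (y + k.+1%:R^-1) * expR v))) *
              cos (c4 * (4 * x * expR (- v) + (y - k.+1%:R^-1) * expR v)))
  (fun v => expR (- (c4 * (4 * x * expR (- v) + y * expR v))) *
              cos (c4 * (4 * x * expR (- v) + y * expR v)))
  (fun v => expR (- (c4 * (4 * x * expR (- v) + y * expR v)))) measurableT.
- by move=> k; mfun.
- move=> v _.
  have h : {for 0, continuous (fun e => expR (- (c4 * (4 * x * expR (- v) + (y + e) * expR v))) *
              cos (c4 * (4 * x * expR (- v) + (y - e) * expR v)))}.
    by apply: der_continuous; derive.
  have := cvg_comp _ _ h0 h; rewrite addr0 subr0; exact.
- move=> k v _; rewrite normrM ger0_norm ?expR_ge0//.
  rewrite (le_trans (ler_piMr _ (cos_max _))) ?expR_ge0// ler_expR lerN2.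
  by rewrite ler_wpM2l ?(ltW c4_gt0)// lerD2l ler_wpM2r ?expR_ge0// lerDl invr_ge0.
- exact: ei.
Qed.

Lemma K0r_le y x : 0 < y -> 0 < x -> `|K0r y x| <= K0_bound (4 * c4 * Num.sqrt y * Num.sqrt x).
Proof.
move=> y0 x0; have h : `|K0_damped k.+1%:R^-1 y x| @[k --> \oo] --> `|K0r y x|.
  by apply: cvg_norm; exact: K0_damped_cvg.
rewrite -(cvg_lim _ h)//; apply: limr_le; first by apply/cvg_ex; eexists; exact: h.
by apply: nearW => k; apply: K0_damped_le => //; rewrite invr_gt0.
Qed.

Lemma measurable_K0r : measurable_fun setT (fun p : R * R => K0r p.1 p.2).
Proof.
apply: mfunM; first exact: mfun_cst.
have := @measurable_Rintegral R _ (R * R)%type (fun p => expR (- (c4 * (4 * p.1.2 * expR (- p.2) + p.1.1 * expR p.2))) *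
              cos (c4 * (4 * p.1.2 * expR (- p.2) + p.1.1 * expR p.2))).
apply.
have m1 : measurable_fun setT (fun p : R * R * R => p.1.1).
  by apply: (measurableT_comp measurable_fst); exact: measurable_fst.
have m2 : measurable_fun setT (fun p : R * R * R => p.1.2).
  by apply: (measurableT_comp measurable_snd); exact: measurable_fst.
have m3 : measurable_fun setT (fun p : R * R * R => p.2) by exact: measurable_snd.
by mfun.
Qed.

Lemma measurable_K0_damped e y : measurable_fun setT (K0_damped e y).
Proof.
apply: mfunM; first exact: mfun_cst.
have := @measurable_Rintegral R _ R (fun p => expR (- (4 * p.1 * expR (- p.2) + e * expR p.2)) * cos (y * expR p.2)).
by apply; mfun.
Qed.

Lemma JK_K0r_le nu y x : 1 <= y -> 0 < x ->
  `|JK nu (2 * x)| * K0_bound (4 * c4 * Num.sqrt y * Num.sqrt x) <= dom nu (4 * c4 * Num.sqrt y) x.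
Proof.
move=> y1 x0; have y0 : 0 < y by apply: lt_le_trans y1.
have a0 : 0 < 4 * c4 * Num.sqrt y by rewrite !mulr_gt0 ?c4_gt0// sqrtr_gt0.
rewrite -K0_bound_dom//; apply: ler_wpM2r; last exact: JK_le.
by rewrite /K0_bound !mulr_ge0 ?expR_ge0 ?invr_ge0 ?sqrtr_ge0.
Qed.

(** The limit of [JK_K0_damped] along e = 1/(k+1). The left side is dominated by [dom], the right
    side by the multiple of exp(- v) from [ratio_le]. *)
Lemma JK_K0r nu y : 1 <= y ->
  \int[mu]_(x in `]0, +oo[) (JK nu (2 * x) * K0r y x) =
  - 16^-1 * \int[mu]_(v in `]0, +oo[) (sin (nu * v) * (sinh v / (sinh v ^+ 2 + y ^+ 2))).
Proof.
move=> y1; have y0 : 0 < y by apply: lt_le_trans y1.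
have mJK : measurable_fun setT (fun x => JK nu (2 * x)).
  by apply: (measurableT_comp (measurable_JK nu)); mfun.
have a0 : 0 < 4 * c4 * Num.sqrt y by rewrite !mulr_gt0 ?c4_gt0// sqrtr_gt0.
have h0 : (k.+1%:R^-1 : R) @[k --> \oo] --> 0 by exact: cvg_harmonic.
have [||||_ H1] := @Rintegral_dominated_cvg R `]0, +oo[
  (fun (k : nat) x => JK nu (2 * x) * K0_damped k.+1%:R^-1 y x)
  (fun x => JK nu (2 * x) * K0r y x) (dom nu (4 * c4 * Num.sqrt y)) measurable_itv0y.
- move=> k; apply: measurable_funTS; apply: mfunM => //; exact: measurable_K0_damped.
- move=> x /=; rewrite in_itv/= andbT => x0.
  by apply: cvgM; [exact: cvg_cst|exact: K0_damped_cvg].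
- move=> k x /=; rewrite in_itv/= andbT => x0.
  apply: le_trans (JK_K0r_le nu y1 x0); rewrite [`|_ * K0_damped _ _ _|]normrM.
  by apply: ler_wpM2l => //; apply: K0_damped_le => //; rewrite invr_gt0.
- exact: integrable_dom.
pose r (e v : R) := sin (nu * v) * ((e + sinh v) / ((e + sinh v) ^+ 2 + y ^+ 2)).
have [||||_ H2] := @Rintegral_dominated_cvg R `]0, +oo[
  (fun (k : nat) v => r k.+1%:R^-1 v) (fun v => sin (nu * v) * (sinh v / (sinh v ^+ 2 + y ^+ 2)))
  (fun v => 4 * expR (- (1 * v))) measurable_itv0y.
- by move=> k; apply: measurable_funTS; rewrite /r; mfun.
- move=> v _.
  have h : {for 0, continuous (r ^~ v)}.
    apply: der_continuous; rewrite /r; derive => //.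
    by rewrite lt0r_neq0// ltr_wpDl ?sqr_ge0// exprn_gt0.
  by have := cvg_comp _ _ h0 h; rewrite /r add0r; exact.
- move=> k v /=; rewrite in_itv/= andbT mul1r => v0.
  have k0 : 0 <= k.+1%:R^-1 :> R by rewrite invr_ge0.
  have /andP[p1 p2] := ratio_le k0 y1 (ltW v0).
  rewrite /r normrM [`|_ / _|]ger0_norm//; apply: le_trans p2.
  by rewrite ler_piMl// sin_max.
- exact: (integrable_scale _ measurable_itv0y (integrable_expR_0y ltr01)).
apply: (cvg_unique _ H1) => //.
rewrite (_ : (fun k : nat => _) = fun k : nat => - 16^-1 * \int[mu]_(v in `]0, +oo[) r k.+1%:R^-1 v); last first.
  by apply/funext => k; rewrite JK_K0_damped// invr_gt0.
by apply: cvgM; [exact: cvg_cst|exact: H2].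
Qed.

End rotation.

(** * The Fourier transform of the hyperbolic secant *)

Section sech_transform.
Context {R : realType}.
Notation mu := (@lebesgue_measure R).
Implicit Types xi v b al : R.

Lemma invcosh_le v : (cosh v)^-1 <= 2 * expR (- (1 * `|v|)).
Proof.
rewrite mul1r expRN -[leLHS]mul1r ler_pdivrMr ?cosh_gt0// mulrAC ler_pdivlMr ?expR_gt0//.
by have := cosh_ge_expR v; lra.
Qed.

Lemma integrable_invcosh : mu.-integrable setT (EFin \o (fun v => (cosh v)^-1)).
Proof.
apply: (integrable_le _ _ _ (integrable_scale 2 measurableT (integrable_expR_norm ltr01))) => //.
  by mfun.
by move=> v _; rewrite ger0_norm ?invcosh_le// invr_ge0 ltW// cosh_gt0.
Qed.

Lemma abs_sinh_le v : `|sinh v| <= cosh v.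
Proof.
rewrite -ler_sqr ?nnegrE ?normr_ge0 ?(ltW (cosh_gt0 v))// real_normK ?num_real//.
by rewrite cosh2Bsinh2 lerDr.
Qed.

Lemma sqr_le_sinh v : v ^+ 2 <= 4 * sinh v ^+ 2.
Proof.
have := cosh2Bsinh2 v; have := cosh_ge_sqr v; have := sqr_ge0 v.
move=> h0 h1 h2; have : (1 + v ^+ 2 / 8) ^+ 2 <= cosh v ^+ 2 by rewrite ler_sqr ?nnegrE; lra.
by have := sqr_ge0 (v ^+ 2); rewrite h2; nra.
Qed.

Definition sech_fourier xi := \int[mu]_v (cos (xi * v) * (cosh v)^-1).

Lemma integrable_sech_fourier (h : R -> R) : measurable_fun setT h -> (forall t, `|h t| <= 1) ->
  mu.-integrable setT (EFin \o (fun v => h v * (cosh v)^-1)).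
Proof.
move=> mh h1; apply: (integrable_le _ _ _ integrable_invcosh) => //.
  by mfun.
by move=> v _; rewrite normrM [`|_^-1|]ger0_norm ?invr_ge0 ?(ltW (cosh_gt0 v))// ler_piMl// invr_ge0 (ltW (cosh_gt0 v)).
Qed.

Lemma cos_acute_gt0 al : 0 < al -> al < pi / 2 -> 0 < cos al.
Proof.
move=> al0 al1; have := @pi_gt0 R => h; apply: cos_gt0_pihalf.
by apply/andP; split => //; lra.
Qed.

Lemma cos_acute_le al b : al < pi / 2 -> 0 <= b <= al -> cos al <= cos b.
Proof.
move=> al1 /andP[b0]; rewrite le_eqVlt => /orP[/eqP ->//|b1]; have := @pi_gt0 R => pi0.
by rewrite ltW// ltr_cos// in_itv/=; apply/andP; split; lra.
Qed.

Section contour.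
Variables (al : R).
Hypotheses (al0 : 0 < al) (al1 : al < pi / 2).

(* [u - i w] is [1 / cosh z] at [z = v + i b], and [D = |cosh z|^2]. *)
Let D v b := sinh v ^+ 2 + cos b ^+ 2.
Let u v b := cosh v * cos b / D v b.
Let w v b := sinh v * sin b / D v b.
Let ub v b := (- (cosh v * sin b) * D v b + 2 * cosh v * cos b ^+ 2 * sin b) / D v b ^+ 2.
Let wb v b := (sinh v * cos b * D v b + 2 * sinh v * sin b ^+ 2 * cos b) / D v b ^+ 2.
Let k := cos al.

Let k0 : 0 < k.
Proof. exact: cos_acute_gt0. Qed.

Let k1 : k <= 1.
Proof. by apply: le_trans (ler_norm _) (cos_max _). Qed.

Let k_le b : 0 <= b <= al -> k <= cos b.
Proof. exact: cos_acute_le. Qed.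

Let D_ge v b : 0 <= b <= al -> k ^+ 2 * cosh v ^+ 2 <= D v b.
Proof.
move=> bI; have kb := k_le bI; rewrite /D cosh2Bsinh2.
have h1 : k ^+ 2 <= cos b ^+ 2 by rewrite ler_sqr ?nnegrE ?(ltW k0)// (le_trans (ltW k0)).
have h2 : k ^+ 2 <= 1 by rewrite expr_le1// ltW.
by have := ler_wpM2r (sqr_ge0 (sinh v)) h2; lra.
Qed.

Let D0 v b : 0 <= b <= al -> 0 < D v b.
Proof.
by move=> bI; apply: lt_le_trans (D_ge v bI); rewrite mulr_gt0// exprn_gt0// cosh_gt0.
Qed.

Let Dsym v b : cosh v ^+ 2 - sin b ^+ 2 = D v b.
Proof. by rewrite /D cosh2Bsinh2; have := cos2Dsin2 b; lra. Qed.

Let dD_b v b : der (D v) b (- (2 * cos b * sin b)).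
Proof. by rewrite /D; derive; ring. Qed.

Let dD_v v b : der (D ^~ b) v (2 * sinh v * cosh v).
Proof. by rewrite /D; derive; ring. Qed.

Let du_b v b : 0 <= b <= al -> der (u v) b (ub v b).
Proof.
move=> bI; have d0 := lt0r_neq0 (D0 v bI); have hD := dD_b v b.
by rewrite /u; derive => //; rewrite /ub; field.
Qed.

Let dw_b v b : 0 <= b <= al -> der (w v) b (wb v b).
Proof.
move=> bI; have d0 := lt0r_neq0 (D0 v bI); have hD := dD_b v b.
by rewrite /w; derive => //; rewrite /wb; field.
Qed.

Let du_v v b : 0 <= b <= al -> der (u ^~ b) v (- wb v b).
Proof.
move=> bI; have d0 := lt0r_neq0 (D0 v bI); have hD := dD_v v b.
rewrite /u; derive => //; rewrite /wb.
transitivity ((sinh v * cos b * D v b - 2 * sinh v * cos b * cosh v ^+ 2) / D v b ^+ 2); first by field.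
by rewrite -[RHS]mulNr; congr (_ / _); rewrite -!Dsym; ring.
Qed.

Let dw_v v b : 0 <= b <= al -> der (w ^~ b) v (ub v b).
Proof.
move=> bI; have d0 := lt0r_neq0 (D0 v bI); have hD := dD_v v b.
rewrite /w; derive => //; rewrite /ub.
transitivity ((cosh v * sin b * D v b - 2 * sinh v ^+ 2 * cosh v * sin b) / D v b ^+ 2); first by field.
by congr (_ / _); rewrite /D; ring.
Qed.

Let K2 := (k ^+ 2)^-1.
Let K4 := 3 * (k ^+ 4)^-1.

Let Dinv v b : 0 <= b <= al -> (D v b)^-1 <= K2 * (cosh v ^+ 2)^-1.
Proof.
move=> bI; rewrite /K2 -invfM lef_pV2 ?posrE ?D0//; first exact: D_ge.
by rewrite mulr_gt0// exprn_gt0// cosh_gt0.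
Qed.

Let uw_le (p v b q : R) : 0 <= b <= al -> `|p| <= cosh v -> `|q| <= 1 ->
  `|p * q / D v b| <= K2 * (cosh v)^-1.
Proof.
move=> bI hp hq; have c0 := cosh_gt0 v; have d0 := D0 v bI.
rewrite normrM [`|_^-1|]ger0_norm ?invr_ge0 ?(ltW d0)//.
apply: (@le_trans _ _ (cosh v * (K2 * (cosh v ^+ 2)^-1))).
  apply: ler_pM => //; [by rewrite invr_ge0 ltW| |exact: Dinv].
  by rewrite normrM (le_trans (ler_piMr _ _)).
by rewrite le_eqVlt; apply/orP; left; apply/eqP; field; exact: lt0r_neq0.
Qed.

(** Common to both derivatives: the fraction splits into p q / D plus 2 (p r / D) / D. Each quotient
    over D costs [K2], and 1 <= K2 allows the total 3 K2^2, which is [K4]. *)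
Let uwb_le (p v b q r : R) : 0 <= b <= al -> `|p| <= cosh v -> `|q| <= 1 -> `|r| <= 1 ->
  `|(p * q * D v b + 2 * p * r) / D v b ^+ 2| <= K4 * (cosh v)^-1.
Proof.
move=> bI hp hq hr; have c0 := cosh_gt0 v; have d0 := D0 v bI.
have c1 := cosh_ge1 v.
have -> : (p * q * D v b + 2 * p * r) / D v b ^+ 2 = p * q / D v b + 2 * (p * r / D v b) * (D v b)^-1.
  by field; exact: lt0r_neq0.
apply: le_trans (ler_normD _ _) _.
have h1 := uw_le bI hp hq; have h2 := uw_le bI hp hr.
have h3 : (D v b)^-1 <= K2.
  apply: le_trans (Dinv v bI) _; rewrite ler_piMr ?invr_ge0 ?exprn_ge0 ?(ltW k0)//.
  by rewrite invf_le1 ?exprn_gt0// exprn_ege1.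
have K21 : 1 <= K2 by rewrite /K2 invf_ge1 ?exprn_gt0// expr_le1// ltW.
have K4E : K4 = 3 * (K2 * K2) by rewrite /K4 /K2; field; exact: lt0r_neq0.
have ic : 0 <= (cosh v)^-1 by rewrite invr_ge0 ltW.
have h4 : `|2 * (p * r / D v b) * (D v b)^-1| <= 2 * (K2 * (cosh v)^-1) * K2.
  rewrite normrM [`|_^-1|]ger0_norm ?invr_ge0 ?(ltW d0)// normrM [`|2|]ger0_norm//.
  by apply: ler_pM; rewrite ?mulr_ge0// ?invr_ge0 ?(ltW d0)// ler_wpM2l.
have h5 : K2 * (cosh v)^-1 <= K2 * (cosh v)^-1 * K2.
  by rewrite ler_peMr// mulr_ge0// (le_trans ler01).
by rewrite K4E; lra.
Qed.

Let ub_le v b : 0 <= b <= al -> `|ub v b| <= K4 * (cosh v)^-1.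
Proof.
move=> bI; have -> : ub v b = (cosh v * - sin b * D v b + 2 * cosh v * (cos b ^+ 2 * sin b)) / D v b ^+ 2.
  by rewrite /ub; congr (_ / _); ring.
apply: uwb_le => //; first by rewrite ger0_norm// ltW// cosh_gt0.
  by rewrite normrN sin_max.
by rewrite normrM normrX mulr_ile1 ?exprn_ge0 ?exprn_ile1 ?cos_max ?sin_max.
Qed.

Let wb_le v b : 0 <= b <= al -> `|wb v b| <= K4 * (cosh v)^-1.
Proof.
move=> bI; have -> : wb v b = (sinh v * cos b * D v b + 2 * sinh v * (sin b ^+ 2 * cos b)) / D v b ^+ 2.
  by rewrite /wb; congr (_ / _); ring.
apply: uwb_le => //; rewrite ?cos_max ?abs_sinh_le//.
by rewrite normrM normrX mulr_ile1 ?exprn_ge0 ?exprn_ile1 ?cos_max ?sin_max.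
Qed.

Let u_le v b : 0 <= b <= al -> `|u v b| <= K2 * (cosh v)^-1.
Proof. by move=> bI; apply: uw_le; rewrite ?cos_max ?ger0_norm// ltW// cosh_gt0. Qed.

Let w_le v b : 0 <= b <= al -> `|w v b| <= K2 * (cosh v)^-1.
Proof. by move=> bI; apply: uw_le; rewrite ?sin_max ?abs_sinh_le. Qed.

(** [P] and [Q] are the real and imaginary parts of exp(i xi z) / cosh z at z = v + i b, and [d] is
    the b-derivative of [P]. *)
Let P xi v b := expR (- (xi * b)) * (cos (xi * v) * u v b + sin (xi * v) * w v b).
Let Q xi v b := expR (- (xi * b)) * (sin (xi * v) * u v b - cos (xi * v) * w v b).
Let d xi v b := expR (- (xi * b)) * (- xi * (cos (xi * v) * u v b + sin (xi * v) * w v b) +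
   (cos (xi * v) * ub v b + sin (xi * v) * wb v b)).

Let trig2_le (t p q B : R) : `|p| <= B -> `|q| <= B -> `|cos t * p + sin t * q| <= 2 * B.
Proof.
move=> hp hq; apply: le_trans (ler_normD _ _) _; rewrite !normrM.
have h1 := ler_piMl (normr_ge0 p) (cos_max t); have h2 := ler_piMl (normr_ge0 q) (sin_max t).
lra.
Qed.

Let P_int xi b : 0 <= b <= al -> mu.-integrable setT (EFin \o P xi ^~ b).
Proof.
move=> bI; apply: (integrable_le _ _ _ (integrable_scale (expR (- (xi * b)) * (2 * K2)) measurableT integrable_invcosh)) => //.
  by rewrite /P /u /w /D; mfun.
move=> v _; rewrite /P normrM ger0_norm ?expR_ge0// -[leRHS]mulrA; apply: ler_wpM2l; first exact: expR_ge0.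
by rewrite -[leRHS]mulrA; apply: trig2_le; [exact: u_le|exact: w_le].
Qed.

Let al_ge0 : 0 <= al <= al. Proof. by rewrite lexx ltW. Qed.
Let zero_le : 0 <= (0 : R) <= al. Proof. by rewrite lexx ltW. Qed.

Let invcosh_y : (cosh v)^-1 @[v --> +oo] --> (0 : R).
Proof.
apply: norm_cvg0; apply: (@squeeze_cvgr _ _ _ _ (fun=> 0) (fun v => 2 * expR (- (1 * v)))).
- near=> v; rewrite normr_ge0/= ger0_norm ?invr_ge0 ?(ltW (cosh_gt0 v))//.
  have v0 : 0 < v by near: v; apply: nbhs_pinfty_gt; exact: num_real.
  by have := invcosh_le v; rewrite gtr0_norm.
- exact: cvg_cst.
- by rewrite -[X in _ `=>` nbhs X](mulr0 2); apply: cvgM; [exact: cvg_cst|exact: cvgy_expRN].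
Unshelve. all: by end_near. Qed.

Let Q_le xi v b : 0 <= b <= al -> `|Q xi v b| <= expR (- (xi * b)) * (2 * K2) * (cosh v)^-1.
Proof.
move=> bI; rewrite /Q normrM ger0_norm ?expR_ge0// -[leRHS]mulrA; apply: ler_wpM2l; first exact: expR_ge0.
rewrite -[leRHS]mulrA addrC -mulrN; apply: trig2_le; last exact: u_le.
by rewrite normrN; exact: w_le.
Qed.

Let Q_y xi b : 0 <= b <= al -> Q xi v b @[v --> +oo] --> 0.
Proof.
move=> bI; apply: norm_cvg0; apply: (@squeeze_cvgr _ _ _ _ (fun=> 0)
   (fun v => expR (- (xi * b)) * (2 * K2) * (cosh v)^-1)).
- by apply: nearW => v; rewrite normr_ge0 Q_le.
- exact: cvg_cst.
- rewrite -[X in _ `=>` nbhs X](mulr0 (expR (- (xi * b)) * (2 * K2))).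
  by apply: cvgM; [exact: cvg_cst|exact: invcosh_y].
Qed.

Let Q_Ny xi b : 0 <= b <= al -> Q xi v b @[v --> -oo] --> 0.
Proof.
move=> bI; apply/cvgNy_compNP.
(* [Q] is odd in v, so the limit at -oo is minus the one at +oo. *)
have -> : (Q xi ^~ b) \o -%R = fun v => -1 * Q xi v b.
  apply/funext => v; rewrite /Q /u /w /D /= coshN sinhN mulrN cosN sinN sqrrN; ring.
suff h : -1 * Q xi v b @[v --> +oo] --> (0 : R) by exact: h.
by rewrite -(mulr0 (-1)); apply: cvgM; [exact: cvg_cst|exact: Q_y].
Qed.

Let d_le xi v b : 0 <= b <= al ->
  `|d xi v b| <= expR (`|xi| * al) * (`|xi| * (2 * K2) + 2 * K4) * (cosh v)^-1.
Proof.
move=> bI; rewrite /d normrM ger0_norm ?expR_ge0// -[leRHS]mulrA.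
apply: ler_pM; rewrite ?expR_ge0//.
  rewrite ler_expR; have /andP[b0 b1] := bI; have := ler_norm (- xi); rewrite normrN => h.
  have := ler_wpM2r b0 h; have := ler_wpM2l (normr_ge0 xi) b1; lra.
apply: le_trans (ler_normD _ _) _; rewrite normrM normrN mulrDl; apply: lerD.
  rewrite -[leRHS]mulrA; apply: ler_wpM2l => //.
  by rewrite -[leRHS]mulrA; apply: trig2_le; [exact: u_le|exact: w_le].
by rewrite -[leRHS]mulrA; apply: trig2_le; [exact: ub_le|exact: wb_le].
Qed.

(** The line is moved from height 0 to height [al], below the pole of 1 / cosh at i pi / 2. *)
Lemma sech_shift xi :
  \int[mu]_v (cos (xi * v) * u v al + sin (xi * v) * w v al) = expR (xi * al) * sech_fourier xi.
Proof.
have dP v b : 0 <= b <= al -> der (P xi v) b (d xi v b).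
  move=> bI; have h1 := du_b v bI; have h2 := dw_b v bI.
  apply: der_eq (derM (der_expR (derN (derM (der_cst xi b) (der_id b)))) (derD (derM (der_cst (cos (xi * v)) b) h1) (derM (der_cst (sin (xi * v)) b) h2))) _.
  by rewrite /d; ring.
have dQ v b : 0 <= b <= al -> der (Q xi ^~ b) v (- d xi v b).
  move=> bI; have h1 := du_v v bI; have h2 := dw_v v bI.
  have h3 := derM (der_cst xi v) (der_id v).
  apply: der_eq (derM (der_cst (expR (- (xi * b))) v) (derD (derM (der_sin h3) h1) (derN (derM (der_cos h3) h2)))) _.
  by rewrite /d; ring.
have := @Rintegral_CR_const R (P xi) (Q xi) (d xi) 0 al
  (fun v => expR (`|xi| * al) * (`|xi| * (2 * K2) + 2 * K4) * (cosh v)^-1) al0 dP dQ.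
have P0 : \int[mu]_v P xi v 0 = sech_fourier xi.
  apply: eq_Rintegral => v _; rewrite /P /u /w /D cos0 sin0 !mulr0 oppr0 expR0 mul0r mulr0 addr0 mul1r.
  rewrite mulr1 expr1n addrC -cosh2Bsinh2; congr (_ * _).
  by field; rewrite lt0r_neq0// cosh_gt0.
have Pal : \int[mu]_v P xi v al = expR (- (xi * al)) *
    \int[mu]_v (cos (xi * v) * u v al + sin (xi * v) * w v al).
  rewrite RintegralZl//.
  have := integrable_scale (expR (xi * al)) measurableT (P_int xi al_ge0).
  apply: eq_integrable => // v _; congr EFin; rewrite /P mulrA -expRD addrN expR0 mul1r//.
rewrite P0 Pal => -> //.
- by rewrite mulrA -expRD addrN expR0 mul1r.
- move=> v b bI; have h1 := du_b v bI; have h2 := dw_b v bI; have h3 := dD_b v b.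
  have d0 := lt0r_neq0 (D0 v bI).
  by apply: der_continuous; rewrite /d /ub /wb; derive => //; rewrite expf_neq0.
- move=> b bI v; have h1 := du_v v bI; have h2 := dw_v v bI; have h3 := dD_v v b.
  have d0 := lt0r_neq0 (D0 v bI).
  by apply: der_continuous; rewrite /d /ub /wb; derive => //; rewrite expf_neq0.
- by rewrite /d /ub /wb /u /w /D; mfun.
- by move=> v b bI; exact: d_le.
- exact: (integrable_scale _ measurableT integrable_invcosh).
- by move=> b bI; exact: Q_Ny.
- by move=> b bI; exact: Q_y.
- exact: P_int.
- exact: P_int.
Qed.

(** Averaging [sech_shift] over xi and - xi cancels the sine term and turns the exponential into a
    hyperbolic cosine. *)
Lemma sech_kernel xi :
  \int[mu]_v (cos (xi * v) * (cosh v * cos al / (sinh v ^+ 2 + cos al ^+ 2))) =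
  cosh (xi * al) * sech_fourier xi.
Proof.
have iu : mu.-integrable setT (EFin \o (fun v => cos (xi * v) * u v al)).
  apply: (integrable_le _ _ _ (integrable_scale K2 measurableT integrable_invcosh)) => //.
    by rewrite /u /D; mfun.
  by move=> v _; rewrite normrM (le_trans (ler_piMl _ (cos_max _)))// u_le.
have iw : mu.-integrable setT (EFin \o (fun v => sin (xi * v) * w v al)).
  apply: (integrable_le _ _ _ (integrable_scale K2 measurableT integrable_invcosh)) => //.
    by rewrite /w /D; mfun.
  by move=> v _; rewrite normrM (le_trans (ler_piMl _ (sin_max _)))// w_le.
have h1 := sech_shift xi; have h2 := sech_shift (- xi).
have sN : sech_fourier (- xi) = sech_fourier xi.
  by apply: eq_Rintegral => v _; rewrite mulNr cosN.
have h2' : \int[mu]_v (cos (xi * v) * u v al - sin (xi * v) * w v al) = expR (- (xi * al)) * sech_fourier xi.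
  by rewrite -sN -mulNr -h2; apply: eq_Rintegral => v _; rewrite mulNr cosN sinN mulNr.
move: h1 h2'; rewrite RintegralD// RintegralB// => h1 h2'.
by rewrite /cosh; lra.
Qed.

Let D1 v : sinh v ^+ 2 + cos al ^+ 2 != 0.
Proof. exact: lt0r_neq0 (D0 v al_ge0). Qed.

Lemma integrable_sech_kernel :
  mu.-integrable setT (EFin \o (fun v => cosh v * cos al / (sinh v ^+ 2 + cos al ^+ 2))).
Proof.
apply: (integrable_le _ _ _ (integrable_scale K2 measurableT integrable_invcosh)) => //.
  by mfun.
by move=> v _; exact: (u_le v al_ge0).
Qed.

(** The integrand has the primitive atan(sinh v / cos al). The mass is independent of [al], so the
    kernel acts as an approximate identity as [al] tends to pi/2. *)
Lemma sech_kernel_mass : \int[mu]_v (cosh v * cos al / (sinh v ^+ 2 + cos al ^+ 2)) = pi.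
Proof.
have k0' := lt0r_neq0 k0.
have dat v : der (fun v => atan (sinh v / k)) v (cosh v * k / (sinh v ^+ 2 + k ^+ 2)).
  have h : der (fun v => sinh v / k) v (cosh v / k) by derive; field.
  apply: der_eq; first exact: is_derive1_comp (is_derive1_atan _) h.
  have d0 := D1 v.
  rewrite -/k in d0 *; move: d0 k0'; move: (sinh v) (k) => s q d0 q0.
  by field; rewrite d0 q0.
have sy : sinh v / k @[v --> +oo] --> +oo.
  apply/cvgryPge => A; near=> t.
  have t4 : 4 <= t by near: t; apply: nbhs_pinfty_ge; exact: num_real.
  have tA : A <= t by near: t; apply: nbhs_pinfty_ge; exact: num_real.
  have h : t <= sinh t.
    have t0 : 0 <= t by apply: le_trans t4.
    by have := sinh_ge_sqr t0; have := mulr_ge0 t0 (_ : 0 <= t - 4); rewrite subr_ge0 => /(_ t4); lra.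
  apply: (le_trans tA); apply: (le_trans h).
  by rewrite ler_peMr ?invf_ge1//; lra.
rewrite (@FTC_T R (fun v => atan (sinh v / k)) _ (- (pi / 2)) (pi / 2) dat).
- by rewrite opprK; have := @pi_gt0 R; lra.
- by move=> v; have d0 := D1 v; apply: der_continuous; derive.
- apply/cvgNy_compNP.
  have -> : (fun v => atan (sinh v / k)) \o -%R = fun v => -1 * atan (sinh v / k).
    by apply/funext => v /=; rewrite mulN1r sinhN mulNr atanN.
  have h : -1 * atan (sinh v / k) @[v --> +oo] --> (-1 * (pi / 2) : R).
    by apply: cvgM; [exact: cvg_cst|exact: (cvg_comp _ _ sy (@cvgy_atan R))].
  rewrite mulN1r in h; exact: h.
- exact: (cvg_comp _ _ sy (@cvgy_atan R)).
- exact: integrable_sech_kernel.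
Unshelve. all: by end_near. Qed.

(** The left side integrates cos(xi v) - 1 against the kernel of mass pi. This difference is at most
    2 and at most xi^2 v^2 / 2, with v^2 <= 4 sinh^2 v, so times cosh^2 v it is at most (2 xi^2 + 2)
    D; the kernel then leaves cos al / cosh v, which is small near pi/2. *)
Lemma sech_kernel_dist xi : `|cosh (xi * al) * sech_fourier xi - pi| <=
  (2 * xi ^+ 2 + 2) * cos al * \int[mu]_v (cosh v)^-1.
Proof.
have iu : mu.-integrable setT (EFin \o (fun v => cos (xi * v) * (cosh v * cos al / (sinh v ^+ 2 + cos al ^+ 2)))).
  apply: (integrable_le _ _ _ (integrable_scale K2 measurableT integrable_invcosh)) => //.
    by mfun.
  by move=> v _; rewrite normrM (le_trans (ler_piMl _ (cos_max _)))//; exact: (u_le v al_ge0).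
rewrite -sech_kernel -sech_kernel_mass -RintegralB//; last exact: integrable_sech_kernel.
rewrite -RintegralZl//; last exact: integrable_invcosh.
apply: norm_Rintegral_le => //; first by mfun.
  move=> v _; have c0 := cosh_gt0 v; have k0' := k0; have d0 := D0 v al_ge0.
  rewrite -[X in _ - X]mul1r -mulrBl normrM [`|_ / _|]ger0_norm; last first.
    by apply: divr_ge0; [apply: mulr_ge0; exact: ltW|exact: ltW].
  have n0 := normr_ge0 (cos (xi * v) - 1).
  have n1 : `|cos (xi * v) - 1| <= 2.
    by apply: le_trans (ler_normB _ _) _; rewrite normr1; have := cos_max (xi * v); lra.
  have n2 : `|cos (xi * v) - 1| <= xi ^+ 2 * v ^+ 2 / 2.
    have := cos_ge (xi * v); have := le_trans (ler_norm _) (cos_max (xi * v)).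
    by rewrite exprMn => h1 h2; rewrite ler_norml; apply/andP; split; lra.
  have h : `|cos (xi * v) - 1| * cosh v ^+ 2 <= (2 * xi ^+ 2 + 2) * D v al.
    have s0 := sqr_ge0 (sinh v); have h1 := ler_wpM2r s0 n1.
    have h2 := ler_wpM2l (sqr_ge0 xi) (sqr_le_sinh v).
    have h3 := mulr_ge0 (sqr_ge0 xi) (sqr_ge0 k); have h4 := sqr_ge0 k.
    by rewrite cosh2Bsinh2 /D -/k; lra.
  rewrite -/k -/(D v al); rewrite -ler_pdivrMr// in h.
  have := ler_wpM2l (mulr_ge0 (ltW k0') (ltW (_ : 0 < (cosh v)^-1))) h; rewrite invr_gt0 => /(_ c0).
  have -> : k * (cosh v)^-1 * (`|cos (xi * v) - 1| * cosh v ^+ 2 / D v al) =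
     `|cos (xi * v) - 1| * (cosh v * k / D v al) by field; rewrite !lt0r_neq0.
  by move=> h5; apply: (le_trans h5); rewrite le_eqVlt; apply/orP; left; apply/eqP; ring.
exact: (integrable_scale _ measurableT integrable_invcosh).
Qed.

End contour.

Lemma sech_fourierE xi : sech_fourier xi = pi / cosh (xi * (pi / 2)).
Proof.
pose g (e : R) := cosh (xi * (pi / 2 - e)) * sech_fourier xi.
(* The angle pi/2 - e_j stays in ]0, pi/2[ because e_j <= 1/2 and pi/2 >= 1; its cosine is sin e_j
   <= e_j. *)
pose e (j : nat) : R := 2^-1 * j.+1%:R^-1.
have e0 : e j @[j --> \oo] --> 0.
  by rewrite -(mulr0 2^-1); apply: cvgM; [exact: cvg_cst|exact: cvg_harmonic].
have cg : {for 0, continuous g} by apply: der_continuous; rewrite /g; derive.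
have h1 : g (e j) @[j --> \oo] --> cosh (xi * (pi / 2)) * sech_fourier xi.
  by have := cvg_comp _ _ e0 cg; rewrite /g subr0; exact.
have h2 : g (e j) @[j --> \oo] --> pi.
  apply/subr_cvg0; apply: norm_cvg0.
  apply: (@squeeze_cvgr _ _ _ _ (fun=> 0)
    (fun j => (2 * xi ^+ 2 + 2) * (\int[mu]_v (cosh v)^-1) * e j)); last 2 first.
  - exact: cvg_cst.
  - by rewrite -[X in _ `=>` nbhs X](mulr0 ((2 * xi ^+ 2 + 2) * (\int[mu]_v (cosh v)^-1))); apply: cvgM; [exact: cvg_cst|exact: e0].
  apply: nearW => j; rewrite normr_ge0/=.
  have ej0 : 0 < e j by rewrite mulr_gt0// invr_gt0.
  have ej1 : e j <= 2^-1 by rewrite ler_piMr// invf_le1// ler1n.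
  have p1 := @pihalf_ge1 R.
  have a0 : 0 < pi / 2 - e j by lra.
  have a1 : pi / 2 - e j < pi / 2 by lra.
  apply: le_trans (sech_kernel_dist a0 a1 xi) _.
  have ci : 0 <= \int[mu]_v (cosh v)^-1.
    by apply: Rintegral_ge0 => v _; rewrite invr_ge0 ltW// cosh_gt0.
  have x0 : 0 <= 2 * xi ^+ 2 + 2 by have := sqr_ge0 xi; lra.
  have ce : cos (pi / 2 - e j) <= e j.
    rewrite cosB cos_pihalf sin_pihalf mul0r add0r mul1r.
    by apply: le_trans (ler_norm _) (le_trans (sin_le_norm _) _); rewrite gtr0_norm.
  by rewrite mulrAC; apply: ler_wpM2l => //; exact: mulr_ge0.
have c0 := lt0r_neq0 (cosh_gt0 (xi * (pi / 2))).
have E : cosh (xi * (pi / 2)) * sech_fourier xi = pi by apply: (cvg_unique _ h1 h2).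
by apply: (mulfI c0); rewrite E mulrCA divff ?mulr1.
Qed.

(** The integrand is even in v, so the half-line integral is half of one over the whole line. There
    the two sech terms of the partial fraction can be translated by u and - u, and the translated
    sines combine to 2 cos(xi v) sin(xi u). *)
Lemma sinh_ratio_integral xi u :
  sinh u * \int[mu]_(v in `]0, +oo[) (sin (xi * v) * (sinh v / (sinh v ^+ 2 + cosh u ^+ 2))) =
  2^-1 * sin (xi * u) * sech_fourier xi.
Proof.
have ch v : cosh (v + u) * cosh (v - u) = sinh v ^+ 2 + cosh u ^+ 2.
  rewrite !coshD coshN sinhN; have := cosh2Bsinh2 v; have := cosh2Bsinh2 u => h1 h2.
  transitivity (cosh v ^+ 2 * cosh u ^+ 2 - sinh v ^+ 2 * sinh u ^+ 2); first by ring.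
  by rewrite h2 h1; ring.
have hs v : sinh u * (sin (xi * v) * (sinh v / (sinh v ^+ 2 + cosh u ^+ 2))) =
    2^-1 * (sin (xi * v) * (cosh (v - u))^-1 - sin (xi * v) * (cosh (v + u))^-1).
  have c1 := lt0r_neq0 (cosh_gt0 (v + u)); have c2 := lt0r_neq0 (cosh_gt0 (v - u)).
  rewrite -ch -mulrBr.
  have -> : (cosh (v - u))^-1 - (cosh (v + u))^-1 = (cosh (v + u) - cosh (v - u)) / (cosh (v + u) * cosh (v - u)).
    by field; rewrite c1 c2.
  by rewrite [X in (X - _) / _]coshD [X in (_ - X) / _]coshD coshN sinhN; field; rewrite c1 c2.
have is_ w : mu.-integrable setT (EFin \o (fun v => sin (xi * (v + w)) * (cosh v)^-1)).
  by apply: integrable_sech_fourier; [mfun|move=> v; exact: sin_max].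
have is2 w : mu.-integrable setT (EFin \o (fun v => sin (xi * v) * (cosh (v + w))^-1)).
  have := integrable_shift w (is_ (- w)); apply: eq_integrable => // v _ /=.
  by rewrite addrK.
have E w : \int[mu]_v (sin (xi * v) * (cosh (v + w))^-1) = \int[mu]_v (sin (xi * (v - w)) * (cosh v)^-1).
  by rewrite (Rintegral_shift w (is_ (- w))); apply: eq_Rintegral => v _; rewrite addrK.
have di := integrable_sub measurableT (is2 (- u)) (is2 u).
have hi : mu.-integrable setT (EFin \o (fun v => sinh u * (sin (xi * v) * (sinh v / (sinh v ^+ 2 + cosh u ^+ 2))))).
  by under eq_fun do rewrite hs; exact: integrable_scale.
have i0 : mu.-integrable `]0, +oo[ (EFin \o (fun v => sin (xi * v) * (sinh v / (sinh v ^+ 2 + cosh u ^+ 2)))).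
  have := integrable_ratio xi (lexx 0) (cosh_ge1 u); apply: eq_integrable => // v _ /=.
  by rewrite !add0r.
rewrite -RintegralZl//.
apply: (mulfI (_ : 2 != 0 :> R)) => //.
rewrite -(Rintegral_even hi) => [|v]; last by rewrite sinhN mulrN sinN sqrrN; ring.
under eq_Rintegral do rewrite hs.
rewrite RintegralZl// RintegralB// !E -RintegralB//.
have -> : \int[mu]_v (sin (xi * (v - - u)) * (cosh v)^-1 - sin (xi * (v - u)) * (cosh v)^-1) =
    2 * sin (xi * u) * sech_fourier xi.
  rewrite -RintegralZl//; last by apply: integrable_sech_fourier; [mfun|move=> v; exact: cos_max].
  apply: eq_Rintegral => v _; rewrite opprK !mulrDr sinD mulrN sinB; ring.
by field.
Qed.

End sech_transform.

(** * Inversion *)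

Section bessel_values.
Context {R : realType}.
Notation mu := (@lebesgue_measure R).
Implicit Types x u : R.

Lemma natCE k : k%:R = k%:R +i* 0 :> R[i].
Proof. by rewrite -[RHS]/((k%:R)%:C) rmorph_nat. Qed.

Lemma complexZ (r a b : R) : r%:C * (a +i* b) = (r * a) +i* (r * b).
Proof. by apply/eqP; rewrite eq_complex/= !mul0r subr0 addr0 !eqxx. Qed.

Lemma cexp_realimag (a b : R) : cexp (a +i* b) = (expR a * cos b) +i* (expR a * sin b).
Proof. by apply/eqP; rewrite eq_complex/= !mul0r subr0 addr0 !eqxx. Qed.

Lemma ccosh_imag (b : R) : ccosh (0 +i* b) = (cos b)%:C.
Proof.
have -> : ccosh (0 +i* b) = (cexp (0 +i* b) + cexp (0 +i* - b)) / 2.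
  by rewrite /ccosh; congr ((_ + cexp _) / 2); apply/eqP; rewrite eq_complex/= oppr0 !eqxx.
rewrite !cexp_realimag expR0 cosN sinN.
have -> : 2^-1 = (2^-1)%:C :> R[i] by rewrite fmorphV/= rmorph_nat.
by apply/eqP; rewrite eq_complex/=; apply/andP; split; apply/eqP; field.
Qed.

Lemma Rintegral_even_cy (f : R -> R) : mu.-integrable setT (EFin \o f) ->
  (forall t, f (- t) = f t) -> \int[mu]_(t in `[0, +oo[) f t = 2^-1 * \int[mu]_t f t.
Proof.
move=> fi fE; rewrite (Rintegral_even fi fE) mulrA mulVf// mul1r.
rewrite Rintegral_itv_obnd_cbnd//; apply: integrableS fi => //; exact: measurable_itv.
Qed.

Lemma besselK_imag n (X : R) : 0 < X ->
  besselK ('i%C * n%:R) (2 * Num.sqrt X)%:C = (besK n%:R X)%:C.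
Proof.
move=> X0; have w0 : 0 < 2 * Num.sqrt X by rewrite mulr_gt0// sqrtr_gt0.
have E t : cexp (- (2 * Num.sqrt X)%:C * (cosh t)%:C) * ccosh ('i%C * n%:R * t%:C) =
    (expR (- (2 * Num.sqrt X * cosh t)) * cos (n%:R * t))%:C.
  have -> : - (2 * Num.sqrt X)%:C * (cosh t)%:C = - (2 * Num.sqrt X * cosh t) +i* 0.
    by apply/eqP; rewrite eq_complex/=; apply/andP; split; apply/eqP; ring.
  have -> : 'i%C * n%:R * t%:C = 0 +i* (n%:R * t).
    by rewrite imag_orderE; apply/eqP; rewrite eq_complex/=; apply/andP; split; apply/eqP; ring.
  rewrite cexp_realimag ccosh_imag cos0 sin0.
  by apply/eqP; rewrite eq_complex/=; apply/andP; split; apply/eqP; ring.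
rewrite /besselK /Cintegral; under eq_Rintegral do rewrite E/=.
under [X in _ +i* X]eq_Rintegral do rewrite E/=.
rewrite [X in _ +i* X]Rintegral_cst ?mul0r//; congr (_ +i* _).
rewrite Rintegral_even_cy//.
- apply: (integrable_le _ _ _ (integrable_cosh_kernel w0)) => //; first by mfun.
  by move=> t _; rewrite normrM ger0_norm ?expR_ge0// ler_piMr ?expR_ge0// cos_max.
- by move=> t; rewrite coshN mulrN cosN.
Qed.

(** The argument of K_0 is w (1 + i), so its real part has exponent and phase both equal to w cosh
    t. Translation by ln (2 sqrt x / sqrt (cosh u)) unbalances w cosh t into the two-sided form of
    [K0r]. *)
Lemma ReK0E x u : 0 < x -> ReK0 x u = K0r (cosh u) x.
Proof.
move=> x0; have y0 := cosh_gt0 u; have c0 := @c4_gt0 R.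
have sx0 : 0 < Num.sqrt x by rewrite sqrtr_gt0.
have sy0 : 0 < Num.sqrt (cosh u) by rewrite sqrtr_gt0.
pose w := 4 * c4 * Num.sqrt (cosh u) * Num.sqrt x.
have w0 : 0 < w by rewrite !mulr_gt0.
have zE : 4 * cexp ('i%C * (pi / 4)%:C) * (Num.sqrt (cosh u))%:C * (Num.sqrt x)%:C = w +i* w.
  have -> : 'i%C * (pi / 4)%:C = 0 +i* (pi / 4) :> R[i].
    by apply/eqP; rewrite eq_complex/= !mul0r !mul1r subr0 add0r !eqxx.
  rewrite cexp_realimag expR0 sin_pi4 -/c4 natCE.
  by apply/eqP; rewrite eq_complex/= /w; apply/andP; split; apply/eqP; ring.
have E t : complex.Re (cexp (- (w +i* w) * (cosh t)%:C) * ccosh (0 * t%:C)) =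
    expR (- (w * cosh t)) * cos (w * cosh t).
  have -> : - (w +i* w) * (cosh t)%:C = - (w * cosh t) +i* - (w * cosh t).
    by apply/eqP; rewrite eq_complex/=; apply/andP; split; apply/eqP; ring.
  rewrite mul0r -[0]/(0 +i* 0) ccosh_imag cos0 cexp_realimag cosN/=; ring.
rewrite /ReK0 zE.
rewrite -[LHS]/(\int[mu]_(t in `[0, +oo[) complex.Re (cexp (- (w +i* w) * (cosh t)%:C) * ccosh (0 * t%:C))).
under eq_Rintegral do rewrite E.
rewrite Rintegral_even_cy; last 2 first.
- apply: (integrable_le _ _ _ (integrable_cosh_kernel w0)) => //; first by mfun.
  by move=> t _; rewrite normrM ger0_norm ?expR_ge0// ler_piMr ?expR_ge0// cos_max.
- by move=> t; rewrite coshN.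
rewrite /K0r; congr (_ * _).
have [ei _] := rot_dom y0 x0.
have gi : mu.-integrable setT (EFin \o (fun v => expR (- (c4 * (4 * x * expR (- v) + cosh u * expR v))) *
              cos (c4 * (4 * x * expR (- v) + cosh u * expR v)))).
  apply: (integrable_le _ _ _ ei) => //; first by mfun.
  by move=> t _; rewrite normrM ger0_norm ?expR_ge0// ler_piMr ?expR_ge0// cos_max.
have p0 : 0 < 2 * Num.sqrt x by rewrite mulr_gt0.
rewrite (Rintegral_shift (ln (2 * Num.sqrt x / Num.sqrt (cosh u))) gi).
apply: eq_Rintegral => t _.
have := two_sided_expE t p0 sy0; rewrite exprMn !sqr_sqrtr ?(ltW x0) ?(ltW y0)//.
have -> : 2 ^+ 2 = 4 :> R by rewrite expr2 -natrM.
by move=> ->; congr (expR (- _) * cos _); rewrite /w; ring.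
Qed.

End bessel_values.

(** * The transform of a real function and its inversion *)

Section transform.
Context {R : realType}.
Notation mu := (@lebesgue_measure R).
Notation I := (`[- pi, pi]%classic : set R).
Implicit Types (p : R -> R) (x u : R).

Lemma K0_bound_anti (w w' : R) : 0 < w -> w <= w' -> K0_bound w' <= K0_bound w.
Proof.
move=> w0 ww'; have w'0 : 0 < w' by apply: lt_le_trans ww'.
rewrite /K0_bound ler_wpM2l ?mulr_ge0 ?expR_ge0//.
apply: ler_pM; rewrite ?expR_ge0 ?invr_ge0 ?sqrtr_ge0 ?ler_expR ?lerN2//.
by rewrite lef_pV2 ?posrE ?sqrtr_gt0// ler_wsqrtr.
Qed.

Lemma K0r_cosh_le x u : 0 < x -> `|K0r (cosh u) x| <= K0_bound (4 * c4 * Num.sqrt 1 * Num.sqrt x).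
Proof.
move=> x0; apply: le_trans (K0r_le (cosh_gt0 u) x0) _; apply: K0_bound_anti.
  by rewrite sqrtr1 !mulr_gt0 ?c4_gt0 ?sqrtr_gt0.
rewrite ler_wpM2r ?sqrtr_ge0// ler_wpM2l ?mulr_ge0 ?(ltW (c4_gt0))//.
by rewrite ler_wsqrtr// cosh_ge1.
Qed.

Lemma abs_sinh_le_pi u : - pi <= u <= pi -> `|sinh u| <= cosh (pi : R).
Proof.
move=> /andP[u0 u1]; apply: le_trans (abs_sinh_le u) _.
have H (a b : R) : 0 <= a -> a <= b -> cosh a <= cosh b.
  move=> a0 ab; have -> : b = a + (b - a) by lra.
  rewrite coshD; have c1 := cosh_ge1 (b - a); have c2 := cosh_gt0 a.
  have s1 : 0 <= sinh a by apply: le_trans (sinh_ge_sqr a0); rewrite divr_ge0// sqr_ge0.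
  have ba : 0 <= b - a by lra.
  have s2 : 0 <= sinh (b - a) by apply: le_trans (sinh_ge_sqr ba); rewrite divr_ge0// sqr_ge0.
  by have := mulr_ge0 s1 s2; have := ler_wpM2l (ltW c2) c1; lra.
have [v0|v0] := leP 0 u; first exact: H.
by rewrite -coshN; apply: H; lra.
Qed.

(** The transform defining f, for a real-valued function; the real and imaginary parts of psi are
    treated separately. *)
Definition ftrans p x := - 32 * \int[mu]_(u in I) (K0r (cosh u) x * p u * sinh u).

(** Integrating over x first, the constants - 32, - 1/16 and 1/2 multiply to 1, and the value of
    [sech_fourier] is what remains in front of the sine coefficient. *)
Lemma JK_ftrans n p : bounded_mfun p ->
  \int[mu]_(x in `]0, +oo[) (JK n%:R (2 * x) * ftrans p x) =
  pi / cosh (n%:R * (pi / 2)) * \int[mu]_(u in I) (p u * sin (n%:R * u)).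
Proof.
move=> [mp [M pM]]; have M0 : 0 <= M by apply: le_trans (normr_ge0 _) (pM 0).
have pi0 := @pi_gt0 R.
pose F (z : R * R) := (JK n%:R (2 * z.1) * - 32) * (K0r (cosh z.2) z.1 * p z.2 * sinh z.2).
have mK : measurable_fun setT (fun z : R * R => K0r (cosh z.2) z.1).
  have h : measurable_fun setT (fun z : R * R => (cosh z.2, z.1)).
    by apply: measurable_fun_pair; mfun.
  exact: (measurableT_comp (@measurable_K0r R) h).
have mJK : measurable_fun setT (fun z : R * R => JK n%:R (2 * z.1)).
  by apply: (measurableT_comp (measurable_JK n%:R)); mfun.
have mp2 : measurable_fun setT (fun z : R * R => p z.2) by apply: (measurableT_comp mp); mfun.
have mF : measurable_fun setT F by rewrite /F; mfun.
have msec x : 0 < x -> mu.-integrable I (EFin \o (fun u => K0r (cosh u) x * p u * sinh u)).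
  move=> x0.
  apply: (integrable_le _ _ _ (bounded_mfun_integrable (bounded_mfunC
     (K0_bound (4 * c4 * Num.sqrt 1 * Num.sqrt x) * M * cosh pi)))) => //.
    apply: measurable_funTS; apply: mfunM; last by mfun.
    by apply: mfunM => //; exact: (measurableT_comp mK (pair1_measurable x)).
  move=> u /=; rewrite in_itv/= => uI; rewrite normrM [`|_ * p _|]normrM.
  by apply: ler_pM; rewrite ?mulr_ge0// ?abs_sinh_le_pi//; apply: ler_pM => //; exact: K0r_cosh_le.
transitivity (\int[mu]_(x in `]0, +oo[) \int[mu]_(u in I) F (x, u)).
  apply: eq_Rintegral => x; rewrite mem_itv0y => x0.
  by rewrite /ftrans mulrA -RintegralZl//; exact: msec.
pose a : R := 4 * c4 * Num.sqrt 1.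
have a0 : 0 < a by rewrite /a sqrtr1 !mulr_gt0 ?c4_gt0.
(* The bound for [K0r (cosh u) x] is largest at cosh u = 1, which makes the majorant uniform in u;
   |sinh u| <= cosh pi and the length 2 pi of [I] give the constant. *)
rewrite (@Rintegral_fubini R `]0, +oo[ I F (fun x => (32 * M * cosh pi * (pi + pi)) * dom n%:R a x))//; last 2 first.
- exact: (integrable_scale _ measurable_itv0y (integrable_dom _ a0)).
- move=> x /=; rewrite in_itv/= andbT => x0.
  have ci : mu.-integrable I (EFin \o (fun=> 1)) by exact: (bounded_mfun_integrable (bounded_mfunC 1)).
  have cv : \int[mu]_(u in I) 1 <= pi + pi.
    by rewrite /Rintegral integral_cst//= lebesgue_measure_itv/= lte_fin lt_Npipi -EFinD mul1e/= opprK.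
  have cp := cosh_gt0 (pi : R).
  apply: le_trans (integral_norm_le (c := 32 * M * cosh pi * dom n%:R a x) _ _ _ _ ci cv) _ => //.
  + by apply: measurable_funTS; exact: (measurableT_comp mF (pair1_measurable x)).
  + rewrite !mulr_ge0// ?(ltW cp)// ?mix_bound_ge0 ?expR_ge0 ?invr_ge0 ?sqrtr_ge0//.
  + move=> u /=; rewrite in_itv/= => uI; rewrite mulr1 /F/= normrM [`|_ * - 32|]normrM normrN.
    have -> : `|32| = 32 :> R by rewrite ger0_norm.
    rewrite [`|_ * sinh _|]normrM [`|_ * p _|]normrM.
    have h1 := JK_K0r_le n%:R (lexx 1) x0.
    have h2 : `|K0r (cosh u) x| * `|p u| * `|sinh u| <= K0_bound (a * Num.sqrt x) * M * cosh pi.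
      apply: ler_pM; rewrite ?mulr_ge0// ?abs_sinh_le_pi//; apply: ler_pM => //; exact: K0r_cosh_le.
    have h3 := ler_wpM2l (mulr_ge0 (normr_ge0 (JK n%:R (2 * x))) (ler0n R 32)) h2.
    apply: (le_trans h3).
    rewrite -/a in h1; have mc : 0 <= 32 * M * cosh pi by rewrite !mulr_ge0// ltW.
    by have := ler_wpM2l mc h1; lra.
  + by rewrite lee_fin; lra.
rewrite -RintegralZl; last 2 first.
- exact: measurable_itv.
- by apply: bounded_mfun_integrable; apply: bounded_mfunM; [split => //; exists M|apply: bounded_mfun_sin; mfun].
apply: eq_Rintegral => u _.
have ji : mu.-integrable `]0, +oo[ (EFin \o (fun x => JK n%:R (2 * x) * K0r (cosh u) x)).
  apply: (integrable_le _ _ _ (integrable_dom n%:R (_ : 0 < 4 * c4 * Num.sqrt (cosh u)))) => //.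
  - apply: measurable_funTS; apply: mfunM; first by apply: (measurableT_comp (measurable_JK n%:R)); mfun.
    exact: (measurableT_comp mK (pair2_measurable u)).
  - move=> x /=; rewrite in_itv/= andbT => x0.
    apply: le_trans (JK_K0r_le n%:R (cosh_ge1 u) x0).
    rewrite [`|_ * K0r _ _|]normrM; apply: ler_wpM2l => //; exact: K0r_le (cosh_gt0 u) x0.
  - by rewrite !mulr_gt0 ?c4_gt0 ?sqrtr_gt0 ?cosh_gt0.
have -> : \int[mu]_(x in `]0, +oo[) F (x, u) =
    (- 32 * p u * sinh u) * \int[mu]_(x in `]0, +oo[) (JK n%:R (2 * x) * K0r (cosh u) x).
  by rewrite -RintegralZl//; apply: eq_Rintegral => x _; rewrite /F/=; ring.
rewrite (JK_K0r _ (cosh_ge1 u)).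
have := sinh_ratio_integral n%:R u; rewrite sech_fourierE => h.
transitivity (2 * p u * (sinh u * \int[mu]_(v in `]0, +oo[) (sin (n%:R * v) * (sinh v / (sinh v ^+ 2 + cosh u ^+ 2)))));
  first by field.
rewrite h; move: (cosh_gt0 (n%:R * (pi / 2) : R)).
move: (cosh (n%:R * (pi / 2) : R)) (pi : R) => c q c0.
by field; rewrite lt0r_neq0.
Qed.

(** The retraction of the line onto [- pi, pi], written with absolute values so that oddness and the
    Lipschitz constant 1 are immediate. Regularity is known on that interval, while the Fourier
    lemmas ask for functions bounded and measurable on the whole line. *)
Definition clamp u := (`|u + pi| - `|u - pi|) / 2.

Lemma clampE u : - pi <= u <= pi -> clamp u = u.
Proof.
move=> /andP[u0 u1]; rewrite /clamp ger0_norm ?ler0_norm; [|lra|lra].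
by rewrite opprB; move: (pi : R) => q; field.
Qed.

Lemma clampN u : clamp (- u) = - clamp u.
Proof.
rewrite /clamp; have -> : - u + pi = - (u - pi) by ring.
have -> : - u - pi = - (u + pi) by ring.
by rewrite !normrN; ring.
Qed.

Lemma clamp_itv u : - pi <= clamp u <= pi.
Proof.
have pi0 := @pi_gt0 R.
have : `| `|u + pi| - `|u - pi| | <= `|(u + pi) - (u - pi)| by exact: ler_dist_dist.
have -> : u + pi - (u - pi) = 2 * pi by ring.
rewrite [`|2 * pi|]ger0_norm; last by rewrite mulr_ge0// ltW.
by rewrite ler_norml /clamp => /andP[h1 h2]; apply/andP; split; lra.
Qed.

Lemma clamp_lip u v : `|clamp u - clamp v| <= `|u - v|.
Proof.
have h1 : `| `|u + pi| - `|v + pi| | <= `|(u + pi) - (v + pi)| by exact: ler_dist_dist.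
have h2 : `| `|u - pi| - `|v - pi| | <= `|(u - pi) - (v - pi)| by exact: ler_dist_dist.
move: h1 h2; have -> : u + pi - (v + pi) = u - v by ring.
have -> : u - pi - (v - pi) = u - v by ring.
rewrite !ler_norml /clamp => /andP[h1 h2] /andP[h3 h4]; apply/andP; split; lra.
Qed.

Section real_inversion.
Variables (psi : R -> R) (C : R).
Hypothesis C0 : 0 <= C.
Hypothesis lip : forall u v, - pi <= u <= pi -> - pi <= v <= pi ->
  `|psi u - psi v| <= C * `|u - v|.
Hypothesis per : psi (- pi) = psi pi.

Let p u := psi (clamp u).

Let bp : bounded_mfun p.
Proof.
have pl u v : `|p u - p v| <= C * `|u - v|.
  apply: le_trans (lip (clamp_itv u) (clamp_itv v)) _.
  by rewrite ler_wpM2l// clamp_lip.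
split.
  apply: continuous_measurable_fun => u; apply/cvgrPdist_lt => e e0.
  have e1 : 0 < e / (C + 1) by rewrite divr_gt0// ltr_wpDl.
  have eE : (C + 1) * (e / (C + 1)) = e by field; rewrite lt0r_neq0// ltr_wpDl.
  apply/nbhs_ballP; exists (e / (C + 1)) => //= v; rewrite /ball/= => h.
  apply: (le_lt_trans (pl u v)); have := ler_wpM2l C0 (ltW h); lra.
exists (`|psi 0| + C * pi) => u.
have z0 : - pi <= (0 : R) <= pi by rewrite oppr_le0 !pi_ge0.
have := lip (clamp_itv u) z0; rewrite subr0 => h.
have cl : `|clamp u| <= pi by rewrite ler_norml clamp_itv.
have := ler_wpM2l C0 cl; have := ler_normD (psi (clamp u) - psi 0) (psi 0).
by rewrite subrK /p; lra.
Qed.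

(** Re K_0 times sinh, clamped; it stays odd because [clamp] is odd. *)
Let q x u := K0r (cosh (clamp u)) x * sinh (clamp u).

Let mclamp : measurable_fun setT clamp.
Proof. by rewrite /clamp; mfun. Qed.

Let bq x : 0 < x -> bounded_mfun (q x).
Proof.
move=> x0; split.
  apply: mfunM; last exact: mfun_sinh.
  apply: (measurableT_comp (@measurable_K0r R) (_ : measurable_fun setT (fun u => (cosh (clamp u), x)))).
  by apply: measurable_fun_pair; [exact: mfun_cosh|exact: mfun_cst].
exists (K0_bound (4 * c4 * Num.sqrt 1 * Num.sqrt x) * cosh pi) => u; rewrite /q normrM.
by apply: ler_pM => //; [exact: K0r_cosh_le|exact: abs_sinh_le_pi (clamp_itv u)].
Qed.

Let q_odd x u : q x (- u) = - q x u.
Proof. by rewrite /q clampN coshN sinhN mulrN. Qed.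

Lemma RI_even (f : R -> R) : bounded_mfun f -> (forall u, f (- u) = f u) ->
  \int[mu]_(u in `[0, pi]) f u = 2^-1 * \int[mu]_(u in I) f u.
Proof.
move=> bf fE; have pi0 := @pi_gt0 R.
have fi : mu.-integrable setT (EFin \o (f \_ I)).
  rewrite -restrict_EFin; apply: (integrable_mkcond _ _).1 => //.
  exact: bounded_mfun_integrable.
rewrite [in RHS]Rintegral_mkcond (Rintegral_even fi) => [|u]; last first.
  rewrite !patchE fE; have -> // : (- u \in I) = (u \in I).
  by apply/idP/idP => /set_mem/=; rewrite in_itv/= => ?; apply/mem_set; rewrite /= in_itv/=; lra.
rewrite mulrA mulVf// mul1r -Rintegral_mkcondr -Rintegral_itv_obnd_cbnd; last first.
  apply: integrableS (bounded_mfun_integrable bf) => //.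
  by apply: subset_itv; rewrite bnd_simp//; lra.
congr (Rintegral mu _ f); apply/seteqP; split=> u /=; rewrite !in_itv/= andbT.
  by move=> /andP[u0 u1]; rewrite u0 u1; split => //; lra.
by move=> [-> /andP[_ ->]].
Qed.

(** The coefficient a_n attached to a real-valued [psi]. *)
Definition coef n := (sinh (pi * n%:R / 2))^-1 *
  \int[mu]_(x in `]0, +oo[) (JK n%:R (2 * x) * ftrans psi x).

Lemma sinh_double (b : R) : sinh (2 * b) = 2 * sinh b * cosh b.
Proof.
have -> : 2 * b = b + b by ring.
by rewrite /sinh /cosh opprD !expRD; field.
Qed.

Lemma real_inversion x : 0 < x ->
  (fun N : nat => - (32 / pi ^+ 2) * \sum_(1 <= n < N.+1)
     (sinh (pi * n%:R) * \int[mu]_(u in `[0, pi]) (K0r (cosh u) x * sinh u * sin (n%:R * u)) * coef n))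
  @ \oo --> ftrans psi x.
Proof.
move=> x0; have pi0 := lt0r_neq0 (@pi_gt0 R).
have pE u : u \in I -> p u = psi u.
  by move=> /set_mem/=; rewrite in_itv/= => uI; rewrite /p clampE.
have fE : ftrans psi = ftrans p.
  by apply/funext => y; rewrite /ftrans; congr (_ * _); apply: eq_Rintegral => u uI; rewrite (pE u uI).
have p_per : p (- pi) = p pi.
  by rewrite /p !clampE//; have := @pi_gt0 R; lra.
have p_lip u v : - pi <= u <= pi -> - pi <= v <= pi -> `|p u - p v| <= C * `|u - v|.
  by move=> uI vI; rewrite /p !clampE//; exact: lip.
have H := parseval_sine C0 bp.1 p_lip p_per bp (bq x0) (q_odd x).
(* The two factors pi undo 1 / pi^2: one comes from the coefficients through [JK_ftrans], the other
   from the normalisation in [parseval_sine]. *)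
have -> : ftrans psi x = - (32 / pi ^+ 2) * (pi * (pi * \int[mu]_(u in I) (q x u * p u))).
  have -> : \int[mu]_(u in I) (q x u * p u) = \int[mu]_(u in I) (K0r (cosh u) x * p u * sinh u).
    apply: eq_Rintegral => u /set_mem/=; rewrite in_itv/= => uI.
    by rewrite /q clampE//; ring.
  rewrite fE /ftrans; move: pi0; move: (pi : R) (\int[mu]_(_ in _) _) => a b a0.
  by field.
apply: cvgM; first exact: cvg_cst.
rewrite (_ : (fun N => _) = fun N => pi * \sum_(1 <= n < N.+1)
  (\int[mu]_(u in I) (q x u * sin (n%:R * u))) * (\int[mu]_(t in I) (p t * sin (n%:R * t)))).
  by apply: cvgM; [exact: cvg_cst|exact: H].
apply/funext => N; rewrite mulr_sumr big_nat [RHS]big_nat; apply: eq_bigr => n /andP[n1 _].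
have bqs : bounded_mfun (fun u => q x u * sin (n%:R * u)).
  by apply: bounded_mfunM; [exact: bq|apply: bounded_mfun_sin; mfun].
have -> : \int[mu]_(u in `[0, pi]) (K0r (cosh u) x * sinh u * sin (n%:R * u)) =
    2^-1 * \int[mu]_(u in I) (q x u * sin (n%:R * u)).
  rewrite -(RI_even bqs) => [|u]; last by rewrite q_odd mulrN sinN mulrNN.
  apply: eq_Rintegral => u /set_mem/=; rewrite in_itv/= => /andP[u0 u1].
  by rewrite /q clampE//; apply/andP; split => //; have := @pi_gt0 R; lra.
have -> : coef n = (sinh (pi * n%:R / 2))^-1 * (pi / cosh (n%:R * (pi / 2)) *
    \int[mu]_(t in I) (p t * sin (n%:R * t))).
  by rewrite /coef fE (JK_ftrans n bp).
have -> : pi * n%:R / 2 = n%:R * (pi / 2) :> R by ring.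
have -> : pi * n%:R = 2 * (n%:R * (pi / 2)) :> R by field.
(* With b = pi n / 2, sinh(2 b) = 2 sinh b cosh b cancels the sinh b of [coef], the cosh b of the
   sech transform and the 1/2 from halving the interval. Positivity of b uses that the sum starts at
   1. *)
rewrite sinh_double.
have b0 : 0 < n%:R * (pi / 2) :> R by rewrite mulr_gt0 ?ltr0n// divr_gt0// pi_gt0.
move: (lt0r_neq0 (sinh_gt0 b0)) (lt0r_neq0 (cosh_gt0 (n%:R * (pi / 2) : R))).
move: (sinh (n%:R * (pi / 2) : R)) (cosh (n%:R * (pi / 2) : R)) (pi : R) => s c r s0 c0.
move: (\int[mu]_(u in I) (q x u * sin (n%:R * u))) (\int[mu]_(t in I) (p t * sin (n%:R * t))) => A B.
by field; rewrite s0 c0.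
Qed.

End real_inversion.

End transform.

Section complex_components.
Context {R : realType}.
Notation mu := (@lebesgue_measure R).

Lemma normC_Re (z : R[i]) : `|complex.Re z|%:C <= `|z|.
Proof.
case: z => a b; rewrite normc_def lecR /= -sqrtr_sqr ler_wsqrtr// lerDl sqr_ge0//.
Qed.

Lemma normC_Im (z : R[i]) : `|complex.Im z|%:C <= `|z|.
Proof.
case: z => a b; rewrite normc_def lecR /= -sqrtr_sqr ler_wsqrtr// lerDr sqr_ge0//.
Qed.

End complex_components.

Theorem theorem6 (R : realType) (psi : R -> R[i])
  (psi_periodic : periodic psi (2 * pi))
  (psi_lipschitz : exists C : R, 0 < C /\
     forall u v : R, -pi <= u <= pi -> -pi <= v <= pi ->
       `|psi u - psi v| <= (C * `|u - v|)%:C)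
  (f : R -> R[i])
  (f_def : forall x : R, 0 < x ->
     f x = - 32 * Cintegral `[- pi, pi]
                    (fun u => (ReK0 x u)%:C * psi u * (sinh u)%:C))
  (a : nat -> R[i])
  (a_def : forall n : nat, (1 <= n)%N ->
     a n = ((sinh (pi * n%:R / 2))^-1)%:C *
       Cintegral `]0, +oo[
         (fun x => (complex.Im (besselJ ('i%C * n%:R) (2 * Num.sqrt (2 * x))))%:C
                   * besselK ('i%C * n%:R) (2 * Num.sqrt (2 * x))%:C
                   * f x))
  (Omega : nat -> R -> R)
  (Omega_def : forall (n : nat) (x : R), (1 <= n)%N -> 0 < x ->
     Omega n x = \int[lebesgue_measure]_(u in `[0, pi])
                   (ReK0 x u * sinh u * sin (n%:R * u))) :
  forall x : R, 0 < x ->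
    (fun N : nat => (- (32 / pi ^+ 2))%:C *
       \sum_(1 <= n < N.+1) (sinh (pi * n%:R) * Omega n x)%:C * a n)
    @ \oo --> f x.
Proof.
move=> x x0; have [C [C0 lip]] := psi_lipschitz.
(* All kernels are real, so f, a_n and the series split into real and imaginary parts, each inverted
   by [real_inversion] with the same constant C. *)
pose p1 u := complex.Re (psi u); pose p2 u := complex.Im (psi u).
have lip1 u v : - pi <= u <= pi -> - pi <= v <= pi -> `|p1 u - p1 v| <= C * `|u - v|.
  move=> uI vI; rewrite -lecR; apply: le_trans (lip u v uI vI).
  by rewrite -[p1 u - p1 v]/(complex.Re (psi u) - complex.Re (psi v)) -raddfB; exact: normC_Re.
have lip2 u v : - pi <= u <= pi -> - pi <= v <= pi -> `|p2 u - p2 v| <= C * `|u - v|.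
  move=> uI vI; rewrite -lecR; apply: le_trans (lip u v uI vI).
  by rewrite -[p2 u - p2 v]/(complex.Im (psi u) - complex.Im (psi v)) -raddfB; exact: normC_Im.
have per : psi (- pi) = psi pi.
  by rewrite -(psi_periodic (- pi)); congr psi; ring.
have per1 : p1 (- pi) = p1 pi by rewrite /p1 per.
have per2 : p2 (- pi) = p2 pi by rewrite /p2 per.
have fE y : 0 < y -> f y = ftrans p1 y +i* ftrans p2 y.
  move=> y0; rewrite f_def// /Cintegral natCE.
  have -> : \int[lebesgue_measure]_(u in `[- pi, pi]) complex.Re ((ReK0 y u)%:C * psi u * (sinh u)%:C) =
      \int[lebesgue_measure]_(u in `[- pi, pi]) (K0r (cosh u) y * p1 u * sinh u).
    by apply: eq_Rintegral => u _; rewrite ReK0E// /p1; case: (psi u) => c d /=; ring.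
  have -> : \int[lebesgue_measure]_(u in `[- pi, pi]) complex.Im ((ReK0 y u)%:C * psi u * (sinh u)%:C) =
      \int[lebesgue_measure]_(u in `[- pi, pi]) (K0r (cosh u) y * p2 u * sinh u).
    by apply: eq_Rintegral => u _; rewrite ReK0E// /p2; case: (psi u) => c d /=; ring.
  by apply/eqP; rewrite eq_complex/= /ftrans; apply/andP; split; apply/eqP; ring.
have aE n : (1 <= n)%N -> a n = coef p1 n +i* coef p2 n.
  move=> n1; rewrite a_def// /Cintegral.
  have E y : 0 < y -> (complex.Im (besselJ ('i%C * n%:R) (2 * Num.sqrt (2 * y))))%:C
      * besselK ('i%C * n%:R) (2 * Num.sqrt (2 * y))%:C * f y =
      (JK n%:R (2 * y) * ftrans p1 y) +i* (JK n%:R (2 * y) * ftrans p2 y).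
    move=> y0; have Y0 : 0 < 2 * y by rewrite mulr_gt0.
    rewrite Im_besselJ// besselK_imag// fE// /JK.
    by apply/eqP; rewrite eq_complex/=; apply/andP; split; apply/eqP; ring.
  have -> : \int[lebesgue_measure]_(y in `]0, +oo[) complex.Re
      ((complex.Im (besselJ ('i%C * n%:R) (2 * Num.sqrt (2 * y))))%:C
      * besselK ('i%C * n%:R) (2 * Num.sqrt (2 * y))%:C * f y) =
      \int[lebesgue_measure]_(y in `]0, +oo[) (JK n%:R (2 * y) * ftrans p1 y).
    by apply: eq_Rintegral => y; rewrite mem_itv0y => y0; rewrite E.
  have -> : \int[lebesgue_measure]_(y in `]0, +oo[) complex.Im
      ((complex.Im (besselJ ('i%C * n%:R) (2 * Num.sqrt (2 * y))))%:C
      * besselK ('i%C * n%:R) (2 * Num.sqrt (2 * y))%:C * f y) =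
      \int[lebesgue_measure]_(y in `]0, +oo[) (JK n%:R (2 * y) * ftrans p2 y).
    by apply: eq_Rintegral => y; rewrite mem_itv0y => y0; rewrite E.
  by rewrite complexZ.
pose Om n := \int[lebesgue_measure]_(u in `[0, pi]) (K0r (cosh u) x * sinh u * sin (n%:R * u)).
have OE n : (1 <= n)%N -> Omega n x = Om n.
  by move=> n1; rewrite Omega_def//; apply: eq_Rintegral => u _; rewrite ReK0E.
rewrite fE//.
rewrite (_ : (fun N => _) = fun N =>
  (- (32 / pi ^+ 2) * \sum_(1 <= n < N.+1) (sinh (pi * n%:R) * Om n * coef p1 n)) +i*
  (- (32 / pi ^+ 2) * \sum_(1 <= n < N.+1) (sinh (pi * n%:R) * Om n * coef p2 n))).
  apply: cvg_complex; exact: real_inversion (ltW C0) _ _ _ _.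
apply/funext => N.
have -> : \sum_(1 <= n < N.+1) (sinh (pi * n%:R) * Omega n x)%:C * a n =
    (\sum_(1 <= n < N.+1) (sinh (pi * n%:R) * Om n * coef p1 n)) +i*
    (\sum_(1 <= n < N.+1) (sinh (pi * n%:R) * Om n * coef p2 n)).
  elim: N => [|N IH]; first by rewrite big_geq// [X in _ = X +i* _]big_geq// [X in _ = _ +i* X]big_geq.
  rewrite big_nat_recr//= IH aE// OE//.
  rewrite [X in _ = X +i* _]big_nat_recr//= [X in _ = _ +i* X]big_nat_recr//=.
  by rewrite complexZ.
by rewrite complexZ.
Qed.
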